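(* Let $n\ge 3$, let $q_*=\frac{2n}{n-2}$, let $2<q\le q_*$, and let $0<a<\frac{n-2}{2}$. Set $\alpha=\frac{q}{q-2}$, \[ C_q=\left[\frac{2\pi^{n/2}}{\Gamma(n/2)}\right]^{1/\alpha}\left(\frac{q}{2}\right)^{2/q}\left[\frac{\Gamma(\alpha)\Gamma(\alpha+1)}{\Gamma(2\alpha)}\right]^{1/\alpha}, \qquad D_{q,a}=(n-2-2a)^{\frac{2}{q}+1}\,C_q . \] Then for every Schwartz function $f\in\mathcal S(\mathbb R^n)$, \[ \int_{\mathbb R^n}|\nabla f|^2\,dx\;\ge\;a(n-2-a)\int_{\mathbb R^n}\frac{1}{|x|^2}|f|^2\,dx\;+\;D_{q,a}\left[\int_{\mathbb R^n}|x|^{-n(q_*-q)/q_*}|f|^q\,dx\right]^{2/q}. \] *)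

(* Defs.v *)
From HB Require Import structures.
From mathcomp Require Import all_boot all_order all_algebra.
From mathcomp Require Import all_classical all_reals all_analysis.
Set Implicit Arguments. Unset Strict Implicit. Unset Printing Implicit Defensive.
Import Order.TTheory GRing.Theory Num.Theory.
Import numFieldNormedType.Exports.
Local Open Scope classical_set_scope.
Local Open Scope ring_scope.

Section Defs.
Variable R : realType.

(* Euclidean norm on R^n = 'rV[R]_n (the library norm on matrices is the sup norm) *)
Definition enorm n (x : 'rV[R]_n) : R := Num.sqrt (\sum_i (x ord0 i) ^+ 2).

Definition ebasis n (i : 'I_n) : 'rV[R]_n := delta_mx ord0 i.

Definition partial n (i : 'I_n) (g : 'rV[R]_n -> R) : 'rV[R]_n -> R :=
  fun x => 'D_(ebasis i) g x.

Fixpoint dpart n (s : seq 'I_n) (g : 'rV[R]_n -> R) : 'rV[R]_n -> R :=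
  match s with
  | [::] => g
  | i :: s' => partial i (dpart s' g)
  end.

Definition schwartz n (g : 'rV[R]_n -> R) : Prop :=
  (forall (s : seq 'I_n) (i : 'I_n) (x : 'rV[R]_n),
      derivable (dpart s g) x (ebasis i)) /\
  (forall (s : seq 'I_n) (N : nat), exists C : R,
      forall x : 'rV[R]_n, (1 + enorm x) ^+ N * `|dpart s g x| <= C).

Definition grad_sq n (g : 'rV[R]_n -> R) (x : 'rV[R]_n) : R :=
  \sum_i (partial i g x) ^+ 2.

Definition upd n (x : 'rV[R]_n) (k : nat) (t : R) : 'rV[R]_n :=
  \row_j (if nat_of_ord j == k then t else x ord0 j).

Fixpoint iint n (k : nat) (g : 'rV[R]_n -> \bar R) (x : 'rV[R]_n) : \bar R :=
  match k with
  | 0 => g x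
  | k'.+1 => (\int[@lebesgue_measure R]_(t in [set: R]) iint k' g (upd x k' t))%E
  end.

(* Lebesgue integral over R^n of a nonnegative function (Tonelli: iterated
   integrals of nonnegative measurable functions) *)
Definition integral_Rn n (g : 'rV[R]_n -> \bar R) : \bar R := iint n g 0.

Definition Gamma (s : R) : R :=
  fine (\int[@lebesgue_measure R]_(t in [set t : R | (0 < t)%R])
          (powR t (s - 1) * expR (- t))%R%:E)%E.

End Defs.

(* Main.v *)
Require Import Defs.
From HB Require Import structures.
From mathcomp Require Import all_boot all_order all_algebra finmap.
From mathcomp Require Import all_classical all_reals all_analysis.
From mathcomp Require Import measurable_realfun gauss_integral lra ring.
Set Implicit Arguments. Unset Strict Implicit. Unset Printing Implicit Defensive.
Import Order.TTheory GRing.Theory Num.Theory.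
Import numFieldNormedType.Exports.
Local Open Scope classical_set_scope.
Local Open Scope ring_scope.

(* Let g = |f|^2 and let gs be its decreasing rearrangement, viewed as a function
   of the volume v = omega r^n.  By Hardy-Littlewood, both weighted integrals on
   the right-hand side increase when g is replaced by gs.  The energy is not
   rearranged: for lam >= 0 one has |grad f|^2 >= lam |grad g| - lam^2 g, and the
   isoperimetric inequality for the superlevel sets of g (Brunn-Minkowski, from
   Prekopa-Leindler) bounds the integral of lam(g) |grad g| from below.  Taking
   lam = psi / r, where r is the radius of the ball with the volume of the level
   set, yields for every nonnegative nondecreasing psi
     int |grad f|^2 >= sigma int (psi r^(n-2))' gs - int psi^2 r^(-2) gs.
   Now choose psi = (n-2)/2 + m Theta with m = (n-2-2a)/2, where Theta transports
   the density r^(-s) gs^(q/2) to the weight (1 - y^2)^(alpha-1) on (-1, 1).  The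
   identity (n-2) psi - psi^2 = a (n-2-a) + m^2 (1 - Theta^2) produces the Hardy
   term, and a pointwise weighted AM-GM with exponents 2/q and 1/alpha turns the
   remaining two terms into the Sobolev term, the powers of 1 - Theta^2
   cancelling.  The total mass of the weight is a beta integral, which gives the
   Gamma factors of the constant. *)

(** * Lebesgue measure on row vectors *)

(** The gradient is reached through collars of finite width [e]: a Taylor bound for [|f|^2] whose
    error is [O(e^2)] times a fixed integrable weight turns the volume bound of Brunn-Minkowski into
    a bound for the integral of [lam(g) |grad g|] as [e] tends to 0. That limit requires [lam] to be
    a Lipschitz function of the value of [g], whereas [psi / r] is a function of the volume and may
    jump, as a function of the level, wherever [gs] has a plateau. It is therefore approached from
    below by Lipschitz functions, and the limit is attained at all levels except the countably many
    plateau values. Plateaus are the only irregularity: [g] is continuous and tends to 0, so the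
    volume of its superlevel sets decreases strictly while positive, and [gs] is continuous. The
    numbers [a] and [n-2-a] are symmetric about [(n-2)/2], at distance [m]. Hence [psi] moves
    between the two roots of [psi^2 - (n-2) psi + a (n-2-a)]; this is where the Hardy constant comes
    from, and why [psi] is positive. The weight exponent of the Sobolev term is the one for which
    the geometric mean in AM-GM is again a multiple of the transported density. *)

Section measurable_rV.
Context {R : realType} {n : nat}.

Let coors : 'I_n -> 'rV[R]_n -> R := fun i x => x ord0 i.

Let rV_set0 : g_sigma_preimage coors set0.
Proof. exact: sigma_algebra0. Qed.

Let rV_setC A : g_sigma_preimage coors A -> g_sigma_preimage coors (~` A).
Proof. exact: sigma_algebraC. Qed.

Let rV_bigcup (F : _^nat) : (forall i, g_sigma_preimage coors (F i)) ->
  g_sigma_preimage coors (\bigcup_i (F i)).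
Proof. exact: sigma_algebra_bigcup. Qed.

(** The sigma-algebra generated by the coordinates: a map into row vectors is measurable as soon as
    its coordinates are, which suits [upd]. *)
HB.instance Definition _ := @isMeasurable.Build (measure_tuple_display default_measure_display)
  'rV[R]_n (g_sigma_preimage coors) rV_set0 rV_setC rV_bigcup.

Lemma measurable_coord (i : 'I_n) :
  measurable_fun [set: 'rV[R]_n] (fun x => x ord0 i).
Proof.
move=> _ Y mY; rewrite setTI; apply: sub_sigma_algebra => /=.
rewrite -bigcup_seq/=; exists i => /=; first by rewrite mem_index_enum.
by exists Y => //; rewrite setTI.
Qed.

Lemma measurable_fun_rV d (T : measurableType d) (f : T -> 'rV[R]_n) :
  (forall i, measurable_fun [set: T] (fun t => f t ord0 i)) ->
  measurable_fun [set: T] f.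
Proof.
move=> mf; apply: (@measurability _ _ _ _ _ _ (\big[setU/set0]_(i < n) preimage_set_system setT (coors i) measurable)) => //.
move=> Z [A]; rewrite -bigcup_seq/= => -[i _ [B mB <-]] <-.
have := mf i measurableT B mB.
by rewrite !setTI.
Qed.

Lemma measurable_upd k :
  measurable_fun [set: 'rV[R]_n * R] (fun z => upd z.1 k z.2).
Proof.
apply: measurable_fun_rV => i.
rewrite (_ : (fun _ => _) = fun z : 'rV[R]_n * R =>
    if nat_of_ord i == k then z.2 else z.1 ord0 i); last first.
  by apply/funext => z; rewrite mxE.
case: (nat_of_ord i == k); first exact: measurable_snd.
exact: (measurableT_comp (measurable_coord i)).
Qed.

End measurable_rV.

(** * Iterated integrals and the volume measure *)

Section iint.
Context {R : realType} {n : nat}.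
Local Open Scope ereal_scope.
Implicit Types g : 'rV[R]_n -> \bar R.

Lemma iint_ge0 k g x : (forall x, 0 <= g x) -> 0 <= iint k g x.
Proof. by move=> g0; elim: k x => //= k IH x; exact: integral_ge0. Qed.

Lemma iint0 k (x : 'rV[R]_n) : iint k (cst 0) x = 0.
Proof. by elim: k x => //= k IH x; apply: integral0_eq => t _; rewrite IH. Qed.

(** Partial integrals remain functions of the whole vector, constant in the coordinates already
    integrated, so each induction step is one use of Tonelli on the pair formed by the vector and
    the new coordinate. *)
Lemma measurable_iint k g : measurable_fun setT g -> (forall x, 0 <= g x) ->
  measurable_fun setT (iint k g).
Proof.
move=> mg g0; elim: k => //= k IH.
apply: (@measurable_fun_fubini_tonelli_F _ _ _ _ _ (@lebesgue_measure R)
   (fun z : 'rV[R]_n * R => iint k g (upd z.1 k z.2))) => //=.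
- exact: (measurableT_comp IH (measurable_upd k)).
- by move=> z; exact: iint_ge0.
Qed.

Lemma measurable_iint_upd k j g x : measurable_fun setT g -> (forall x, 0 <= g x) ->
  measurable_fun setT (fun t => iint k g (upd x j t)).
Proof.
move=> mg g0; apply: (measurableT_comp (measurable_iint k mg g0)).
apply: (@measurableT_comp _ _ _ _ _ _ (fun z : 'rV[R]_n * R => upd z.1 j z.2)
  _ (fun t => (x, t))); first exact: measurable_upd.
exact: pair1_measurable.
Qed.

Lemma le_iint k g1 g2 x : measurable_fun setT g1 -> measurable_fun setT g2 ->
  (forall x, 0 <= g1 x) -> (forall x, g1 x <= g2 x) ->
  iint k g1 x <= iint k g2 x.
Proof.
move=> m1 m2 g10 g12.
have g20 y : 0 <= g2 y by exact: le_trans (g12 y).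
elim: k x => //= k IH x; apply: ge0_le_integral => //.
- by move=> t _; exact: iint_ge0.
- exact: measurable_iint_upd.
- exact: measurable_iint_upd.
Qed.

Lemma iintZl k (c : R) g x : (0 <= c)%R -> measurable_fun setT g ->
  (forall x, 0 <= g x) -> iint k (fun x => c%:E * g x) x = c%:E * iint k g x.
Proof.
move=> c0 mg g0; elim: k x => //= k IH x.
under eq_integral do rewrite IH.
rewrite ge0_integralZl_EFin//; last exact: measurable_iint_upd.
by move=> t _; exact: iint_ge0.
Qed.

Lemma iint_nneseries k (g : nat -> 'rV[R]_n -> \bar R) x :
  (forall i, measurable_fun setT (g i)) -> (forall i x, 0 <= g i x) ->
  iint k (fun x => \sum_(i <oo) g i x) x = \sum_(i <oo) iint k (g i) x.
Proof.
move=> mg g0; elim: k x => //= k IH x.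
under eq_integral do rewrite IH.
rewrite integral_nneseries//.
- by move=> i; exact: measurable_iint_upd.
- by move=> i t _; exact: iint_ge0.
Qed.

Lemma iint_sum k (I : Type) (s : seq I) (g : I -> 'rV[R]_n -> \bar R) x :
  (forall i, measurable_fun setT (g i)) -> (forall i x, 0 <= g i x) ->
  iint k (fun x => \sum_(i <- s) g i x) x = \sum_(i <- s) iint k (g i) x.
Proof.
move=> mg g0; elim: k x => //= k IH x.
under eq_integral do rewrite IH.
rewrite ge0_integral_sum//.
- by move=> i; exact: measurable_iint_upd.
- by move=> i t _; exact: iint_ge0.
Qed.

Lemma iint_monotone k (g : nat -> 'rV[R]_n -> \bar R) x :
  (forall i, measurable_fun setT (g i)) -> (forall i x, 0 <= g i x) ->
  (forall x, nondecreasing_seq (g ^~ x)) ->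
  iint k (fun x => limn (g ^~ x)) x = limn (fun i => iint k (g i) x).
Proof.
move=> mg g0 ndg; elim: k x => //= k IH x.
under eq_integral do rewrite IH.
rewrite monotone_convergence//.
- by move=> i; exact: measurable_iint_upd.
- by move=> i t _; exact: iint_ge0.
- by move=> t _ a b ab; apply: le_iint => // y; exact: ndg.
Qed.

(** Once shown to be countably additive, this is Lebesgue measure, and the iterated integrals of the
    theorem become integrals against a measure, open to Tonelli, push-forward and convergence
    theorems; [integral_RnE] is the bridge. *)
Definition rvol (A : set 'rV[R]_n) : \bar R := integral_Rn (fun x => (\1_A x)%:E).

Let rvol0 : rvol set0 = 0.
Proof.
rewrite /rvol (_ : (fun _ => _) = cst 0); first exact: iint0.
by apply/funext => x; rewrite indic0.
Qed.

Let rvol_ge0 A : 0 <= rvol A.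
Proof. by apply: iint_ge0 => x; rewrite lee_fin. Qed.

Let rvol_sigma_additive : semi_sigma_additive rvol.
Proof.
move=> F mF tF mUF; rewrite [X in _ --> X](_ : _ =
    \sum_(i <oo) rvol (F i)); last first.
  rewrite /rvol /integral_Rn -iint_nneseries//; last first.
    by move=> i; apply/measurable_EFinP; exact: measurable_indic.
  rewrite (_ : (fun _ => (\1_(\bigcup_n F n) _)%:E) =
    fun x => \big[+%E/0%R]_(0 <= i <oo) (\1_(F i) x)%:E)//.
  by apply/funext => x; rewrite indic_bigcup.
by apply: is_cvg_nneseries => i _ _.
Qed.

HB.instance Definition _ := isMeasure.Build _ _ _ rvol rvol0 rvol_ge0 rvol_sigma_additive.

Import HBNNSimple.

Lemma integral_Rn_nnsfun (f : {nnsfun 'rV[R]_n >-> R}) :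
  integral_Rn (fun x => (f x)%:E) = \int[rvol]_x (f x)%:E.
Proof.
transitivity (\sum_(r \in range f) r%:E * rvol (f @^-1` [set r])).
  rewrite /integral_Rn (_ : (fun x => (f x)%:E) =
      fun x => \sum_(r <- fset_set (range f)) (r * \1_(f @^-1` [set r]) x)%:E); last first.
    by apply/funext => x; rewrite sumEFin fimfunE fsbig_finite.
  rewrite iint_sum; last 2 first.
  - by move=> r; exact/measurable_EFinP/measurable_funM.
  - by move=> r x; rewrite nnfun_muleindic_ge0.
  rewrite fsbig_finite//=; apply: eq_bigr => r _.
  have [r0|r0] := leP 0%R r.
    rewrite -[LHS]/(iint n (fun x => r%:E * (\1_(f @^-1` [set r]) x)%:E) 0%R).
    by rewrite iintZl//; exact/measurable_EFinP/measurable_indic.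
  rewrite preimage_nnfun0// measure0 mule0.
  rewrite (_ : (fun _ => _) = cst 0); first exact: iint0.
  by apply/funext => x; rewrite indic0 mulr0.
under eq_integral do rewrite fimfunE -fsumEFin//.
rewrite ge0_integral_fsum//; last 2 first.
- by move=> y; exact/measurable_EFinP/measurable_funM.
- by move=> y x _; rewrite nnfun_muleindic_ge0.
apply: eq_fsbigr => r _; rewrite integralZl_indic_nnsfun// integral_indic//=.
by rewrite setIT.
Qed.

(** Both sides agree on simple functions by linearity, and both commute with increasing limits. *)
Lemma integral_RnE g : measurable_fun setT g -> (forall x, 0 <= g x) ->
  integral_Rn g = \int[rvol]_x g x.
Proof.
move=> mg g0; pose f := nnsfun_approx measurableT mg.
have gE : g = fun x => limn (fun i => (f i x)%:E).
  by apply/funext => x; apply/esym/cvg_lim => //; exact: cvg_nnsfun_approx.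
have mf i : measurable_fun setT (fun x => (f i x)%:E) by exact/measurable_EFinP.
have f0 i x : 0 <= (f i x)%:E by rewrite lee_fin.
have ndf x : nondecreasing_seq (fun i => (f i x)%:E).
  by move=> a b ab; rewrite lee_fin; exact/lefP/nd_nnsfun_approx.
rewrite {1}gE /integral_Rn (@iint_monotone n (fun i x => (f i x)%:E))//.
rewrite [in RHS]gE monotone_convergence//.
by congr (limn _); apply/funext => i; exact: integral_Rn_nnsfun.
Qed.

End iint.

Section rvol_theory.
Context {R : realType} {n : nat}.
Implicit Types (x : 'rV[R]_n) (A : set 'rV[R]_n).

Lemma measurable_ball_rV x (e : R) : measurable (ball x e).
Proof.
have [e0|e0] := ltP 0 e; last first.
  rewrite (_ : ball x e = set0)//; apply/seteqP; split => // y [].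
  by rewrite ltNge e0.
rewrite (_ : ball x e = \bigcap_(i in [set: 'I_n]) (fun y => y ord0 i) @^-1` (ball (x ord0 i) e)).
  apply: fin_bigcap_measurable => // i _.
  by rewrite -[X in measurable X]setTI; apply: measurable_coord => //; exact: measurable_ball.
apply/seteqP; split=> [y [_ xy] i _|y xy]; first exact: xy.
by split=> // i j; rewrite (ord1 i); exact: xy.
Qed.

(** Balls of the matrix norm are boxes, hence measurable, and an open set is the union of the
    countably many balls of rational centre and radius [1 / (k+1)] that it contains. *)
Lemma open_measurable_rV A : open A -> measurable A.
Proof.
move=> oA.
pose B (z : 'rV[rat]_n * nat) : set 'rV[R]_n :=
  let b := ball (map_mx ratr z.1 : 'rV[R]_n) (z.2.+1%:R^-1) in
  if `[< b `<=` A >] then b else set0.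
rewrite (_ : A = \bigcup_z B z).
  apply: countable_bigcupT_measurable => // z; rewrite /B.
  by case: ifP => // _; exact: measurable_ball_rV.
apply/seteqP; split=> [x Ax|x [z _]]; last first.
  by rewrite /B; case: ifPn => // /asboolP; exact.
have /nbhs_ballP [e /= e0 eA] : nbhs x A by exact: open_nbhs_nbhs.
have [k ke] : exists k, k.+1%:R^-1 < e / 2 :> R.
  have := near_infty_natSinv_lt (PosNum (divr_gt0 e0 (ltr0n R 2))).
  by move=> [k _ /(_ k (leqnn k)) /=]; exists k.
have kp : 0 < k.+1%:R^-1 :> R by rewrite invr_gt0.
have qx (i : 'I_n) : exists q : rat, ball (x ord0 i) (k.+1%:R^-1) (ratr q : R).
  have [|y [xy [q _ qy]]] := @dense_rat R (ball (x ord0 i) (k.+1%:R^-1)) _ (ball_open _ _).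
    by exists (x ord0 i); exact: ballxx.
  by exists q; rewrite qy.
have {qx} [q qx] := choice qx.
exists (\row_i q i, k) => //; rewrite /B /=.
have bx : ball (map_mx ratr (\row_i q i) : 'rV[R]_n) k.+1%:R^-1 x.
  by split => // i j; rewrite !mxE (ord1 i); exact/ball_sym.
case: ifPn => // /asboolP; elim => y qy; apply: eA.
apply: (@le_ball _ _ _ (k.+1%:R^-1 + k.+1%:R^-1)).
  by rewrite (splitr e) lerD// ltW.
exact: ball_triangle (ball_sym bx) qy.
Qed.

Lemma continuous_measurable_rV (g : 'rV[R]_n -> R) :
  continuous g -> measurable_fun setT g.
Proof.
move=> cg; apply: (measurability _ (RGenOInfty.measurableE R)) => //.
move=> _ [_ [r ->] <-]; rewrite setTI; apply: open_measurable_rV.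
apply: open_comp; last exact: interval_open.
by move=> x _; exact: cg.
Qed.

End rvol_theory.

Notation pushm m mf :=
  (measure_function_pushforward__canonical__measure_function_Measure m mf).

Lemma le_measureW d (T : measurableType d) (R : realType)
  (m : {measure set T -> \bar R}) (A B : set T) :
  measurable A -> measurable B -> A `<=` B -> (m A <= m B)%E.
Proof. by move=> mA mB; apply: le_measure; exact: mem_set. Qed.

(** * Affine changes of variable on the line *)

Section affine.
Context {R : realType}.
Local Open Scope ereal_scope.
Notation mu := (@lebesgue_measure R).
Implicit Types (A : set R) (c d : R).

Lemma measurable_affine c d : measurable_fun [set: R] (fun t : R => (c * t + d)%R).
Proof. by apply: measurable_funD => //; exact: mulrl_measurable. Qed.

(** The push-forward of [mu] under the affine map, scaled by [c], gives half-open intervals their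
    length, and Lebesgue measure is the only measure that does. *)
Lemma lebesgue_measure_affine c d A : (0 < c)%R -> measurable A ->
  mu ((fun t => (c * t + d)%R) @^-1` A) = (c^-1)%:E * mu A.
Proof.
move=> c0 mA; pose phi : measurableTypeR R -> measurableTypeR R := fun t => (c * t + d)%R.
have mphi : measurable_fun setT phi by exact: measurable_affine.
have c0' := ltW c0.
have : mu A = mscale (NngNum c0') (pushm mu mphi) A.
  apply: lebesgue_measure_unique => // _ [[a b]] _ <-.
  change (mu `]a, b]%classic = c%:E * mu (phi @^-1` `]a, b]%classic)).
  rewrite (_ : phi @^-1` _ = `]((a - d) / c)%R, ((b - d) / c)%R]%classic); last first.
    apply/seteqP; split => t /=; rewrite !in_itv/= /phi ltr_pdivrMr// ler_pdivlMr//;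
    by rewrite (mulrC t) ltrBlDr lerBrDr.
  rewrite !lebesgue_measure_itv/= !lte_fin ltr_pM2r ?invr_gt0// ltrD2r.
  case: ifPn => // _; last by rewrite mule0.
  by rewrite -!EFinD -EFinM -mulrBl opprB addrA subrK mulrCA divff ?mulr1// gt_eqF.
move=> ->; change (mscale _ _ A) with (c%:E * mu (phi @^-1` A)).
rewrite muleA -EFinM mulVf ?mul1e// gt_eqF//.
Qed.

Lemma ge0_integral_affine c d (f : R -> \bar R) : (0 < c)%R ->
  measurable_fun setT f -> (forall t, 0 <= f t) ->
  \int[mu]_t f (c * t + d)%R = (c^-1)%:E * \int[mu]_t f t.
Proof.
move=> c0 mf f0; have ci0 : (0 <= c^-1)%R by rewrite invr_ge0 ltW.
pose phi : measurableTypeR R -> measurableTypeR R := fun t => (c * t + d)%R.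
have mphi : measurable_fun setT phi by exact: measurable_affine.
rewrite -(ge0_integral_mscale mu measurableT (NngNum ci0))//.
transitivity (\int[pushforward mu phi]_y f y).
  by rewrite ge0_integral_pushforward//.
apply: eq_measure_integral => B mB _.
exact: lebesgue_measure_affine.
Qed.

End affine.

(** * Product functions, boxes and dilations *)

Section rvol_formulas.
Context {R : realType} {n : nat}.
Notation mu := (@lebesgue_measure R).
Implicit Types (x : 'rV[R]_n) (A : set 'rV[R]_n).

Lemma iint_prod (phi : 'I_n -> R -> R) (I : 'I_n -> R) k x :
  (forall i, measurable_fun setT (phi i)) -> (forall i t, 0 <= phi i t) ->
  (forall i, (\int[mu]_t (phi i t)%:E = (I i)%:E)%E) -> (k <= n)%N ->
  iint k (fun x => (\prod_i phi i (x ord0 i))%:E) x =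
  (\prod_(i < n) (if (i < k)%N then I i else phi i (x ord0 i)))%:E.
Proof.
move=> mphi phi0 phiI; elim: k x => [x _|k IH x kn] /=.
  by congr (_%:E); apply: eq_bigr.
have I0 i : 0 <= I i by rewrite -lee_fin -phiI; apply: integral_ge0 => t _; rewrite lee_fin.
pose ik := Ordinal kn.
pose C := \prod_(i < n | i != ik) (if (i < k)%N then I i else phi i (x ord0 i)).
have C0 : 0 <= C by apply: prodr_ge0 => i _; case: ifP.
transitivity (\int[mu]_t (C%:E * (phi ik t)%:E))%E.
  apply: eq_integral => t _; rewrite IH ?(ltnW kn)// -EFinM; congr (_%:E).
  rewrite (bigD1 ik)//= ltnn mxE eqxx mulrC; congr (_ * _).
  rewrite /C; apply: eq_bigr => i iik; rewrite mxE; case: ifP => // _; rewrite ifN//.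
rewrite ge0_integralZl_EFin//; last 2 first.
- by move=> t _; rewrite lee_fin.
- by apply: measurableT_comp => //; exact: mphi.
rewrite phiI -EFinM; congr (_%:E); rewrite [RHS](bigD1 ik)//= ltnSn mulrC; congr (_ * _).
apply: eq_bigr => i iik.
have ik' : nat_of_ord i != k by [].
by rewrite [(i < k.+1)%N]ltnS [(i <= k)%N]leq_eqVlt (negPf ik').
Qed.

Lemma integral_Rn_prod (phi : 'I_n -> R -> R) (I : 'I_n -> R) :
  (forall i, measurable_fun setT (phi i)) -> (forall i t, 0 <= phi i t) ->
  (forall i, (\int[mu]_t (phi i t)%:E = (I i)%:E)%E) ->
  integral_Rn (fun x : 'rV[R]_n => (\prod_i phi i (x ord0 i))%:E) = (\prod_i I i)%:E.
Proof.
move=> mphi phi0 phiI; rewrite /integral_Rn (iint_prod _ mphi phi0 phiI)//.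
by congr (_%:E); apply: eq_bigr => i _; rewrite ltn_ord.
Qed.

Lemma rvol_box (a b : 'I_n -> R) : (forall i, a i <= b i) ->
  rvol [set x : 'rV[R]_n | forall i, a i < x ord0 i < b i] = (\prod_i (b i - a i))%:E.
Proof.
move=> ab; rewrite -(integral_Rn_prod (phi := fun i => \1_(`]a i, b i[%classic))).
- rewrite /rvol; congr (iint _ _ _); apply/funext => x; congr (_%:E).
  rewrite indicE; have [/set_mem xab|/negP] := boolP (x \in _).
    rewrite big1// => i _; rewrite indicE mem_set//= in_itv/=; exact: xab.
  move=> /negP; rewrite notin_setE /= => /existsNP[i xi].
  by apply/esym/eqP; rewrite prodf_seq_eq0; apply/hasP; exists i; rewrite ?mem_index_enum//= indicE memNset//= in_itv.
- by move=> i.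
- by move=> i t.
- move=> i; rewrite integral_indic//= setIT lebesgue_measure_itv/= lte_fin.
  case: ifPn => //; rewrite -leNgt => ba.
  by have -> : a i = b i by [apply/le_anti; rewrite ab]; rewrite subrr.
Qed.

Lemma upd_scale (c : R) x k t : upd (c *: x) k (c * t) = c *: upd x k t.
Proof. by apply/rowP => i; rewrite !mxE; case: ifP. Qed.

(** Each integration contributes one factor [c^-1] by the affine change of variable; the coordinates
    not yet integrated stay scaled, whence the argument [c *: x] on the right. *)
Lemma iint_scale (c : R) (g : 'rV[R]_n -> \bar R) k x : 0 < c ->
  measurable_fun setT g -> (forall x, 0 <= g x)%E ->
  iint k (fun x => g (c *: x)) x = ((c ^- k)%:E * iint k g (c *: x))%E.
Proof.
move=> c0 mg g0; elim: k x => [|k IH] x /=; first by rewrite expr0 invr1 mul1e.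
under eq_integral do rewrite IH -upd_scale.
rewrite ge0_integralZl_EFin//; last 3 first.
- by move=> t _; exact: iint_ge0.
- have := measurable_iint_upd k k (c *: x) mg g0 => /measurableT_comp; apply.
  by have := measurable_affine c 0; under eq_fun do rewrite addr0.
- by rewrite invr_ge0 exprn_ge0// ltW.
have mh := measurable_iint_upd k k (c *: x) mg g0.
transitivity ((c ^- k)%:E * ((c^-1)%:E * \int[mu]_t iint k g (upd (c *: x) k t)))%E.
  congr (_ * _)%E; rewrite -(ge0_integral_affine 0 c0)//.
    by apply: eq_integral => t _; rewrite addr0.
  by move=> t; exact: iint_ge0.
by rewrite muleA -EFinM exprS invfM mulrC.
Qed.

Lemma integral_Rn_scale (c : R) (g : 'rV[R]_n -> \bar R) : 0 < c ->
  measurable_fun setT g -> (forall x, 0 <= g x)%E ->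
  integral_Rn (fun x => g (c *: x)) = ((c ^- n)%:E * integral_Rn g)%E.
Proof. by move=> c0 mg g0; rewrite /integral_Rn iint_scale// scaler0. Qed.

Lemma rvol_scale (c : R) A : 0 < c -> measurable A ->
  rvol [set x : 'rV[R]_n | A (c *: x)] = ((c ^- n)%:E * rvol A)%E.
Proof.
move=> c0 mA; rewrite /rvol -integral_Rn_scale//.
by apply/measurable_EFinP; exact: measurable_indic.
Qed.

End rvol_formulas.

(** * Prekopa-Leindler and Brunn-Minkowski inequalities *)

Section sigma_finite_rvol.
Context {R : realType} {n : nat}.

Let rvol_sigma_finite : sigma_finite setT (@rvol R n).
Proof.
exists (fun k => [set x : 'rV[R]_n | forall i, - k%:R < x ord0 i < k%:R]).
  apply/esym/seteqP; split => // x _.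
  have [k kx] : exists k : nat, `|x| < k%:R.
    by exists (Num.truncn `|x|).+1; rewrite Num.Theory.truncnS_gt.
  exists k => // i; rewrite -ltr_norml (le_lt_trans _ kx)//.
  by rewrite [leRHS]/Num.norm/= mx_normrE; apply: (le_bigmax _ (fun ij => `|x ij.1 ij.2|) (ord0, i)).
move=> k; split.
  rewrite (_ : [set x | _] = \bigcap_(i in [set: 'I_n])
      (fun y : 'rV[R]_n => y ord0 i) @^-1` (`]- k%:R, k%:R[%classic)).
    apply: fin_bigcap_measurable => // i _.
    by rewrite -[X in measurable X]setTI; exact: measurable_coord.
  apply/seteqP; split=> [x xk i _|x xk i]; first by rewrite /= in_itv/=; exact: xk.
  by have := xk i Logic.I; rewrite /= in_itv.
rewrite rvol_box ?ltry// => i.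
by rewrite lerNl (le_trans (y := 0))// oppr_le0.
Qed.

HB.instance Definition _ :=
  @Measure_isSigmaFinite.Build _ _ _ (@rvol R n) rvol_sigma_finite.

End sigma_finite_rvol.

(** * Tonelli's theorem in layer-cake form *)

Section layer.
Context d (T : measurableType d) (R : realType).
Variable m : {sigma_finite_measure set T -> \bar R}.
Notation mu := (@lebesgue_measure R).

Lemma tonelli_layer (E : set (T * R)) (w : R -> R) : measurable E ->
  measurable_fun setT w -> (forall s, 0 <= w s) ->
  (\int[mu]_s ((w s)%:E * m [set x | E (x, s)]) =
   \int[m]_x \int[mu]_s (w s * \1_E (x, s))%:E)%E.
Proof.
move=> mE mw w0.
rewrite (@fubini_tonelli _ _ _ _ _ m mu (fun z => (w z.2 * \1_E z)%:E)); last 2 first.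
- apply/measurable_EFinP; apply: measurable_funM; last exact: measurable_indic.
  exact: (measurableT_comp mw).
- by move=> z; rewrite lee_fin mulr_ge0.
apply: eq_integral => s _ /=.
have EsE : [set x | E (x, s)] = ysection E s by rewrite ysectionE.
have mEs : measurable [set x | E (x, s)] by rewrite EsE; exact: measurable_ysection.
transitivity (\int[m]_x ((w s)%:E * (\1_[set x | E (x, s)] x)%:E))%E.
  rewrite ge0_integralZl_EFin//; last exact/measurable_EFinP/measurable_indic.
  by rewrite integral_indic// setIT.
by apply: eq_integral => x _; rewrite EFinM.
Qed.

Lemma measurable_layer (E : set (T * R)) : measurable E ->
  measurable_fun setT (fun s => m [set x | E (x, s)]).
Proof.
move=> mE; have := measurable_fun_ysection m mE.
apply: eq_measurable_fun => s _ /=; congr (m _).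
by rewrite ysectionE.
Qed.

End layer.

Section brunn_minkowski_1d.
Context {R : realType}.
Notation mu := (@lebesgue_measure R).
Implicit Types X Y Z : set R.

Let compact_max X : X !=set0 -> compact X -> exists2 a, X a & forall x, X x -> x <= a.
Proof.
move=> X0 cX.
have [|c Xc cmax] := @compact_EVT_max R R id X X0 cX.
  by apply: continuous_subspaceT => x; exact: cvg_id.
by exists c => [|x /mem_set]; [exact: set_mem|exact: cmax].
Qed.

Let compact_min X : X !=set0 -> compact X -> exists2 a, X a & forall x, X x -> a <= x.
Proof.
move=> X0 cX.
have [|c Xc cmin] := @compact_EVT_min R R id X X0 cX.
  by apply: continuous_subspaceT => x; exact: cvg_id.
by exists c => [|x /mem_set]; [exact: set_mem|exact: cmin].
Qed.

Let measure_translate c X : measurable X ->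
  mu ((fun t => t + c) @^-1` X) = mu X.
Proof.
move=> mX; have := @lebesgue_measure_affine R 1 c X ltr01 mX.
by under eq_fun do rewrite mul1r; rewrite invr1 mul1e.
Qed.

Let measurable_translate c X : measurable X -> measurable ((fun t => t + c) @^-1` X).
Proof.
move=> mX; rewrite -[X in measurable X]setTI.
by apply: measurable_funD => //.
Qed.

(** For compact [K] and [L], shift [K] by the least point [b] of [L] and [L] by the greatest point
    [a] of [K]: both shifted sets lie in the sum set and meet at most in [a + b], so their measures
    add up. Inner regularity passes to measurable sets. *)
Lemma brunn_minkowski_1d X Y Z :
  measurable X -> measurable Y -> measurable Z -> X !=set0 -> Y !=set0 ->
  (forall x y, X x -> Y y -> Z (x + y)) -> (mu X + mu Y <= mu Z)%E.
Proof.
move=> mX mY mZ [x0 Xx0] [y0 Yy0] XYZ.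
have key K L : compact K -> compact L -> K !=set0 -> L !=set0 ->
    K `<=` X -> L `<=` Y -> (mu K + mu L <= mu Z)%E.
  move=> cK cL K0 L0 KX LY.
  have mK := compact_measurable cK; have mL := compact_measurable cL.
  have [a Ka amax] := compact_max K0 cK.
  have [b Lb bmin] := compact_min L0 cL.
  rewrite -(measure_translate (- b) mK) -(measure_translate (- a) mL).
  set K' := _ @^-1` K; set L' := _ @^-1` L.
  have mK' : measurable K' by exact: measurable_translate.
  have mL' : measurable L' by exact: measurable_translate.
  have mab : measurable [set a + b] by [].
  have -> : mu L' = mu (L' `\` [set a + b]).
    apply/eqP; rewrite eq_le; apply/andP; split; last first.
      by apply: le_measureW; [exact: measurableD|by []|exact: subDsetl].
    have LU : L' = (L' `\` [set a + b]) `|` (L' `&` [set a + b]).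
      by rewrite setUC setUIDK.
    rewrite {1}LU.
    apply: (@le_trans _ _ (mu (L' `\` [set (a + b)%R]) + mu (L' `&` [set (a + b)%R]))%E).
      by apply: measureU2; [exact: measurableD|exact: measurableI].
    have -> : mu (L' `&` [set a + b]) = 0%E; last by rewrite adde0.
    apply/eqP; rewrite eq_le measure_ge0 andbT -(lebesgue_measure_set1 (a + b)).
    by apply: le_measureW; [exact: measurableI|by []|exact: subIsetr].
  rewrite -measureU//; last 2 first.
  - exact: measurableD.
  - apply/seteqP; split => // s [/= Ks [Ls sab]].
    apply: sab; apply/eqP; rewrite eq_le; apply/andP; split.
      by have := amax _ Ks; lra.
    by have := bmin _ Ls; lra.
  apply: le_measureW => //.
    by apply: measurableU => //; exact: measurableD.
  move=> s [Ks|[Ls _]].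
    by rewrite -(subrK b s); apply: XYZ; [exact: KX|exact: LY].
  by rewrite -(subrK a s) addrC; apply: XYZ; [exact: KX|exact: LY].
(* With [mu Z] finite, [mu L] can be moved to the other side, so that the suprema over [K] and over
   [L] are taken one after the other. *)
have [Zoo|] := ltP (mu Z) +oo%E; last first.
  by rewrite leye_eq => /eqP ->; rewrite leey.
have Zfin : mu Z \is a fin_num by rewrite ge0_fin_numE.
have keyX L : compact L -> L `<=` Y -> (mu X <= mu Z - mu L)%E.
  move=> cL LY; rewrite (lebesgue_regularity_inner_sup mX).
  apply: ge_ereal_sup => _ [K [cK KX] <-].
  have mL := compact_measurable cL; have mK := compact_measurable cK.
  have Lfin : mu L \is a fin_num by rewrite ge0_fin_numE ?compact_finite_measure.
  rewrite leeBrDr//.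
  (* The points [x0] and [y0] keep the compact approximations nonempty. *)
  apply: (@le_trans _ _ (mu (K `|` [set x0]) + mu (L `|` [set y0]))%E).
    by apply: leeD; apply: le_measureW; [by []|exact: measurableU|exact: subsetUl|by []|exact: measurableU|exact: subsetUl].
  apply: key.
  - by apply: compactU => //; exact: compact_set1.
  - by apply: compactU => //; exact: compact_set1.
  - by exists x0; right.
  - by exists y0; right.
  - by move=> x [/KX//|->].
  - by move=> x [/LY//|->].
have Xfin : mu X \is a fin_num.
  rewrite ge0_fin_numE//; apply: le_lt_trans (keyX set0 compact0 (@sub0set _ _)) _.
  by rewrite measure0 sube0.
rewrite addeC -leeBrDr// (lebesgue_regularity_inner_sup mY).
apply: ge_ereal_sup => _ [L [cL LY] <-].
have Lfin : mu L \is a fin_num.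
  by rewrite ge0_fin_numE ?compact_finite_measure//; exact: compact_measurable.
by rewrite leeBrDr// addeC -leeBrDr//; exact: keyX.
Qed.

End brunn_minkowski_1d.

Section prekopa_leindler.
Context {R : realType}.
Notation mu := (@lebesgue_measure R).

Lemma weighted_amgm (x y t : R) : 0 <= x -> 0 <= y -> 0 < t < 1 ->
  x `^ (1 - t) * y `^ t <= (1 - t) * x + t * y.
Proof.
move=> x0 y0 /andP[t0 t1]; have t1' : 0 < 1 - t by rewrite subr_gt0.
have := @conjugate_powR R (x `^ (1 - t)) (y `^ t) (1 - t)^-1 t^-1.
rewrite -!powRrM !mulfV ?gt_eqF// !powRr1// !invrK mulrC (mulrC y) [(1 - t) * x]mulrC.
apply; rewrite ?powR_ge0 ?invr_gt0//; lra.
Qed.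

(** Layer cake for [f / a], whose values lie in [[0, 1]], so that the levels [s] range over []0,
    1[]. *)
Let level_int (f : R -> R) (a If : R) : measurable_fun setT f ->
  (forall x, 0 <= f x) -> 0 < a -> (forall x, f x <= a) ->
  (\int[mu]_x (f x)%:E = If%:E)%E ->
  (\int[mu]_s ((\1_(`]0%R, 1%R[%classic : set R) s)%:E * mu [set x | (a * s < f x)%R]) = (If / a)%:E)%E.
Proof.
move=> mf f0 a0 fa fI.
pose E : set (R * R) := [set z | a * z.2 < f z.1].
have mE : measurable E.
  rewrite -[E]setTI; apply: (@measurable_lte _ _ _ _ _ (fun z : R * R => (a * z.2)%:E) (fun z => (f z.1)%:E)) => //.
  - by apply/measurable_EFinP; exact: measurable_funM.
  - by apply/measurable_EFinP; exact: (measurableT_comp mf).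
rewrite (tonelli_layer mu mE)//.
transitivity (\int[mu]_x ((a^-1)%:E * (f x)%:E))%E; last first.
  rewrite ge0_integralZl_EFin//.
  - by rewrite fI -EFinM mulrC.
  - by move=> x _; rewrite lee_fin.
  - exact/measurable_EFinP.
  - by rewrite invr_ge0 ltW.
apply: eq_integral => x _; rewrite -EFinM.
transitivity (\int[mu]_s (\1_(`]0%R, (a^-1 * f x)%R[%classic : set R) s)%:E)%E.
  apply: eq_integral => s _; congr (_%:E); rewrite !indicE -natrM mulnb; congr (_%:R).
  apply: congr1; apply/idP/idP.
    move=> /andP[]; rewrite !inE/= !in_itv/= => /andP[s0 s1] asf.
    by rewrite s0/= mulrC ltr_pdivlMr// mulrC.
  move=> /set_mem /=; rewrite in_itv/= => /andP[s0]; rewrite mulrC ltr_pdivlMr// mulrC => asf.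
  apply/andP; split; apply/mem_set => //=; rewrite in_itv/= s0/=.
  by have := fa x; nra.
rewrite integral_indic//= setIT lebesgue_measure_itv/= lte_fin.
have := f0 x; rewrite le_eqVlt => /predU1P[<-|fx0]; first by rewrite mulr0 ltxx.
by rewrite mulr_gt0 ?invr_gt0// ?sube0 -?EFinB ?subr0.
Qed.

Let sup_pos (f : R -> R) M : (forall x, 0 <= f x) -> (forall x, f x <= M) ->
  (exists x, 0 < f x) -> exists a, [/\ 0 < a, forall x, f x <= a &
    forall s, s < a -> exists x, s < f x].
Proof.
move=> f0 fM [x0 fx0]; pose a := sup (range f).
have hs : has_sup (range f).
  by split; [exists (f x0), x0|exists M => _ [x _ <-]].
have fa x : f x <= a by apply: ub_le_sup; [exact: hs.2|exists x].
exists a; split => // [|s sa]; first exact: lt_le_trans (fa x0).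
have e0 : 0 < a - s by rewrite subr_gt0.
have [_ [x _ <-]] := sup_adherent e0 hs.
by rewrite subKr; exists x.
Qed.

(** Scaling by the suprema [a] and [b] makes the level sets of [f] at [a * s] and of [g] at [b * s]
    nonempty for the same [s], namely all of []0, 1[], as one-dimensional Brunn-Minkowski requires.
    Integration in [s] yields the arithmetic mean of [If / a] and [Ig / b], and AM-GM passes to the
    geometric mean. *)
Lemma prekopa_leindler_1d (t M If Ig : R) (f g : R -> R) (h : R -> \bar R) :
  0 < t < 1 ->
  measurable_fun setT f -> measurable_fun setT g -> measurable_fun setT h ->
  (forall x, 0 <= f x) -> (forall x, 0 <= g x) -> (forall x, 0 <= h x)%E ->
  (forall x, f x <= M) -> (forall x, g x <= M) ->
  (\int[mu]_x (f x)%:E = If%:E)%E -> (\int[mu]_x (g x)%:E = Ig%:E)%E ->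
  (forall x y, ((f x) `^ (1 - t) * (g y) `^ t)%:E <= h ((1 - t) * x + t * y)%R)%E ->
  ((If `^ (1 - t) * Ig `^ t)%:E <= \int[mu]_x h x)%E.
Proof.
move=> /andP[t0 t1] mf mg mh f0 g0 h0 fM gM fI gI fgh.
have t1' : 0 < 1 - t by rewrite subr_gt0.
have hI0 : (0 <= \int[mu]_x h x)%E by exact: integral_ge0.
have If0 : 0 <= If by rewrite -lee_fin -fI; apply: integral_ge0 => x _; rewrite lee_fin.
have Ig0 : 0 <= Ig by rewrite -lee_fin -gI; apply: integral_ge0 => x _; rewrite lee_fin.
have triv (k : R -> R) Ik : (forall x, 0 <= k x) ->
    (\int[mu]_x (k x)%:E = Ik%:E)%E -> ~ (exists x, 0 < k x) -> Ik = 0.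
  move=> k0 kI nk; have : Ik%:E = 0%E; last by case.
  rewrite -kI; apply: integral0_eq => x _; congr (_%:E).
  by apply/eqP; rewrite eq_le k0 andbT leNgt; apply/negP => kx; apply: nk; exists x.
have [ef|nef] := pselect (exists x, 0 < f x); last first.
  by rewrite (triv f If)// powR0 ?gt_eqF// mul0r.
have [eg|neg] := pselect (exists x, 0 < g x); last first.
  by rewrite (triv g Ig)// powR0 ?gt_eqF// mulr0.
have [a [a0 fa afx]] := sup_pos f0 fM ef.
have [b [b0 gb bgx]] := sup_pos g0 gM eg.
pose c := a `^ (1 - t) * b `^ t.
have c0 : 0 < c by rewrite mulr_gt0// powR_gt0.
pose w : R -> R := \1_(`]0%R, 1%R[%classic : set R).
have mw : measurable_fun setT w by exact: measurable_indic.
have w0 s : 0 <= w s by [].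
pose Ef : set (R * R) := [set z | a * z.2 < f z.1].
have mEf : measurable Ef.
  rewrite -[Ef]setTI; apply: (@measurable_lte _ _ _ _ _ (fun z : R * R => (a * z.2)%:E) (fun z => (f z.1)%:E)) => //.
  - by apply/measurable_EFinP; exact: measurable_funM.
  - by apply/measurable_EFinP; exact: (measurableT_comp mf).
pose Eg : set (R * R) := [set z | b * z.2 < g z.1].
have mEg : measurable Eg.
  rewrite -[Eg]setTI; apply: (@measurable_lte _ _ _ _ _ (fun z : R * R => (b * z.2)%:E) (fun z => (g z.1)%:E)) => //.
  - by apply/measurable_EFinP; exact: measurable_funM.
  - by apply/measurable_EFinP; exact: (measurableT_comp mg).
pose Eh : set (R * R) := [set z | ((c * z.2)%:E <= h z.1)%E].
have mEh : measurable Eh.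
  rewrite -[Eh]setTI; apply: (@measurable_lee _ _ _ _ _ (fun z : R * R => (c * z.2)%:E) (fun z => h z.1)) => //.
  - by apply/measurable_EFinP; exact: measurable_funM.
  - exact: (measurableT_comp mh).
have level s : (((1 - t)%:E * ((w s)%:E * mu [set x | Ef (x, s)]) +
    t%:E * ((w s)%:E * mu [set x | Eg (x, s)])) <= (w s)%:E * mu [set x | Eh (x, s)])%E.
  rewrite /w indicE; have [|_] := boolP (s \in _); last by rewrite !mul0e !mule0 adde0.
  rewrite inE/= in_itv/= => /andP[s0 s1]; rewrite !mul1e.
  have mf' : measurable [set x | a * s < f x].
    have -> : [set x | a * s < f x] = ysection Ef s by rewrite ysectionE.
    exact: measurable_ysection.
  have mg' : measurable [set x | b * s < g x].
    have -> : [set x | b * s < g x] = ysection Eg s by rewrite ysectionE.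
    exact: measurable_ysection.
  have mh' : measurable [set x | ((c * s)%:E <= h x)%E].
    have -> : [set x | ((c * s)%:E <= h x)%E] = ysection Eh s by rewrite ysectionE.
    exact: measurable_ysection.
  have ti : 0 < t^-1 by rewrite invr_gt0.
  have t1i : 0 < (1 - t)^-1 by rewrite invr_gt0.
  have := lebesgue_measure_affine 0 t1i mf'; rewrite invrK => <-.
  have := lebesgue_measure_affine 0 ti mg'; rewrite invrK => <-.
  have mpre (k : R) A : measurable A -> measurable ((fun x => k * x + 0) @^-1` A).
    by move=> mA; rewrite -[X in measurable X]setTI; exact: measurable_affine.
  apply: brunn_minkowski_1d => //.
  - exact: mpre.
  - exact: mpre.
  - have [|x ax] := afx (a * s); first by rewrite gtr_pMr.
    by exists ((1 - t) * x); rewrite /= addr0 mulKf ?gt_eqF.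
  - have [|x ax] := bgx (b * s); first by rewrite gtr_pMr.
    by exists (t * x); rewrite /= addr0 mulKf ?gt_eqF.
  move=> x y /=; rewrite !addr0 => fx gy.
  have := fgh ((1 - t)^-1 * x) (t^-1 * y); rewrite !mulVKf ?gt_eqF//.
  apply: le_trans; rewrite lee_fin.
  have -> : c * s = (a * s) `^ (1 - t) * (b * s) `^ t.
    rewrite !powRM ?ltW// mulrACA -powRD ?subrK ?oner_eq0//.
    by rewrite powRr1// ltW.
  have as0 : 0 <= a * s by rewrite mulr_ge0// ltW.
  have bs0 : 0 <= b * s by rewrite mulr_ge0// ltW.
  apply: ler_pM; rewrite ?powR_ge0//; apply: ge0_ler_powR; rewrite ?nnegrE ?f0 ?g0 ?(ltW t0) ?(ltW t1')//; exact: ltW.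
have meas (E : set (R * R)) : measurable E ->
    measurable_fun setT (fun s => (w s)%:E * mu [set x | E (x, s)])%E.
  move=> mE; apply: emeasurable_funM; first exact/measurable_EFinP.
  exact: measurable_layer.
have ge (E : set (R * R)) s : (0 <= (w s)%:E * mu [set x | E (x, s)])%E.
  by rewrite mule_ge0// lee_fin.
have step1 : (((1 - t) * (If / a) + t * (Ig / b))%:E <= (c^-1)%:E * \int[mu]_x h x)%E.
  rewrite EFinD [((1 - t) * _)%:E]EFinM [(t * _)%:E]EFinM -(level_int mf f0 a0 fa fI) -(level_int mg g0 b0 gb gI).
  rewrite -ge0_integralZl_EFin//; last 3 first.
  - by move=> s _; exact: (ge Ef).
  - exact: (meas Ef).
  - exact: ltW.
  rewrite -ge0_integralZl_EFin//; last 3 first.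
  - by move=> s _; exact: (ge Eg).
  - exact: (meas Eg).
  - exact: ltW.
  rewrite -ge0_integralD//; last 4 first.
  - by move=> s _; rewrite mule_ge0 ?(ge Ef)// lee_fin ltW.
  - by apply: emeasurable_funM => //; exact: (meas Ef).
  - by move=> s _; rewrite mule_ge0 ?(ge Eg)// lee_fin ltW.
  - by apply: emeasurable_funM => //; exact: (meas Eg).
  apply: (@le_trans _ _ (\int[mu]_s ((w s)%:E * mu [set x | Eh (x, s)]))%E).
    apply: ge0_le_integral => //.
    - by move=> s _; rewrite adde_ge0// mule_ge0 ?(ge Ef) ?(ge Eg)// lee_fin ltW.
    - by apply: emeasurable_funD; apply: emeasurable_funM => //; [exact: (meas Ef)|exact: (meas Eg)].
    - exact: meas.
  rewrite (tonelli_layer mu mEh)// -ge0_integralZl_EFin//; last by rewrite invr_ge0 ltW.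
  apply: ge0_le_integral => //.
  - by move=> x _; apply: integral_ge0 => s _; rewrite lee_fin mulr_ge0.
  - apply: (@measurable_fun_fubini_tonelli_F _ _ _ _ _ mu (fun z : R * R => (w z.2 * \1_Eh z)%:E)) => //=.
    + apply/measurable_EFinP; apply: measurable_funM; last exact: measurable_indic.
      exact: (measurableT_comp mw).
    + by move=> z; rewrite lee_fin mulr_ge0.
  - exact: emeasurable_funM.
  move=> x _; case hx : (h x) => [r| |]; last 2 first.
  - by rewrite gt0_muley ?lte_fin ?invr_gt0// leey.
  - by have := h0 x; rewrite hx.
  have r0 : 0 <= r by have := h0 x; rewrite hx lee_fin.
  (* At a point where [h x = r], a level [s] counts only if [c * s <= r], so the levels fill at most
     []0, c^-1 * r]]. *)
  rewrite -EFinM; apply: (@le_trans _ _ (\int[mu]_s (\1_(`]0%R, (c^-1 * r)%R]%classic : set R) s)%:E)%E).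
    apply: ge0_le_integral => //.
    - by move=> s _; rewrite lee_fin mulr_ge0.
    - apply/measurable_EFinP; apply: measurable_funM => //.
      apply: (@measurableT_comp _ _ _ _ _ _ (\1_Eh : R * R -> R) _ (fun s : R => (x, s))).
        exact: measurable_indic.
      exact: pair1_measurable.
    - by apply/measurable_EFinP; exact: measurable_indic.
    move=> s _; rewrite lee_fin /w !indicE -natrM mulnb ler_nat.
    have [/andP[]|//] := boolP (_ && _).
    rewrite !inE/= in_itv/= => /andP[s0 s1]; rewrite /Eh /= hx lee_fin => csr.
    by rewrite mem_set//= in_itv/= s0/= mulrC ler_pdivlMr// mulrC.
  rewrite integral_indic//= setIT lebesgue_measure_itv/= lte_fin.
  by case: ifP => _; rewrite ?sube0 -?EFinB ?subr0 ?lee_fin// mulr_ge0// invr_ge0 ltW.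
case hI : (\int[mu]_x h x)%E => [H| |]; last 2 first.
- by rewrite leey.
- by move: hI0; rewrite hI.
rewrite lee_fin; move: step1; rewrite hI -EFinM lee_fin => step1.
have -> : If = a * (If / a) by rewrite mulrC divfK ?gt_eqF.
have -> : Ig = b * (Ig / b) by rewrite mulrC divfK ?gt_eqF.
have Ia0 : 0 <= If / a by rewrite divr_ge0// ltW.
have Ib0 : 0 <= Ig / b by rewrite divr_ge0// ltW.
rewrite (powRM _ (ltW a0) Ia0) (powRM _ (ltW b0) Ib0) mulrACA -/c -ler_pdivlMl//.
by apply: le_trans step1; apply: weighted_amgm => //; rewrite t0.
Qed.

End prekopa_leindler.

Section prekopa_leindler_iint.
Context {R : realType} {n : nat}.
Notation mu := (@lebesgue_measure R).
Implicit Types (x y : 'rV[R]_n) (A B : set 'rV[R]_n).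

Definition in_box (K : R) A := forall x, A x -> forall i, `|x ord0 i| < K.

(** Comparison with the product of the indicators of []-K, K[]. An integrated coordinate contributes
    [2 * K], one not yet integrated at most 1; hence the maximum. *)
Lemma iint_indic_bounded K A k x : 0 <= K -> measurable A -> in_box K A -> (k <= n)%N ->
  (iint k (fun x => (\1_A x)%:E) x <= (Num.max 1 (2 * K) ^+ n)%:E)%E.
Proof.
move=> K0 mA AK kn.
pose phi : 'I_n -> R -> R := fun=> \1_(`]- K, K[%classic).
have mphi i : measurable_fun setT (phi i) by exact: measurable_indic.
have phi0 i s : 0 <= phi i s by [].
have phiI i : (\int[mu]_s (phi i s)%:E = (2 * K)%:E)%E.
  rewrite integral_indic//= setIT lebesgue_measure_itv/= lte_fin.
  case: ifPn; first by rewrite -EFinB opprK mulr_natl mulr2n.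
  by rewrite -leNgt => KN; congr (_%:E); lra.
apply: (@le_trans _ _ (iint k (fun x => (\prod_i phi i (x ord0 i))%:E) x)).
  apply: le_iint => //.
  - by apply/measurable_EFinP; exact: measurable_indic.
  - apply/measurable_EFinP; apply: measurable_prod => i _.
    by apply: (measurableT_comp (mphi i)); exact: measurable_coord.
  move=> y; rewrite lee_fin indicE; have [/set_mem Ay|_] := boolP (y \in A).
    rewrite big1// => i _; rewrite /phi indicE mem_set//= in_itv/= -ltr_norml.
    exact: AK.
  by apply: prodr_ge0 => i _.
rewrite (iint_prod _ mphi phi0 phiI)// lee_fin.
rewrite -[in leRHS](card_ord n) -prodr_const; apply: ler_prod => i _.
case: ifP => _; rewrite le_max; first by rewrite mulr_ge0//= lexx orbT.
by rewrite phi0/= /phi indicE; case: (_ \in _) => /=; rewrite ?lexx ?ler01.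
Qed.

Lemma iint_indic_fin K A k x : 0 <= K -> measurable A -> in_box K A -> (k <= n)%N ->
  iint k (fun x => (\1_A x)%:E) x \is a fin_num.
Proof.
move=> K0 mA AK kn; rewrite ge0_fin_numE; last by apply: iint_ge0 => y; rewrite lee_fin.
by apply: le_lt_trans (iint_indic_bounded x K0 mA AK kn) _; rewrite ltry.
Qed.

Lemma upd_convex (a b : R) x y k s t :
  upd (a *: x + b *: y) k (a * s + b * t) = a *: upd x k s + b *: upd y k t.
Proof. by apply/rowP => i; rewrite !mxE; case: ifP. Qed.

(** Since [upd] commutes with convex combinations, the induction hypothesis on [k] is exactly the
    pointwise hypothesis of the one-dimensional inequality for the partial integrals as functions of
    the next coordinate. The function [h] is extended-valued because its partial integrals may be
    infinite. *)
Lemma prekopa_leindler_iint (t K : R) A B (h : 'rV[R]_n -> \bar R) k x y :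
  0 < t < 1 -> 0 <= K -> measurable A -> measurable B ->
  in_box K A -> in_box K B -> measurable_fun setT h -> (forall x, 0 <= h x)%E ->
  (forall x y, A x -> B y -> 1 <= h ((1 - t) *: x + t *: y)%R)%E -> (k <= n)%N ->
  ((fine (iint k (fun x => (\1_A x)%:E) x) `^ (1 - t) *
    fine (iint k (fun x => (\1_B x)%:E) y) `^ t)%:E <=
   iint k h ((1 - t) *: x + t *: y)%R)%E.
Proof.
move=> t01 K0 mA mB AK BK mh h0 ABh; have /andP[t0 t1] := t01.
have mIA : measurable_fun setT (fun x => (\1_A x)%:E : \bar R).
  by apply/measurable_EFinP; exact: measurable_indic.
have mIB : measurable_fun setT (fun x => (\1_B x)%:E : \bar R).
  by apply/measurable_EFinP; exact: measurable_indic.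
have IA0 z : (0 <= (\1_A z)%:E :> \bar R)%E by rewrite lee_fin.
have IB0 z : (0 <= (\1_B z)%:E :> \bar R)%E by rewrite lee_fin.
elim: k x y => [|k IH] x y kn.
  rewrite /= !indicE; have [/set_mem Ax|_] := boolP (x \in A); last first.
    by rewrite powR0 ?mul0r ?subr_eq0 ?gt_eqF.
  have [/set_mem By|_] := boolP (y \in B); last first.
    by rewrite powR0 ?mulr0 ?gt_eqF.
  by rewrite !powR1 mulr1; exact: ABh.
have key C (c : 'rV[R]_n) (mC : measurable C) (CK : in_box K C) :
  let f := fun s => fine (iint k (fun x => (\1_C x)%:E) (upd c k s)) in
  [/\ measurable_fun setT f, forall s, 0 <= f s, forall s, f s <= Num.max 1 (2 * K) ^+ n &
    (\int[mu]_s (f s)%:E = (fine (iint k.+1 (fun x => (\1_C x)%:E) c))%:E)%E].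
  move=> f.
  have mIC : measurable_fun setT (fun x => (\1_C x)%:E : \bar R).
    by apply/measurable_EFinP; exact: measurable_indic.
  have IC0 z : (0 <= (\1_C z)%:E :> \bar R)%E by rewrite lee_fin.
  have fE s : (f s)%:E = iint k (fun x => (\1_C x)%:E) (upd c k s).
    by rewrite fineK// (@iint_indic_fin K)// ltnW.
  split.
  - apply: (measurableT_comp (fine_measurable measurableT)).
    exact: measurable_iint_upd.
  - by move=> s; rewrite fine_ge0// iint_ge0.
  - by move=> s; rewrite -lee_fin fE; apply: iint_indic_bounded => //; rewrite ltnW.
  - under eq_integral do rewrite fE.
    by rewrite fineK// (@iint_indic_fin K).
have [mf f0 fM fI] := key A x mA AK.
have [mg g0 gM gI] := key B y mB BK.
apply: (@prekopa_leindler_1d R t _ _ _ _ _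
  (fun s => iint k h (upd ((1 - t) *: x + t *: y) k s)) t01 mf mg _ f0 g0 _ fM gM fI gI).
- exact: measurable_iint_upd.
- by move=> s; exact: iint_ge0.
- by move=> s s'; rewrite upd_convex; apply: IH; exact: ltnW.
Qed.

End prekopa_leindler_iint.

(** * Euclidean balls and the volume of a neighbourhood *)

Section euclidean_ball.
Context {R : realType} {n : nat}.
Implicit Types (x y : 'rV[R]_n) (A B : set 'rV[R]_n).

Lemma enorm_ge0 x : 0 <= enorm x. Proof. exact: sqrtr_ge0. Qed.

Lemma enormZ (c : R) x : enorm (c *: x) = `|c| * enorm x.
Proof.
rewrite /enorm -sqrtr_sqr -sqrtrM ?sqr_ge0// mulr_sumr; congr Num.sqrt.
by apply: eq_bigr => i _; rewrite mxE exprMn.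
Qed.

Lemma sqr_enorm x : enorm x ^+ 2 = \sum_i x ord0 i ^+ 2.
Proof. by rewrite sqr_sqrtr// sumr_ge0// => i _; rewrite sqr_ge0. Qed.

Lemma coord_le_enorm x i : `|x ord0 i| <= enorm x.
Proof.
rewrite -(ler_pXn2r (_ : 0 < 2)%N) ?nnegrE ?enorm_ge0// sqr_enorm real_normK ?num_real//.
by rewrite (bigD1 i)//= lerDl sumr_ge0// => j _; rewrite sqr_ge0.
Qed.

Lemma measurable_enorm : measurable_fun [set: 'rV[R]_n] (@enorm R n).
Proof.
apply: (@measurableT_comp _ _ _ _ _ _ (Num.sqrt : R -> R)).
  by apply: continuous_measurable_fun; exact: sqrt_continuous.
apply: measurable_sum => i; apply: measurable_funX; exact: measurable_coord.
Qed.

Definition eball (r : R) : set 'rV[R]_n := [set x | enorm x < r].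

Lemma measurable_eball r : measurable (eball r).
Proof.
rewrite (_ : eball r = @enorm R n @^-1` `]-oo, r[%classic).
  by rewrite -[X in measurable X]setTI; exact: measurable_enorm.
by apply/seteqP; split => x /=; rewrite in_itv.
Qed.

Lemma in_box_eball r : in_box r (eball r).
Proof. by move=> x xr i; exact: le_lt_trans (coord_le_enorm x i) xr. Qed.

Definition omega : R := fine (rvol (eball 1)).

Lemma rvol_eball1 : rvol (eball 1) = omega%:E.
Proof.
rewrite fineK// /rvol /integral_Rn (@iint_indic_fin R n 1)//; first exact: measurable_eball.
exact: in_box_eball.
Qed.

Lemma rvol_eball r : 0 < r -> rvol (eball r) = (omega * r ^+ n)%:E.
Proof.
move=> r0; rewrite (_ : eball r = [set x | eball 1 (r^-1 *: x)]); last first.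
  apply/seteqP; split => x /=; rewrite /eball /= enormZ gtr0_norm ?invr_gt0// mulrC;
  by rewrite ltr_pdivrMr// mul1r.
rewrite rvol_scale ?invr_gt0//; last exact: measurable_eball.
by rewrite rvol_eball1 -EFinM exprVn invrK mulrC.
Qed.

(** The unit ball contains the cube of half-side [1 / (n+1)], on which the sum of squares is at most
    [n / (n+1)]. *)
Lemma omega_gt0 : 0 < omega.
Proof.
have [e [e0 e1 ne]] : exists e : R, [/\ 0 < e, e <= 1 & n%:R * e < 1].
  exists n.+1%:R^-1; split; first by rewrite invr_gt0.
    by rewrite invf_le1 ?ler1n.
  by rewrite ltr_pdivrMr// mul1r ltr_nat.
suff : (0%:E < rvol (eball 1))%E by rewrite rvol_eball1 lte_fin.
apply: (@lt_le_trans _ _ (rvol [set x : 'rV[R]_n | forall i, - e < x ord0 i < e])).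
  rewrite rvol_box ?lte_fin; last by move=> i; lra.
  by apply: prodr_gt0 => i _; lra.
apply: le_measureW.
- rewrite (_ : [set x | _] = \bigcap_(i in [set: 'I_n])
      (fun y : 'rV[R]_n => y ord0 i) @^-1` (`]- e, e[%classic)).
    apply: fin_bigcap_measurable => // i _.
    by rewrite -[X in measurable X]setTI; exact: measurable_coord.
  apply/seteqP; split=> [x xk i _|x xk i]; first by rewrite /= in_itv/=; exact: xk.
  by have := xk i Logic.I; rewrite /= in_itv.
- exact: measurable_eball.
move=> x xn; rewrite /eball /= -(ltr_pXn2r (_ : 0 < 2)%N) ?nnegrE ?enorm_ge0// sqr_enorm expr1n.
apply: (@le_lt_trans _ _ (\sum_(i < n) e)).
  apply: ler_sum => i _; have := xn i; rewrite -ltr_norml => xi.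
  rewrite -real_normK ?num_real// expr2.
  by have := normr_ge0 (x ord0 i); nra.
by rewrite sumr_const card_ord -[X in X < _]mulr_natl.
Qed.

(** Prekopa-Leindler is multiplicative, so the sets are first dilated by [1 / (1 - t)] and [1 / t]
    with [t = eps / (rho + eps)]. Both then have the volume of the ball of radius [rho + eps], and
    the geometric mean of two equal numbers loses nothing. *)
Lemma brunn_minkowski_ball (rho eps K : R) A Z : 0 < rho -> 0 < eps ->
  measurable A -> measurable Z -> in_box K A ->
  (forall x y, A x -> eball eps y -> Z (x + y)) ->
  rvol A = (omega * rho ^+ n)%:E -> ((omega * (rho + eps) ^+ n)%:E <= rvol Z)%E.
Proof.
move=> r0 e0 mA mZ AK AZ Ar.
have re0 : 0 < rho + eps by rewrite addr_gt0.
pose t := eps / (rho + eps); have t0 : 0 < t by rewrite divr_gt0.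
have st : 1 - t = rho / (rho + eps) by rewrite /t; field; rewrite gt_eqF.
have s0 : 0 < 1 - t by rewrite st divr_gt0.
pose A' : set 'rV[R]_n := [set x | A ((1 - t) *: x)].
pose B' : set 'rV[R]_n := [set x | eball eps (t *: x)].
have mS c C : measurable C -> measurable [set x : 'rV[R]_n | C (c *: x)].
  move=> mC; rewrite -[X in measurable X]setTI; apply: measurable_fun_rV => //= i.
  rewrite (_ : (fun _ => _) = fun x : 'rV[R]_n => c * x ord0 i); last by apply/funext => x; rewrite mxE.
  by apply: measurable_funM => //; exact: measurable_coord.
have mA' : measurable A' by exact: mS.
have mB' : measurable B' by apply: mS; exact: measurable_eball.
have A'E : rvol A' = (omega * (rho + eps) ^+ n)%:E.
  rewrite rvol_scale// Ar -EFinM st; congr (_%:E).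
  by rewrite expr_div_n invf_div mulrCA divfK// expf_eq0 gt_eqF// andbF.
have B'E : rvol B' = (omega * (rho + eps) ^+ n)%:E.
  rewrite rvol_scale//; last exact: measurable_eball.
  rewrite rvol_eball// -EFinM; congr (_%:E).
  by rewrite /t expr_div_n invf_div mulrCA divfK// expf_eq0 gt_eqF// andbF.
pose K' := Num.max (`|K| / (1 - t)) (eps / t).
have K'0 : 0 <= K' by rewrite le_max divr_ge0// ltW.
have A'K : in_box K' A'.
  move=> x /AK xK i; rewrite lt_max; apply/orP; left.
  have := xK i; rewrite mxE normrM gtr0_norm// ltr_pdivlMr// mulrC => /lt_le_trans; apply.
  exact: ler_norm.
have B'K : in_box K' B'.
  move=> x /in_box_eball xK i; rewrite lt_max; apply/orP; right.
  by have := xK i; rewrite mxE normrM gtr0_norm// ltr_pdivlMr// mulrC.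
have t01 : 0 < t < 1 by rewrite t0/= -subr_gt0.
have := @prekopa_leindler_iint R n t K' A' B' (fun x => (\1_Z x)%:E) n 0 0 t01 K'0 mA' mB' A'K B'K.
rewrite !scaler0 addr0 [X in fine X `^ (1 - t)]A'E [X in fine X `^ t]B'E /=.
rewrite -powRD ?subrK ?oner_eq0// powRr1; last first.
  by rewrite mulr_ge0 ?exprn_ge0 ?ltW// omega_gt0.
apply => //.
- by apply/measurable_EFinP; exact: measurable_indic.
- by move=> x y A'x B'y; rewrite lee_fin indicE mem_set//; exact: AZ.
Qed.

End euclidean_ball.

(** * Schwartz functions *)

Section mean_value.
Context {R : realType} {n : nat}.
Implicit Types (x y : 'rV[R]_n) (phi : 'rV[R]_n -> R) (i : 'I_n).

Lemma is_derive_line phi x i (t : R) : (forall x i, derivable phi x (ebasis R i)) ->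
  is_derive t (1 : R) (fun s : R => phi (x + s *: ebasis R i)) (partial i phi (x + t *: ebasis R i)).
Proof.
move=> dphi; have E : (fun h => h^-1 *: (((fun s : R => phi (x + s *: ebasis R i)) \o shift t) (h *: (1 : R))
      - phi (x + t *: ebasis R i))) =
   (fun h => h^-1 *: ((phi \o shift (x + t *: ebasis R i)) (h *: ebasis R i) - phi (x + t *: ebasis R i))).
  apply/funext => h /=; congr (_ *: (phi _ - _)).
  by rewrite /shift /= [h *: 1]mulr1 scalerDl addrCA.
apply: DeriveDef.
  by rewrite /derivable E; exact: dphi.
by rewrite /derive E.
Qed.

Lemma mean_value_line phi x i (s : R) : (forall x i, derivable phi x (ebasis R i)) ->
  exists2 c : R, `|c| <= `|s| &
    phi (x + s *: ebasis R i) - phi x = s * partial i phi (x + c *: ebasis R i).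
Proof.
move=> dphi; pose f (t : R) := phi (x + t *: ebasis R i).
pose df (t : R) := partial i phi (x + t *: ebasis R i).
have fd (t : R) : is_derive t (1 : R) f (df t) by exact: is_derive_line.
have cf a b : {within `[a, b], continuous f}.
  by apply: derivable_within_continuous => t _; apply: ex_derive.
have f0 : f 0 = phi x by rewrite /f scale0r addr0.
rewrite -f0 -/(f s); have [s0|s0] := leP 0 s.
  have [c] := @MVT_segment R f df 0 s s0 (fun t _ => fd t) (cf _ _).
  rewrite in_itv/= => /andP[c0 cs] ->; exists c; last by rewrite subr0 mulrC.
  by rewrite !ger0_norm.
have [c] := @MVT_segment R f df s 0 (ltW s0) (fun t _ => fd t) (cf _ _).
rewrite in_itv/= => /andP[c0 cs] fE; exists c.
  by rewrite !ler0_norm// ?lerN2// ltW.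
by rewrite -opprB fE sub0r mulrN opprK mulrC.
Qed.

(** The path from [x] to [x + y] runs parallel to the axes, one coordinate at a time, so that only
    partial derivatives are met. *)
Lemma mean_value_rV phi x y : (forall x i, derivable phi x (ebasis R i)) ->
  exists2 xi : 'I_n -> 'rV[R]_n, forall i j, `|xi i ord0 j - x ord0 j| <= `|y ord0 j| &
    phi (x + y) - phi x = \sum_i y ord0 i * partial i phi (xi i).
Proof.
move=> dphi.
pose z k : 'rV[R]_n := \row_j (x ord0 j + if (j < k)%N then y ord0 j else 0).
have zS i : z i.+1 = z i + y ord0 i *: ebasis R i.
  apply/rowP => j; rewrite !mxE eqxx/= eq_sym.
  have [->|ij] := eqVneq i j; first by rewrite ltnSn ltnn mulr1 addr0.
  rewrite mulr0 addr0 ltnS leq_eqVlt; case: eqVneq => // /val_inj ji.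
  by rewrite ji eqxx in ij.
have mv i : exists xi : 'rV[R]_n, (forall j, `|xi ord0 j - x ord0 j| <= `|y ord0 j|) /\
    phi (z i.+1) - phi (z i) = y ord0 i * partial i phi xi.
  have [c cy E] := mean_value_line (z i) i (y ord0 i) dphi.
  exists (z i + c *: ebasis R i); split; last by rewrite zS.
  move=> j; rewrite !mxE eqxx/= eq_sym; have [<-|ij] := eqVneq i j.
    by rewrite ltnn mulr1 addr0 addrAC subrr add0r.
  by rewrite mulr0 addr0 addrAC subrr add0r; case: ifP; rewrite ?normr0.
have [xi xiP] := choice mv; exists xi; first by move=> i; have [] := xiP i.
have -> : x + y = z n by apply/rowP => j; rewrite !mxE ltn_ord.
have -> : x = z 0 by apply/rowP => j; rewrite !mxE ltn0 addr0.
rewrite -(telescope_sumr (fun k => phi (z k)) (leq0n n)) big_mkord.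
by apply: eq_bigr => i _; have [] := xiP i.
Qed.

(** The predicate [schwartz] speaks of derivatives along basis vectors; bounds on these give a
    Lipschitz estimate and hence continuity. *)
Lemma bounded_partial_continuous phi C : (forall x i, derivable phi x (ebasis R i)) ->
  (forall x i, `|partial i phi x| <= C) -> continuous phi.
Proof.
move=> dphi bphi x; have C0 : 0 <= Num.max C 1 by rewrite le_max ler01 orbT.
have lip y : `|phi (x + y) - phi x| <= n%:R * Num.max C 1 * `|y|.
  have [xi _ ->] := mean_value_rV x y dphi.
  apply: (le_trans (ler_norm_sum _ _ _)).
  apply: (@le_trans _ _ (\sum_(i < n) (Num.max C 1 * `|y|))).
    apply: ler_sum => i _; rewrite normrM mulrC; apply: ler_pM => //.
      by rewrite le_max bphi.
    by rewrite [leRHS]/Num.norm/= mx_normrE; apply: (le_bigmax _ (fun ij => `|y ij.1 ij.2|) (ord0, i)).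
  by rewrite sumr_const card_ord -[leLHS]mulr_natl mulrA.
apply/(@cvgrPdist_le _ _ _ (nbhs x) (nbhs_filter x)) => e e0.
have N0 : 0 < n%:R * Num.max C 1 + 1 by rewrite ltr_wpDl// mulr_ge0.
apply/nbhs_ballP; exists (e / (n%:R * Num.max C 1 + 1)); first by rewrite /= divr_gt0.
move=> z; rewrite mx_norm_ball /ball_ /= => xz.
have zE : z = x + (z - x) by rewrite addrC subrK.
rewrite distrC zE; apply: (le_trans (lip _)).
move: xz; rewrite distrC ltr_pdivlMr// => /ltW; apply: le_trans.
by rewrite mulrC ler_wpM2l// lerDl.
Qed.

End mean_value.

(** * An integrable weight that dominates Schwartz functions *)

Section weight.
Context {R : realType} {n : nat}.
Notation mu := (@lebesgue_measure R).
Implicit Types (x y : 'rV[R]_n).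

(** A product, so that its integral factors into [n] copies of [pi]. Every decay bound and every
    error term below is a multiple of it. *)
Definition dweight x : R := \prod_i (oneDsqr (x ord0 i))^-1.

Lemma dweight_gt0 x : 0 < dweight x.
Proof. by apply: prodr_gt0 => i _; rewrite invr_gt0 (lt_le_trans ltr01)// oneDsqr_ge1. Qed.

Lemma dweight_le1 x : dweight x <= 1.
Proof.
apply: Num.Theory.prodr_ile1 => i _.
by rewrite invr_ge0 (le_trans ler01 (oneDsqr_ge1 _))/= oneDsqrV_le1.
Qed.

Lemma measurable_dweight : measurable_fun setT dweight.
Proof.
apply: measurable_prod => i _.
apply: (@measurableT_comp _ _ _ _ _ _ (fun t : R => (oneDsqr t)^-1)); last exact: measurable_coord.
by apply: continuous_measurable_fun; exact: continuous_oneDsqrV.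
Qed.

(** One factor 3 per coordinate: [|t - s| <= 1] implies [1 + s^2 <= 3 (1 + t^2)], because
    [s^2 = 2 t^2 + 2 (s - t)^2 - (s - 2 t)^2]. *)
Lemma dweight_shift x y : (forall i, `|y ord0 i - x ord0 i| <= 1) ->
  dweight y <= 3 ^+ n * dweight x.
Proof.
move=> xy; rewrite /dweight -[in X in X * _](card_ord n) -prodr_const -big_split/=.
apply: ler_prod => i _; have o t : 0 < oneDsqr t :> R.
  by rewrite (lt_le_trans ltr01)// oneDsqr_ge1.
rewrite invr_ge0 ltW//= -[X in X <= _]div1r ler_pdivrMr// mulrAC ler_pdivlMr// mul1r /oneDsqr.
have := xy i; rewrite ler_norml => /andP[].
by move: (x ord0 i) (y ord0 i) => s t; have := sqr_ge0 (s - 2 * t); nra.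
Qed.

Lemma integral_dweight : exists2 W : R, 0 <= W & integral_Rn (fun x => (dweight x)%:E) = W%:E.
Proof.
pose phi : 'I_n -> R -> R := fun=> fun t => (oneDsqr t)^-1.
have phi0 i t : 0 <= phi i t by rewrite invr_ge0 (le_trans ler01)// oneDsqr_ge1.
have phiI i : (\int[mu]_t (phi i t)%:E = pi%:E)%E.
  rewrite ge0_symfun_integralT//.
  - have -> : [set x : R | 0 <= x] = `[0, +oo[%classic by rewrite set_itvcy.
    by rewrite integral0y_oneDsqr -EFinM mulrC divfK.
  - exact: continuous_oneDsqrV.
  - by move=> t /=; rewrite /phi /oneDsqr sqrrN.
exists (\prod_(i < n) pi); first by apply: prodr_ge0 => i _; exact: pi_ge0.
rewrite (integral_Rn_prod (phi := phi) (I := fun=> pi))// => i.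
by apply: continuous_measurable_fun; exact: continuous_oneDsqrV.
Qed.

End weight.

(** * Decay and Taylor estimates for the squared modulus *)

Section schwartz_estimates.
Context {R : realType} {n : nat}.
Implicit Types (x y : 'rV[R]_n) (u v : 'rV[R]_n -> R).

Lemma oneDsqr_coord_le x i : oneDsqr (x ord0 i) <= (1 + enorm x) ^+ 2.
Proof.
rewrite /oneDsqr; have := coord_le_enorm x i; have := enorm_ge0 x.
have := normr_ge0 (x ord0 i); rewrite -(real_normK (num_real (x ord0 i))).
by move: `|x ord0 i| (enorm x) => s t; nra.
Qed.

(** Decay of order [2 * n] is used: each of the [n] factors [1 + x_i^2] is at most
    [(1 + enorm x)^2]. *)
Lemma schwartz_dpart_bound u s : schwartz u ->
  exists2 C, 0 <= C & forall x, `|dpart s u x| <= C * dweight x.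
Proof.
move=> [_ /(_ s (2 * n)%N) [C uC]]; exists (Num.max C 0); first by rewrite le_max lexx orbT.
move=> x; have w0 := dweight_gt0 x.
rewrite -ler_pdivrMr//; apply: (@le_trans _ _ C); last by rewrite le_max lexx.
apply: le_trans (uC x); rewrite mulrC; apply: ler_wpM2r => //.
rewrite /dweight -prodfV; under eq_bigr do rewrite invrK.
rewrite exprM; have := oneDsqr_coord_le x; move: ((1 + enorm x) ^+ 2) => c xc.
rewrite -[X in c ^+ X](card_ord n) -prodr_const; apply: ler_prod => i _.
by rewrite xc andbT (le_trans ler01)// oneDsqr_ge1.
Qed.

Lemma schwartz_continuous u s : schwartz u -> continuous (dpart s u).
Proof.
move=> su; have B i : exists C, forall x, `|partial i (dpart s u) x| <= C.
  have [C C0 uC] := schwartz_dpart_bound (i :: s) su.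
  by exists C => x; apply: (le_trans (uC x)); rewrite ler_piMr// dweight_le1.
have [C BC] := choice B.
apply: (@bounded_partial_continuous R n _ (\sum_i `|C i|)).
  by move=> x i; exact: su.1.
move=> x i; apply: (le_trans (BC i x)); apply: (le_trans (ler_norm _)).
by rewrite (bigD1 i)//= lerDl sumr_ge0.
Qed.

(** The mean value formula applied twice, first to [u] and then to its partial derivatives. The two
    factors [n] count the two sums, and [3^n] moves the weight from the intermediate point back to
    [x]. *)
Lemma schwartz_taylor u : schwartz u -> exists2 C, 0 <= C &
  forall x y e, 0 <= e <= 1 -> (forall i, `|y ord0 i| <= e) ->
  `|u (x + y) - u x - \sum_i y ord0 i * partial i u x| <= C * e ^+ 2 * dweight x.
Proof.
move=> su.
have B (ij : 'I_n * 'I_n) : exists C, 0 <= C /\ forall x, `|partial ij.1 (partial ij.2 u) x| <= C * dweight x.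
  have [C C0 uC] := schwartz_dpart_bound [:: ij.1; ij.2] su.
  by exists C.
have [C BC] := choice B.
pose C1 := \sum_ij C ij.
have C0 ij : 0 <= C ij by have [] := BC ij.
have CC1 ij : C ij <= C1 by rewrite /C1 (bigD1 ij)//= lerDl sumr_ge0.
have C10 : 0 <= C1 by apply: sumr_ge0.
exists (n%:R * (n%:R * (C1 * 3 ^+ n))); first by rewrite !mulr_ge0// exprn_ge0.
move=> x y e /andP[e0 e1] ye.
have [xi xiP ->] := mean_value_rV x y (fun z i => su.1 [::] i z).
rewrite -sumrB; apply: (le_trans (ler_norm_sum _ _ _)).
apply: (@le_trans _ _ (\sum_(i < n) (e * (n%:R * (e * (C1 * (3 ^+ n * dweight x))))))); last first.
  rewrite sumr_const card_ord -[leLHS]mulr_natl expr2.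
  by rewrite le_eqVlt; apply/orP; left; apply/eqP; ring.
apply: ler_sum => i _; rewrite -mulrBr normrM; apply: ler_pM => //.
have -> : xi i = x + (xi i - x) by rewrite addrC subrK.
have [eta etaP ->] := mean_value_rV x (xi i - x) (fun z j => su.1 [:: i] j z).
apply: (le_trans (ler_norm_sum _ _ _)).
apply: (@le_trans _ _ (\sum_(j < n) (e * (C1 * (3 ^+ n * dweight x))))); last first.
  by rewrite sumr_const card_ord -[leLHS]mulr_natl.
have xie j : `|(xi i - x) ord0 j| <= e by rewrite !mxE; apply: le_trans (xiP i j) (ye j).
apply: ler_sum => j _; rewrite normrM; apply: ler_pM => //.
have [_ /(_ (eta j)) h] := BC (j, i); apply: (le_trans h).
apply: ler_pM => //; first exact/ltW/dweight_gt0.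
by apply: dweight_shift => k; apply: le_trans (etaP j k) (le_trans (xie k) e1).
Qed.

(** Lagrange's identity: the defect is half of a double sum of squares. *)
Lemma cauchy_schwarz_sum (a b : 'I_n -> R) :
  (\sum_i a i * b i) ^+ 2 <= (\sum_i a i ^+ 2) * (\sum_i b i ^+ 2).
Proof.
have : 0 <= \sum_i \sum_j (a i * b j - a j * b i) ^+ 2.
  by apply: sumr_ge0 => i _; apply: sumr_ge0 => j _; exact: sqr_ge0.
have -> : \sum_i \sum_j (a i * b j - a j * b i) ^+ 2 =
  2 * ((\sum_i a i ^+ 2) * (\sum_i b i ^+ 2) - (\sum_i a i * b i) ^+ 2).
  rewrite expr2 !big_distrlr/= mulrBr; transitivity (
    \sum_i \sum_j (a i ^+ 2 * b j ^+ 2) + \sum_i \sum_j (a j ^+ 2 * b i ^+ 2)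
    - 2 * (\sum_i \sum_j (a i * b i * (a j * b j)))).
    rewrite mulr_sumr -big_split -sumrB; apply: eq_bigr => i _.
    rewrite mulr_sumr -big_split -sumrB; apply: eq_bigr => j _ /=; ring.
  by congr (_ - _); rewrite [X in _ + X]exchange_big/= mulr_natl mulr2n.
by rewrite pmulr_rge0// subr_ge0.
Qed.

Definition sqmod u v x : R := u x ^+ 2 + v x ^+ 2.
(** The partial derivative of [|f|^2] in direction [i], given by its formula, so that [gradnorm] is
    the length of the gradient of [|f|^2]. *)
Definition dsqmod u v i x : R := 2 * (u x * partial i u x + v x * partial i v x).
Definition gradnorm u v x : R := Num.sqrt (\sum_i (dsqmod u v i x) ^+ 2).

Lemma sqmod_ge0 u v x : 0 <= sqmod u v x. Proof. by rewrite addr_ge0 ?sqr_ge0. Qed.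

Lemma gradnorm_ge0 u v x : 0 <= gradnorm u v x. Proof. exact: sqrtr_ge0. Qed.

Lemma sqr_gradnorm u v x : gradnorm u v x ^+ 2 = \sum_i (dsqmod u v i x) ^+ 2.
Proof. by rewrite sqr_sqrtr// sumr_ge0// => i _; rewrite sqr_ge0. Qed.

Lemma grad_sq_ge0 u x : 0 <= grad_sq u x.
Proof. by apply: sumr_ge0 => i _; rewrite sqr_ge0. Qed.

(** In direction [i] the two sides differ by [4 (u * partial i v - v * partial i u)^2]: what is lost
    is the variation of the phase of [f]. *)
Lemma gradnorm_le u v x :
  gradnorm u v x ^+ 2 <= 4 * sqmod u v x * (grad_sq u x + grad_sq v x).
Proof.
rewrite sqr_gradnorm /grad_sq -big_split/= mulr_sumr; apply: ler_sum => i _.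
rewrite /dsqmod /sqmod; move: (u x) (v x) (partial i u x) (partial i v x) => a b c d.
by have := sqr_ge0 (a * d - b * c); nra.
Qed.

Lemma sqmod_continuous u v : schwartz u -> schwartz v -> continuous (sqmod u v).
Proof.
move=> su sv x; have cu := @schwartz_continuous u [::] su x; have cv := @schwartz_continuous v [::] sv x.
have c2 (w : 'rV[R]_n -> R) : {for x, continuous w} -> {for x, continuous (fun z => w z ^+ 2)}.
  by move=> cw; exact: (@cvgM _ _ (nbhs x) _ _ _ _ _ cw cw).
exact: (@cvgD _ _ _ (nbhs x) _ _ _ _ _ (c2 u cu) (c2 v cv)).
Qed.

Lemma measurable_sqmod u v : schwartz u -> schwartz v -> measurable_fun setT (sqmod u v).
Proof. by move=> su sv; apply: continuous_measurable_rV; exact: sqmod_continuous. Qed.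

Lemma measurable_dpart u s : schwartz u -> measurable_fun setT (dpart s u).
Proof. by move=> su; apply: continuous_measurable_rV; exact: schwartz_continuous. Qed.

Lemma measurable_gradnorm u v : schwartz u -> schwartz v -> measurable_fun setT (gradnorm u v).
Proof.
move=> su sv; apply: (@measurableT_comp _ _ _ _ _ _ (Num.sqrt : R -> R)).
  by apply: continuous_measurable_fun; exact: sqrt_continuous.
apply: measurable_sum => i; apply: measurable_funX; apply: measurable_funM => //.
apply: measurable_funD; apply: measurable_funM.
- exact: (@measurable_dpart u [::] su).
- exact: (@measurable_dpart u [:: i] su).
- exact: (@measurable_dpart v [::] sv).
- exact: (@measurable_dpart v [:: i] sv).
Qed.

Lemma measurable_grad_sq u : schwartz u -> measurable_fun setT (grad_sq u).
Proof.
move=> su; apply: measurable_sum => i; apply: measurable_funX.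
exact: (@measurable_dpart u [:: i] su).
Qed.

Lemma schwartz_lip u : schwartz u -> exists2 C, 0 <= C &
  forall x y e, 0 <= e <= 1 -> (forall i, `|y ord0 i| <= e) ->
  [/\ `|u x| <= C * dweight x, `|\sum_i y ord0 i * partial i u x| <= C * e * dweight x &
   `|u (x + y) - u x - \sum_i y ord0 i * partial i u x| <= C * e ^+ 2 * dweight x].
Proof.
move=> su; have [C1 C10 h1] := schwartz_dpart_bound [::] su.
have B i : exists C, 0 <= C /\ forall x, `|partial i u x| <= C * dweight x.
  by have [C C0 uC] := schwartz_dpart_bound [:: i] su; exists C.
have [C2 h2] := choice B; have C20 i : 0 <= C2 i by have [] := h2 i.
have [C3 C30 h3] := schwartz_taylor su.
pose S := \sum_i C2 i; have S0 : 0 <= S by exact: sumr_ge0.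
exists (C1 + S + C3); first by rewrite !addr_ge0.
move=> x y e e01 ye; have w0 := dweight_gt0 x; have /andP[e0 e1] := e01.
split.
- apply: (le_trans (h1 x)); rewrite ler_pM2r//; lra.
- apply: (@le_trans _ _ (S * e * dweight x)).
    apply: (le_trans (ler_norm_sum _ _ _)); rewrite /S !mulr_suml; apply: ler_sum => i _.
    rewrite normrM -mulrA mulrCA; apply: ler_pM => //.
    by have [_] := h2 i; exact.
  by rewrite ler_pM2r// ler_wpM2r//; lra.
- apply: (le_trans (h3 x y e e01 ye)).
  by rewrite ler_pM2r// ler_wpM2r ?exprn_ge0//; lra.
Qed.

Lemma sqmod_bound u v : schwartz u -> schwartz v ->
  exists2 C, 0 <= C & forall x, sqmod u v x <= C * dweight x.
Proof.
move=> su sv; have [C1 C10 h1] := schwartz_dpart_bound [::] su.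
have [C2 C20 h2] := schwartz_dpart_bound [::] sv.
exists (C1 ^+ 2 + C2 ^+ 2); first by rewrite addr_ge0 ?sqr_ge0.
move=> x; rewrite /sqmod -(real_normK (num_real (u x))) -(real_normK (num_real (v x))).
have := h1 x; have := h2 x; rewrite /=; have := dweight_le1 x; have := dweight_gt0 x.
move: (normr_ge0 (u x)) (normr_ge0 (v x)).
move: `|u x| `|v x| (dweight x) => a b w a0 b0 w0 w1 bC aC.
have aa : a ^+ 2 <= C1 ^+ 2 * w ^+ 2 by rewrite -exprMn ler_pXn2r ?nnegrE// (le_trans a0).
have bb : b ^+ 2 <= C2 ^+ 2 * w ^+ 2 by rewrite -exprMn ler_pXn2r ?nnegrE// (le_trans b0).
have ww : w ^+ 2 <= w by rewrite expr2 ger_pMr.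
have := sqr_ge0 C1; have := sqr_ge0 C2; nra.
Qed.

Lemma gradnorm_bound u v : schwartz u -> schwartz v ->
  exists2 C, 0 <= C & forall x, gradnorm u v x <= C * dweight x.
Proof.
move=> su sv; have [C1 C10 h1] := schwartz_dpart_bound [::] su.
have [C2 C20 h2] := schwartz_dpart_bound [::] sv.
have B w i : schwartz w -> exists C, 0 <= C /\ forall x, `|partial i w x| <= C * dweight x.
  by move=> sw; have [C C0 uC] := schwartz_dpart_bound [:: i] sw; exists C.
have [D1 k1] := choice (fun i => B u i su); have [D2 k2] := choice (fun i => B v i sv).
pose S := \sum_i (2 * (C1 * D1 i + C2 * D2 i)).
have T0 i : 0 <= 2 * (C1 * D1 i + C2 * D2 i).
  by have [? _] := k1 i; have [? _] := k2 i; rewrite mulr_ge0// addr_ge0// mulr_ge0.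
exists S; first exact: sumr_ge0.
move=> x; have w0 := dweight_gt0 x; have w1 := dweight_le1 x.
have h i : `|dsqmod u v i x| <= 2 * (C1 * D1 i + C2 * D2 i) * dweight x.
  rewrite /dsqmod normrM ger0_norm// -mulrA ler_pM2l// (le_trans (ler_normD _ _))// !normrM.
  have [d1 /(_ x) e1] := k1 i; have [d2 /(_ x) e2] := k2 i.
  have := h1 x; have := h2 x => /= f2 f1.
  have g1 : `|u x| * `|partial i u x| <= C1 * D1 i * dweight x.
    apply: (@le_trans _ _ ((C1 * dweight x) * (D1 i * dweight x))); first exact: ler_pM.
    by rewrite mulrACA ler_wpM2l ?mulr_ge0// ger_pMr.
  have g2 : `|v x| * `|partial i v x| <= C2 * D2 i * dweight x.
    apply: (@le_trans _ _ ((C2 * dweight x) * (D2 i * dweight x))); first exact: ler_pM.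
    by rewrite mulrACA ler_wpM2l ?mulr_ge0// ger_pMr.
  by rewrite mulrDl lerD.
rewrite -(ler_pXn2r (_ : 0 < 2)%N) ?nnegrE ?gradnorm_ge0//; last by rewrite mulr_ge0 ?sumr_ge0 ?ltW.
rewrite sqr_gradnorm /S mulr_suml expr2 big_distrl/=; apply: ler_sum => i _.
rewrite -(real_normK (num_real _)) expr2.
apply: ler_pM => //; apply: (le_trans (h i)).
rewrite (bigD1 i)//= lerDl sumr_ge0// => j _.
by rewrite mulr_ge0// ltW.
Qed.

(** With [L] the linear part and [r] the remainder of [w], expanding [(w + L + r)^2] leaves
    [L^2 + 2 w r + 2 L r + r^2], each bounded by [C^2 e^2 dweight x] times its coefficient; 1, 2, 2
    and 1 add up to 6. The linear part of [u^2 + v^2] is controlled by Cauchy-Schwarz. *)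
Lemma sqmod_taylor u v : schwartz u -> schwartz v -> exists2 C, 0 <= C &
  forall x y e, 0 < e <= 1 -> enorm y < e ->
  sqmod u v (x + y) <= sqmod u v x + e * gradnorm u v x + C * e ^+ 2 * dweight x.
Proof.
move=> su sv; have [C1 C10 h1] := schwartz_lip su; have [C2 C20 h2] := schwartz_lip sv.
exists (6 * C1 ^+ 2 + 6 * C2 ^+ 2); first by rewrite addr_ge0// mulr_ge0// sqr_ge0.
move=> x y e /andP[e0 e1] ye; have w0 := dweight_gt0 x; have w1 := dweight_le1 x.
have ye' i : `|y ord0 i| <= e by apply: le_trans (coord_le_enorm y i) (ltW ye).
have e01 : 0 <= e <= 1 by rewrite ltW.
have sq1 (w : 'rV[R]_n -> R) C : 0 <= C ->
  [/\ `|w x| <= C * dweight x, `|\sum_i y ord0 i * partial i w x| <= C * e * dweight x &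
   `|w (x + y) - w x - \sum_i y ord0 i * partial i w x| <= C * e ^+ 2 * dweight x] ->
   w (x + y) ^+ 2 <= w x ^+ 2 + 2 * w x * (\sum_i y ord0 i * partial i w x) + 6 * C ^+ 2 * e ^+ 2 * dweight x.
  move=> C0 []; move: (\sum_i _) => L aw aL; set r := (X in `|X|) => ar.
  have -> : w (x + y) = w x + L + r by rewrite /r; ring.
  move: aw aL ar; move: (w x) r (dweight x) w0 w1 => a r W w0 w1 aw aL ar.
  have Cw : 0 <= C * W by rewrite mulr_ge0// ltW.
  have m (p q P Q : R) : `|p| <= P -> `|q| <= Q -> p * q <= P * Q.
    by move=> pP qQ; rewrite (le_trans (ler_norm _))// normrM ler_pM.
  have LL := m _ _ _ _ aL aL; have aR := m _ _ _ _ aw ar; have LR := m _ _ _ _ aL ar; have RR := m _ _ _ _ ar ar.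
  have ee : e ^+ 2 <= 1 by rewrite expr_le1// ltW.
  have e3 : e ^+ 3 <= e ^+ 2 by rewrite exprS ger_pMl// exprn_gt0.
  have e4 : e ^+ 4 <= e ^+ 2 by rewrite (exprD e 2 2) ger_pMr// exprn_gt0.
  have ww : W ^+ 2 <= W by rewrite expr2 ger_pMr.
  have cc : C ^+ 2 * e ^+ 2 * W ^+ 2 <= C ^+ 2 * e ^+ 2 * W by rewrite ler_wpM2l// mulr_ge0// ?sqr_ge0// exprn_ge0// ltW.
  have c3 : C ^+ 2 * W ^+ 2 * e ^+ 3 <= C ^+ 2 * W ^+ 2 * e ^+ 2 by rewrite ler_wpM2l// mulr_ge0 ?sqr_ge0.
  have c4 : C ^+ 2 * W ^+ 2 * e ^+ 4 <= C ^+ 2 * W ^+ 2 * e ^+ 2 by rewrite ler_wpM2l// mulr_ge0 ?sqr_ge0.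
  nra.
have hu := sq1 u C1 C10 (h1 x y e e01 ye'); have hv := sq1 v C2 C20 (h2 x y e e01 ye').
have lin : 2 * u x * (\sum_i y ord0 i * partial i u x) + 2 * v x * (\sum_i y ord0 i * partial i v x)
    = \sum_i dsqmod u v i x * y ord0 i.
  by rewrite !mulr_sumr -big_split; apply: eq_bigr => i _ /=; rewrite /dsqmod; ring.
have cs : \sum_i dsqmod u v i x * y ord0 i <= e * gradnorm u v x.
  apply: (@le_trans _ _ (enorm y * gradnorm u v x)); last by rewrite ler_wpM2r ?gradnorm_ge0// ltW.
  apply: (le_trans (ler_norm _)).
  rewrite -(ler_pXn2r (_ : 0 < 2)%N) ?nnegrE ?mulr_ge0 ?gradnorm_ge0 ?enorm_ge0//.
  by rewrite real_normK ?num_real// exprMn sqr_gradnorm sqr_enorm [leRHS]mulrC cauchy_schwarz_sum.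
rewrite /sqmod; lra.
Qed.

End schwartz_estimates.

(** Supplies the perimeter term: the first-order growth in [e] of the volume of a ball, up to the
    factor [omega]. *)
Lemma bernoulli_exp (R : realType) n (r e : R) : 0 <= r -> 0 <= e ->
  r ^+ n + n%:R * e * r ^+ n.-1 <= (r + e) ^+ n.
Proof.
move=> r0 e0; case: n => [|n]; first by rewrite !expr0 !mul0r addr0.
elim: n => [|n IH]; first by rewrite !expr1 expr0 mul1r mulr1.
rewrite [leRHS]exprS; have re0 : 0 <= r + e by rewrite addr_ge0.
apply: le_trans (ler_wpM2l re0 IH); rewrite /= !(exprS r) -[n.+2]addn1 natrD.
have := exprn_ge0 n r0; move: (r ^+ n) => s s0.
have := ler0n R n.+1; move: n.+1%:R => m m0.
rewrite -subr_ge0 (_ : _ - _ = m * (s * e ^+ 2)); last by ring.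
by rewrite !mulr_ge0// sqr_ge0.
Qed.

(** * Isoperimetric inequality for level sets *)

Section levels.
Context {R : realType} {n : nat}.
Notation mu := (@lebesgue_measure R).
Implicit Types (x y : 'rV[R]_n).
Variables (g : 'rV[R]_n -> R) (Cg : R).
Hypotheses (mg : measurable_fun setT g) (g0 : forall x, 0 <= g x).
Hypothesis gC : forall x, g x <= Cg * dweight x.

Definition superlevel t : set 'rV[R]_n := [set x | t < g x].

Lemma measurable_superlevel t : measurable (superlevel t).
Proof.
rewrite (_ : superlevel t = g @^-1` `]t, +oo[%classic).
  by rewrite -[X in measurable X]setTI; exact: mg.
by apply/seteqP; split => x /=; rewrite in_itv/= andbT.
Qed.

(** The weight is at most [1 / (1 + x_i^2)], so [t < g x] forces [1 + x_i^2 < Cg / t], and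
    [|x_i| <= 1 + x_i^2]. *)
Lemma in_box_superlevel t : 0 < t -> in_box (Cg / t + 1) (superlevel t).
Proof.
move=> t0 x tx i; have w0 := dweight_gt0 x.
have o0 j : 0 < oneDsqr (x ord0 j) by rewrite (lt_le_trans ltr01)// oneDsqr_ge1.
have wi : dweight x <= (oneDsqr (x ord0 i))^-1.
  rewrite /dweight (bigD1 i)//= ger_pMr ?invr_gt0//.
  apply: Num.Theory.prodr_ile1 => j _.
  by rewrite invr_ge0 ltW//= oneDsqrV_le1.
have Cg0 : 0 < Cg.
  by rewrite -(pmulr_lgt0 _ w0); apply: lt_le_trans (gC x); exact: lt_trans tx.
have h : oneDsqr (x ord0 i) < Cg / t.
  rewrite ltr_pdivlMr// mulrC -ltr_pdivlMr// (lt_le_trans tx)// (le_trans (gC x))//.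
  by rewrite ler_pM2l.
apply: le_lt_trans (_ : oneDsqr (x ord0 i) < _); last by apply: (lt_trans h); rewrite ltrDl.
rewrite /oneDsqr -(real_normK (num_real (x ord0 i))).
by have := sqr_ge0 (`|x ord0 i| - 1); have := normr_ge0 (x ord0 i); nra.
Qed.

Lemma Cg_ge0 : 0 <= Cg.
Proof.
have w0 := dweight_gt0 (0 : 'rV[R]_n).
by rewrite -(pmulr_lge0 _ w0); apply: le_trans (gC 0).
Qed.

Lemma rvol_superlevel_fin t : 0 < t -> rvol (superlevel t) \is a fin_num.
Proof.
move=> t0; apply: (@iint_indic_fin _ _ (Cg / t + 1)) => //.
- by rewrite addr_ge0// divr_ge0 ?Cg_ge0// ltW.
- exact: measurable_superlevel.
- exact: in_box_superlevel.
Qed.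

(** The radius of the ball with the volume of [superlevel t]. It has this meaning for [0 < t], where
    the volume is finite; an infinite volume is sent to 0 by [fine]. *)
Definition rad t : R := (fine (rvol (superlevel t)) / @omega R n) `^ n%:R^-1.

Lemma rad_ge0 t : 0 <= rad t. Proof. exact: powR_ge0. Qed.

Hypothesis n0 : (0 < n)%N.

Lemma rvol_superlevel t : 0 < t -> rvol (superlevel t) = (@omega R n * rad t ^+ n)%:E.
Proof.
move=> t0; have o0 := @omega_gt0 R n.
rewrite -powR_mulrn ?rad_ge0// /rad -powRrM mulVf ?pnatr_eq0 -?lt0n// powRr1; last first.
  by rewrite divr_ge0 ?fine_ge0// ltW.
by rewrite mulrC divfK ?gt_eqF// fineK// rvol_superlevel_fin.
Qed.

Lemma measurable_rad : measurable_fun setT rad.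
Proof.
apply: (@measurableT_comp _ _ _ _ _ _ (fun t : R => t `^ n%:R^-1)); first exact: measurable_powR.
apply: measurable_funM => //; apply: (measurableT_comp (fine_measurable measurableT)).
have mE : measurable [set z : 'rV[R]_n * R | z.2 < g z.1].
  rewrite -[X in measurable X]setTI; apply: (@measurable_lte _ _ _ _ _ (fun z : 'rV[R]_n * R => z.2%:E) (fun z => (g z.1)%:E)) => //.
  - by apply/measurable_EFinP; exact: measurable_snd.
  - by apply/measurable_EFinP; exact: (measurableT_comp mg).
exact: (measurable_layer (@rvol R n) mE).
Qed.

Variables (rho : 'rV[R]_n -> R) (Cr Ct : R).
Hypotheses (mrho : measurable_fun setT rho) (rho0 : forall x, 0 <= rho x).
Hypothesis rhoC : forall x, rho x <= Cr * dweight x.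
Hypothesis Ct0 : 0 <= Ct.
Hypothesis gT : forall x y (e : R), 0 < e <= 1 -> enorm y < e ->
  g (x + y) <= g x + e * rho x + Ct * e ^+ 2 * dweight x.

Let H e x := g x + e * rho x + Ct * e ^+ 2 * dweight x.

Let mH e : measurable_fun setT (H e).
Proof.
apply: measurable_funD; last by apply: measurable_funM => //; exact: measurable_dweight.
by apply: measurable_funD => //; apply: measurable_funM.
Qed.

Let le_gH (e : R) x : 0 <= e -> g x <= H e x.
Proof.
move=> e0; rewrite /H -addrA lerDl addr_ge0 ?mulr_ge0 ?exprn_ge0//.
exact/ltW/dweight_gt0.
Qed.

Hypothesis n1 : (1 < n)%N.

(* [H e] majorises [g (x + y)] for [enorm y < e], so [g <= t < H e] contains the
   collar of width [e] around [superlevel t], and Brunn-Minkowski bounds its volume. *)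
Lemma level_isoperimetric (t e : R) : 0 < t -> 0 < e <= 1 ->
  ((e * (n%:R * @omega R n * rad t ^+ n.-1))%:E <= rvol [set x | (g x <= t < H e x)%R])%E.
Proof.
move=> t0 e01; have /andP[e0 e1] := e01; have o0 := @omega_gt0 R n.
(* If the level set is null, [rad t] is 0 and the left-hand side vanishes, [n.-1] being positive. *)
have [r0|] := ltP 0 (rad t); last first.
  move=> rle; have -> : rad t = 0 by apply/le_anti; rewrite rle rad_ge0.
  have /negPf n10 : n.-1 != 0%N by rewrite -lt0n -subn1 subn_gt0.
  by rewrite expr0n n10 !mulr0.
have mS : measurable (superlevel t) := measurable_superlevel t.
have mHt : measurable [set x | t < H e x].
  rewrite (_ : [set x | _] = H e @^-1` `]t, +oo[%classic).
    by rewrite -[X in measurable X]setTI; exact: mH.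
  by apply/seteqP; split => x /=; rewrite in_itv/= andbT.
have := @brunn_minkowski_ball R n (rad t) e _ (superlevel t) [set x | t < H e x] r0 e0 mS mHt
  (in_box_superlevel t0).
have mD : measurable [set x | g x <= t < H e x].
  rewrite (_ : [set x | _] = [set x | t < H e x] `\` superlevel t); first exact: measurableD.
  apply/seteqP; split => x /=.
    by move=> /andP[gt tH]; split => //; rewrite /superlevel /= ltNge gt.
  by move=> [tH /negP]; rewrite /superlevel /= -leNgt => ->.
move=> /(_ _ (rvol_superlevel t0)) bm.
have {bm} : ((@omega R n * (rad t + e) ^+ n)%:E <= rvol [set x | (t < H e x)%R])%E.
  apply: bm => x y tx ye /=; apply: (lt_le_trans tx).
  (* The Taylor bound is read backwards, from [x + y] to [x], so that [H e] is evaluated at the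
     outer point. *)
  have := @gT (x + y) (- y) e e01; rewrite addrK; apply.
  by rewrite -scaleN1r enormZ normrN1 mul1r.
move=> /le_trans h.
have {h} : ((@omega R n * (rad t + e) ^+ n)%:E <= rvol ([set x | (g x <= t < H e x)%R] `|` superlevel t))%E.
  apply: h; apply: le_measureW => //; first exact: measurableU.
  move=> x tx /=; have [gt|tg] := leP (g x) t; last by right.
  by left; apply/andP; split.
have U2 : (rvol ([set x | (g x <= t < H e x)%R] `|` superlevel t) <=
  rvol [set x | (g x <= t < H e x)%R] + rvol (superlevel t))%E := measureU2 _ mD mS.
move=> /le_trans /(_ U2); rewrite (rvol_superlevel t0) -leeBlDr// -EFinB.
apply: le_trans; rewrite lee_fin -mulrBr.
have := bernoulli_exp n (ltW r0) (ltW e0); move: (rad t ^+ n.-1) => q b.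
rewrite (_ : e * _ = @omega R n * (n%:R * e * q)); last by ring.
by rewrite ler_pM2l// lerBrDl.
Qed.

(* Integrate [level_isoperimetric] against [lam] and let [e] tend to 0; the
   Lipschitz bound absorbs the replacement of [lam t] by [lam (g x)] on the collar. *)
Lemma functional_isoperimetric (lam : R -> R) (L k : R) :
  measurable_fun setT lam -> 0 <= k -> (forall t, 0 <= lam t) -> (forall t, lam t <= L) ->
  (forall s t, lam t <= lam s + k * `|t - s|) ->
  (\int[mu]_t (\1_(`]0%R, +oo[%classic : set R) t * (lam t * (n%:R * @omega R n * rad t ^+ n.-1)))%:E
    <= \int[rvol]_x (lam (g x) * rho x)%:E)%E.
Proof.
move=> mlam k0 lam0 lamL lamk.
have L0 : 0 <= L by exact: le_trans (lamL 0).
have Cr0 : 0 <= Cr.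
  have w0 := dweight_gt0 (0 : 'rV[R]_n).
  by rewrite -(pmulr_lge0 _ w0); apply: le_trans (rhoC 0).
have o0 := @omega_gt0 R n.
have [W W0 intW] := @integral_dweight R n.
rewrite integral_RnE in intW; last 2 first.
- by apply/measurable_EFinP; exact: measurable_dweight.
- by move=> x; rewrite lee_fin; exact/ltW/dweight_gt0.
pose f t : R := \1_(`]0%R, +oo[%classic : set R) t * (lam t * (n%:R * @omega R n * rad t ^+ n.-1)).
have f0 t : 0 <= f t by rewrite !mulr_ge0// ?exprn_ge0 ?rad_ge0// ltW.
have mf : measurable_fun setT f.
  apply: measurable_funM; first exact: measurable_indic.
  apply: measurable_funM => //; apply: measurable_funM => //.
  by apply: measurable_funX; exact: measurable_rad.
(* The summand [L * Ct] pays for the Taylor remainder in the thickness [H e x - g x], and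
   [k * (Cr + Ct)^2] for replacing [lam t] by [lam (g x)] across a thickness of at most
   [e * (Cr + Ct) * dweight x]. *)
pose C2 := L * Ct + k * (Cr + Ct) ^+ 2.
have Cs0 : 0 <= (Cr + Ct) ^+ 2 by exact: sqr_ge0.
have C20 : 0 <= C2 by apply: addr_ge0; apply: mulr_ge0.
have mlg : measurable_fun setT (fun x => (lam (g x) * rho x)%:E).
  by apply/measurable_EFinP; apply: measurable_funM => //; exact: measurableT_comp.
have lg0 x : (0 <= (lam (g x) * rho x)%:E)%E by rewrite lee_fin mulr_ge0.
have step e : 0 < e <= 1 ->
    (e%:E * \int[mu]_t (f t)%:E <= e%:E * \int[rvol]_x (lam (g x) * rho x)%:E + (e ^+ 2 * C2 * W)%:E)%E.
  move=> e01; have /andP[e0 e1] := e01; have e0' := ltW e0.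
  pose E : set ('rV[R]_n * R) := [set z | g z.1 <= z.2 < H e z.1].
  have mE : measurable E.
    rewrite (_ : E = [set z | ((g z.1)%:E <= z.2%:E)%E] `&` [set z | (z.2%:E < (H e z.1)%:E)%E]); last first.
      by apply/seteqP; split => z /=; rewrite lee_fin lte_fin => /andP.
    apply: measurableI.
      rewrite -[X in measurable X]setTI; apply: measurable_lee => //.
      - by apply/measurable_EFinP; exact: (measurableT_comp mg).
      - by apply/measurable_EFinP; exact: measurable_snd.
    rewrite -[X in measurable X]setTI; apply: measurable_lte => //.
    - by apply/measurable_EFinP; exact: measurable_snd.
    - by apply/measurable_EFinP; exact: (measurableT_comp (mH e)).
  pose w t : R := \1_(`]0%R, +oo[%classic : set R) t * lam t.
  have w0 t : 0 <= w t by rewrite mulr_ge0.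
  have mw : measurable_fun setT w by apply: measurable_funM => //; exact: measurable_indic.
  rewrite -ge0_integralZl_EFin//; last 2 first.
  - by move=> t _; rewrite lee_fin.
  - exact/measurable_EFinP.
  apply: (@le_trans _ _ (\int[mu]_t ((w t)%:E * rvol [set x | E (x, t)]))%E).
    apply: ge0_le_integral => //.
    - by move=> t _; rewrite -EFinM lee_fin mulr_ge0.
    - by apply: emeasurable_funM => //; exact/measurable_EFinP.
    - apply: emeasurable_funM; first exact/measurable_EFinP.
      exact: (measurable_layer (@rvol R n) mE).
    move=> t _; rewrite /f /w indicE; have [/set_mem|_] := boolP (t \in _); last first.
      by rewrite !mul0r mule0 mul0e.
    rewrite /= in_itv/= andbT => t0; rewrite !mul1r -EFinM mulrCA EFinM.
    by apply: lee_wpmul2l; [rewrite lee_fin|exact: level_isoperimetric].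
  rewrite (tonelli_layer (@rvol R n) mE)// -ge0_integralZl_EFin// [(e ^+ 2 * C2 * W)%:E]EFinM -intW -ge0_integralZl_EFin//; last 3 first.
  - by move=> x _; rewrite lee_fin; exact/ltW/dweight_gt0.
  - by apply/measurable_EFinP; exact: measurable_dweight.
  - by rewrite mulr_ge0 ?exprn_ge0.
  rewrite -ge0_integralD//; last 4 first.
  - by move=> x _; rewrite mule_ge0// lee_fin.
  - by apply: emeasurable_funM.
  - by move=> x _; rewrite -EFinM lee_fin mulr_ge0 ?mulr_ge0 ?exprn_ge0//; exact/ltW/dweight_gt0.
  - by apply: emeasurable_funM => //; apply/measurable_EFinP; exact: measurable_dweight.
  apply: ge0_le_integral => //.
  - by move=> x _; apply: integral_ge0 => t _; rewrite lee_fin mulr_ge0.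
  - apply: (@measurable_fun_fubini_tonelli_F _ _ _ _ _ mu (fun z : 'rV[R]_n * R => (w z.2 * \1_E z)%:E)) => //=.
    + apply/measurable_EFinP; apply: measurable_funM; last exact: measurable_indic.
      exact: (measurableT_comp mw).
    + by move=> z; rewrite lee_fin mulr_ge0.
  - apply: emeasurable_funD; first exact: emeasurable_funM.
    by apply: emeasurable_funM => //; apply/measurable_EFinP; exact: measurable_dweight.
  move=> x _; have gH : g x <= H e x by exact: le_gH.
  pose c := lam (g x) + k * (H e x - g x).
  have c0 : 0 <= c by rewrite addr_ge0// mulr_ge0// subr_ge0.
  apply: (@le_trans _ _ (\int[mu]_t (c%:E * (\1_(`[g x, H e x[%classic : set R) t)%:E))%E).
    apply: ge0_le_integral => //.
    - by move=> t _; rewrite lee_fin mulr_ge0.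
    - apply/measurable_EFinP; apply: measurable_funM => //.
      apply: (@measurableT_comp _ _ _ _ _ _ (\1_E : 'rV[R]_n * R -> R) _ (fun s : R => (x, s))).
        exact: measurable_indic.
      exact: pair1_measurable.
    - by apply: emeasurable_funM => //; apply/measurable_EFinP; exact: measurable_indic.
    move=> t _; rewrite -EFinM lee_fin !indicE.
    have [/set_mem /= /andP[gt tH]|_] := boolP ((x, t) \in E); last by rewrite mulr0 mulr_ge0.
    rewrite mem_set ?mulr1/=; last by rewrite in_itv/= gt.
    rewrite /w; apply: (@le_trans _ _ (lam t)).
      by rewrite ler_piMl// indicE; case: (_ \in _); rewrite ?lexx ?ler01.
    apply: (le_trans (lamk (g x) t)); rewrite /c lerD2l ler_wpM2l//.
    by rewrite ger0_norm ?subr_ge0// lerD2r ltW.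
  rewrite ge0_integralZl_EFin//; last by apply/measurable_EFinP; exact: measurable_indic.
  rewrite integral_indic//= setIT lebesgue_measure_itv/= lte_fin.
  have -> : ((if (g x < H e x)%R then (H e x)%:E - (g x)%:E else 0) = (H e x - g x)%:E :> \bar R)%E.
    case: ifPn => //; rewrite -leNgt => Hg; congr (_%:E).
    by apply/esym/eqP; rewrite subr_eq0 eq_le Hg gH.
  rewrite -!EFinM -EFinD lee_fin /c.
  have wx0 := dweight_gt0 x; have wx1 := dweight_le1 x.
  have HE : H e x - g x = e * rho x + Ct * e ^+ 2 * dweight x by rewrite /H; ring.
  have Hw : H e x - g x <= e * (Cr + Ct) * dweight x.
    rewrite HE; have := rhoC x; have e2 : e ^+ 2 <= e by rewrite expr2 ger_pMr.
    have := ler_wpM2l (mulr_ge0 Ct0 (ltW wx0)) e2; have := ler_wpM2l e0' (rhoC x); nra.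
  have H0 : 0 <= H e x - g x by rewrite subr_ge0.
  have Hsq : (H e x - g x) ^+ 2 <= e ^+ 2 * (Cr + Ct) ^+ 2 * dweight x.
    apply: (@le_trans _ _ ((e * (Cr + Ct) * dweight x) ^+ 2)).
      by rewrite ler_pXn2r ?nnegrE//; exact: le_trans Hw.
    rewrite !exprMn; apply: ler_wpM2l; first by apply: mulr_ge0 => //; exact: sqr_ge0.
    by rewrite expr2 ger_pMr.
  have := ler_wpM2l k0 Hsq.
  have := ler_wpM2r (mulr_ge0 (mulr_ge0 Ct0 (sqr_ge0 e)) (ltW wx0)) (lamL (g x)).
  rewrite (_ : (_ + _) * _ = lam (g x) * (H e x - g x) + k * (H e x - g x) ^+ 2); last by ring.
  rewrite {2}HE /C2; move: ((H e x - g x) ^+ 2) => D; nra.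
have fI0 : (0 <= \int[mu]_t (f t)%:E)%E by apply: integral_ge0 => t _; rewrite lee_fin.
apply/lee_addgt0Pr => d d0.
(* After division by [e] the error is [e * C2 * W]; this choice keeps it below [d]. *)
pose e := Num.min 1 (d / (C2 * W + 1)).
have CW : 0 < C2 * W + 1 by rewrite ltr_wpDl// mulr_ge0.
have e01 : 0 < e <= 1 by rewrite lt_min ltr01 divr_gt0//= ge_min lexx.
have /andP[e0 e1] := e01.
have := step e e01; rewrite -[X in (_ <= X)%E](_ : e%:E * (\int[rvol]_x (lam (g x) * rho x)%:E + (e * C2 * W)%:E) = _)%E; last first.
  rewrite ge0_muleDr//; last 2 first.
  - by apply: integral_ge0 => x _.
  - by rewrite lee_fin !mulr_ge0// ltW.
  by rewrite -EFinM !mulrA -expr2.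
rewrite lee_pmul2l ?lte_fin// => /le_trans; apply; rewrite leeD2l// lee_fin.
have : e <= d / (C2 * W + 1) by rewrite ge_min lexx orbT.
by rewrite ler_pdivlMr// => h; apply: le_trans h; rewrite -mulrA ler_pM2l// lerDl.
Qed.

End levels.

Lemma near_gt_pt (R : realType) (d v : R) : d < v -> \forall w \near v, d < w.
Proof. by move=> dv; exact: (@cvgr_gt _ _ (nbhs v) _ id v cvg_id d dv). Qed.

Lemma near_lt_pt (R : realType) (d v : R) : v < d -> \forall w \near v, w < d.
Proof. by move=> dv; exact: (@cvgr_lt _ _ (nbhs v) _ id v cvg_id d dv). Qed.

(** * Decreasing rearrangement *)

Section rearrangement.
Context {R : realType} {n : nat}.
Notation mu := (@lebesgue_measure R).
Implicit Types (x y : 'rV[R]_n).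
Variables (g : 'rV[R]_n -> R) (Cg : R).
Hypotheses (mg : measurable_fun setT g) (g0 : forall x, 0 <= g x).
Hypothesis gC : forall x, g x <= Cg * dweight x.

Definition dfun t : R := fine (rvol (superlevel g t)).

Lemma dfun_ge0 t : 0 <= dfun t. Proof. exact: fine_ge0. Qed.

Lemma rvol_dfun t : 0 < t -> rvol (superlevel g t) = (dfun t)%:E.
Proof. by move=> t0; rewrite fineK// (rvol_superlevel_fin mg g0 gC). Qed.

Lemma le_dfun s t : 0 < s -> s <= t -> dfun t <= dfun s.
Proof.
move=> s0 st; rewrite -lee_fin -!rvol_dfun//; last exact: lt_le_trans st.
apply: le_measureW; [exact: measurable_superlevel|exact: measurable_superlevel|].
by move=> x; exact: le_lt_trans.
Qed.

(** [superlevel g t] is the increasing union of the sets at heights [t + 1 / (k+1)], so continuity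
    of the measure from below gives right continuity of [dfun]. *)
Lemma dfun_right t v : 0 < t -> v < dfun t -> exists2 s, t < s & v < dfun s.
Proof.
move=> t0 vt.
pose F k := superlevel g (t + k.+1%:R^-1).
have FE : \bigcup_k F k = superlevel g t.
  apply/seteqP; split => x.
    by move=> [k _]; apply: lt_trans; rewrite ltrDl invr_gt0.
  rewrite /superlevel /= -subr_gt0 => tg.
  have [k _ /(_ k (leqnn k)) /= kt] := near_infty_natSinv_lt (PosNum tg).
  by exists k => //=; rewrite /F /superlevel /= -ltrBrDl.
have mF k : measurable (F k) by exact: measurable_superlevel.
have ndF : nondecreasing_seq F.
  move=> a b ab; apply/subsetPset => x; apply: le_lt_trans; rewrite lerD2l.
  by rewrite lef_pV2 ?posrE// ler_nat.
have cF : rvol (F k) @[k --> \oo] --> rvol (superlevel g t).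
  by rewrite -FE; apply: nondecreasing_cvg_mu => //; rewrite FE; exact: measurable_superlevel.
apply: contrapT => nex.
have : (rvol (superlevel g t) <= v%:E)%E.
  rewrite -(cvg_lim _ cF)//; apply: lime_le; first by apply/cvg_ex; eexists; exact: cF.
  apply: nearW => k; have tk0 : t < t + k.+1%:R^-1 by rewrite ltrDl invr_gt0.
  rewrite rvol_dfun; last exact: lt_trans tk0.
  by rewrite lee_fin leNgt; apply/negP => vk; apply: nex; exists (t + k.+1%:R^-1).
by rewrite rvol_dfun// lee_fin leNgt vt.
Qed.

Lemma dfun_big t : Cg <= t -> 0 < t -> dfun t = 0.
Proof.
move=> Ct t0; rewrite /dfun (_ : superlevel g t = set0) ?measure0//.
apply/seteqP; split => // x; rewrite /superlevel /= => tx.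
have := lt_le_trans tx (gC x); rewrite ltNge => /negP; apply.
apply: le_trans Ct; rewrite ler_piMr ?dweight_le1//; exact: (Cg_ge0 g0 gC).
Qed.

(* The alternative [t = 0] only keeps the set nonempty. *)
Definition rearr v : R := sup [set t | t = 0 \/ 0 < t /\ v < dfun t].

Let has_sup_rearr v : 0 <= v -> has_sup [set t | t = 0 \/ 0 < t /\ v < dfun t].
Proof.
move=> v0; split; first by exists 0; left.
have := Cg_ge0 g0 gC => Cg0.
exists Cg => t [->//|[t0 vt]]; rewrite leNgt; apply/negP => Ct.
by move: vt; rewrite dfun_big// ?ltNge ?v0// ltW.
Qed.

Lemma rearr_ge0 v : 0 <= v -> 0 <= rearr v.
Proof. by move=> v0; apply: ub_le_sup; [exact: (has_sup_rearr v0).2|left]. Qed.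

Lemma rearr_le v : 0 <= v -> rearr v <= Cg.
Proof.
move=> v0; apply: ge_sup; first exact: (has_sup_rearr v0).1.
have := Cg_ge0 g0 gC => Cg0.
move=> t [->//|[t0 vt]]; rewrite leNgt; apply/negP => Ct.
by move: vt; rewrite dfun_big// ?ltNge ?v0// ltW.
Qed.

(** The Galois relation between the distribution function and its generalised inverse. Right
    continuity of [dfun] makes it an equivalence of strict inequalities, from which the properties
    of [rearr] follow. *)
Lemma lt_rearr t v : 0 < t -> 0 <= v -> (t < rearr v) = (v < dfun t).
Proof.
move=> t0 v0; apply/idP/idP => [tr|vt].
  have [s [s0|[s0 vs]] ts] := sup_gt (has_sup_rearr v0).1 tr.
    by move: ts; rewrite s0 ltNge (ltW t0).
  by apply: (lt_le_trans vs); apply: le_dfun => //; exact: ltW.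
have [s ts vs] := dfun_right t0 vt; apply: (lt_le_trans ts).
by apply: ub_le_sup; [exact: (has_sup_rearr v0).2|right; split => //; exact: lt_trans ts].
Qed.

Lemma rearr_noninc v w : 0 <= v -> v <= w -> rearr w <= rearr v.
Proof.
move=> v0 vw; have w0 := le_trans v0 vw; rewrite leNgt; apply/negP => lt.
have r0 := rearr_ge0 v0; pose t := (rearr v + rearr w) / 2.
have t0 : 0 < t by rewrite /t; lra.
have tw : t < rearr w by rewrite /t; lra.
have tv : rearr v < t by rewrite /t; lra.
move: tw; rewrite lt_rearr// => tw.
have := le_lt_trans vw tw; rewrite -lt_rearr// => h.
by move: (lt_trans tv h); rewrite ltxx.
Qed.

Hypothesis cg : continuous g.
Hypothesis n0 : (0 < n)%N.

Lemma rvol_open_gt0 (A : set 'rV[R]_n) x : open A -> A x -> (0 < rvol A)%E.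
Proof.
move=> oA Ax; have /nbhs_ballP [e /= e0 eA] : nbhs x A by exact: open_nbhs_nbhs.
apply: (@lt_le_trans _ _ (rvol [set y : 'rV[R]_n | forall i, x ord0 i - e < y ord0 i < x ord0 i + e])).
  rewrite rvol_box ?lte_fin; last by move=> i; lra.
  by apply: prodr_gt0 => i _; lra.
have bE : [set y : 'rV[R]_n | forall i, x ord0 i - e < y ord0 i < x ord0 i + e] = ball x e.
  apply/seteqP; split => y.
    move=> yx; split => // i j; rewrite (ord1 i) /ball/= /ball_/= distrC ltr_distl; exact: yx.
  by move=> [_ yx] i; have := yx ord0 i; rewrite /ball/= /ball_/= distrC ltr_distl.
rewrite bE; apply: le_measureW => //; first exact: measurable_ball_rV.
exact: open_measurable_rV.
Qed.

(** On the segment from a point where [g <= s] to one where [g > t], the continuous [g] takes the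
    value halfway between. The open set [s < g < t] is thus nonempty and has positive volume. *)
Lemma dfun_strict s t : 0 < s -> s < t -> 0 < dfun t -> dfun t < dfun s.
Proof.
move=> s0 st dt0; have t0 := lt_trans s0 st.
have [y ty] : exists y, t < g y.
  apply: contrapT => nex; move: dt0; rewrite /dfun (_ : superlevel g t = set0) ?measure0 ?ltxx//.
  by apply/seteqP; split => // x tx; apply: nex; exists x.
have [z zs] : exists z, g z <= s.
  (* A point outside the box that contains [superlevel g s]. *)
  pose K := Cg / s + 1; exists (const_mx K); rewrite leNgt; apply/negP => sz.
  have := @in_box_superlevel R n g Cg gC s s0 (const_mx K) sz (Ordinal n0).
  by rewrite mxE -/K => h; have := le_lt_trans (ler_norm K) h; rewrite ltxx.
pose c := (s + t) / 2; have sc : s < c by rewrite /c; lra.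
have ct : c < t by rewrite /c; lra.
pose f (a : R) := g (z + a *: (y - z)).
have cf : {within `[0, 1], continuous f}.
  apply: continuous_subspaceT => a.
  apply: (@continuous_comp _ _ _ (fun a : R => z + a *: (y - z)) g a); last exact: cg.
  apply: (@cvgD _ _ _ (nbhs a) _ (fun=> z) (fun a : R => a *: (y - z))); first exact: cvg_cst.
  by apply: cvgZr_tmp; exact: cvg_id.
have [|a _ fa] := @IVT R f 0 1 c ler01 cf.
  rewrite /f scale0r addr0 scale1r addrC subrK.
  rewrite ge_min le_max (ltW (le_lt_trans zs sc)) (ltW (lt_trans ct ty)) orbT//.
have oU : open [set x | s < g x < t].
  rewrite (_ : [set x | _] = g @^-1` `]s, t[%classic).
    by apply: open_comp; [move=> x _; exact: cg|exact: interval_open].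
  by apply/seteqP; split => x /=; rewrite in_itv.
have mU := open_measurable_rV oU.
have U0 : (0 < rvol [set x | (s < g x < t)%R])%E.
  by apply: (rvol_open_gt0 (x := z + a *: (y - z))) => //=; rewrite -/(f a) fa sc.
have mt := measurable_superlevel mg t; have ms := measurable_superlevel mg s.
rewrite -lte_fin -!rvol_dfun//.
apply: (@lt_le_trans _ _ (rvol (superlevel g t) + rvol [set x | (s < g x < t)%R])%E).
  by rewrite lteDl// rvol_dfun.
have <- : rvol (superlevel g t `|` [set x | s < g x < t]) =
   (rvol (superlevel g t) + rvol [set x | (s < g x < t)%R])%E.
  apply: measureU => //; apply/seteqP; split => // x [/= tx /andP[_ xt]].
  by move: (lt_trans tx xt); rewrite ltxx.
apply: le_measureW => //; first exact: measurableU.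
by move=> x [tx|/andP[]//]; exact: lt_trans tx.
Qed.

Lemma rearr_dfun t : 0 < t -> 0 < dfun t -> rearr (dfun t) = t.
Proof.
move=> t0 dt0; apply/eqP; rewrite eq_le; apply/andP; split.
  by rewrite leNgt lt_rearr// ?ltxx// ltW.
rewrite leNgt; apply/negP => rt; have r0 := rearr_ge0 (ltW dt0).
pose c := (rearr (dfun t) + t) / 2.
have c0 : 0 < c by rewrite /c; lra.
have ct : c < t by rewrite /c; lra.
have cr : rearr (dfun t) < c by rewrite /c; lra.
have := dfun_strict c0 ct dt0; rewrite -lt_rearr// ?(ltW dt0)// => h.
by move: (lt_trans cr h); rewrite ltxx.
Qed.

(** A jump of [rearr] at [v] would make [dfun] constant, equal to [v], on an interval of levels,
    which [dfun_strict] excludes. *)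
Lemma rearr_continuous v : 0 < v -> {for v, continuous rearr}.
Proof.
move=> v0; apply/(@cvgrPdist_lt _ _ _ (nbhs v) (nbhs_filter v)) => e e0.
have r0 := rearr_ge0 (ltW v0).
have up : \forall w \near v, rearr w < rearr v + e.
  pose t := rearr v + e / 2; have t0 : 0 < t by rewrite /t; lra.
  have [d dv vd] : exists2 d, 0 <= d < v & forall w, d < w -> rearr w < rearr v + e.
    pose s := rearr v + e / 4; have s0 : 0 < s by rewrite /s; lra.
    have st : s < t by rewrite /s /t; lra.
    have dsv : dfun s <= v by rewrite leNgt -lt_rearr// ?(ltW v0)// /s; lra.
    have dt : dfun t < v.
      have [dt0|] := ltP 0 (dfun t); last by move=> h; apply: le_lt_trans v0.
      by apply: lt_le_trans dsv; exact: dfun_strict.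
    exists (dfun t); first by rewrite dfun_ge0.
    move=> w tw; apply: (@le_lt_trans _ _ t); last by rewrite /t; lra.
    rewrite leNgt lt_rearr//; first by rewrite -leNgt ltW.
    by apply: ltW; apply: le_lt_trans tw; exact: dfun_ge0.
  have /andP[_ dv'] := dv.
  by near=> w; apply: vd; near: w; exact: near_gt_pt.
have dn : \forall w \near v, rearr v - e < rearr w.
  have [er|er] := ltP 0 (rearr v - e / 2); last first.
    near=> w; apply: (@lt_le_trans _ _ 0); first lra.
    by apply/rearr_ge0/ltW; near: w; exact: near_gt_pt.
  have tr : rearr v - e / 2 < rearr v by lra.
  move: tr; rewrite lt_rearr// ?(ltW v0)// => vt.
  near=> w; apply: (@lt_trans _ _ (rearr v - e / 2)); first lra.
  rewrite lt_rearr//; first by near: w; exact: near_lt_pt.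
  by apply: ltW; near: w; exact: near_gt_pt.
near=> w; rewrite distrC ltr_distl; apply/andP; split; near: w; [exact: dn|exact: up].
Unshelve. all: by end_near. Qed.

End rearrangement.

(** * Measures determined by their values on rays *)

Section eq_measure_rays.
Context {R : realType}.

(** Both measures may be infinite near 0. Uniqueness on the pi-system of rays is therefore applied
    to the restrictions to []d, +oo[], where they are finite, and [d] then decreases to 0. *)
Lemma eq_measure_rays (m1 m2 : {measure set (measurableTypeR R) -> \bar R}) (A : set R) :
  (forall t : R, 0 < t -> m1 `]t, +oo[%classic = m2 `]t, +oo[%classic) ->
  (forall t : R, 0 < t -> (m1 `]t, +oo[%classic < +oo)%E) ->
  measurable A -> A `<=` `]0, +oo[%classic -> m1 A = m2 A.
Proof.
move=> m12 m1oo mA A0.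
have step (d : R) : 0 < d -> m1 (A `&` `]d, +oo[%classic) = m2 (A `&` `]d, +oo[%classic).
  move=> d0; have mD : measurable (`]d, +oo[%classic : set (measurableTypeR R)) by [].
  have itvI (x : R) : `]x, +oo[%classic `&` `]d, +oo[%classic = `](Num.max x d), +oo[%classic.
    by apply/seteqP; split => y /=; rewrite !in_itv/= !andbT gt_max => /andP.
  have := @measure_unique _ R (measurableTypeR R) (@RGenOInfty.G R) (fun k => `](- k%:R), +oo[%classic)
    (RGenOInfty.measurableE R) _ _ _ (mrestr m1 mD) (mrestr m2 mD) _ _ A mA.
  apply.
  - move=> _ _ [x ->] [y ->]; exists (Num.max x y).
    by apply/seteqP; split => z /=; rewrite !in_itv/= !andbT gt_max => /andP.
  - by move=> k; exists (- k%:R).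
  - apply/seteqP; split => // x _; exists (Num.truncn `|x|).+1 => //=.
    rewrite in_itv/= andbT ltrNl (le_lt_trans (ler_norm _))// normrN.
    by rewrite Num.Theory.truncnS_gt.
  - move=> _ [x ->]; have xd : 0 < Num.max x d by rewrite lt_max d0 orbT.
    by have := m12 _ xd; rewrite -itvI.
  - move=> k; have xd : 0 < Num.max (- k%:R) d by rewrite lt_max d0 orbT.
    by have := m1oo _ xd; rewrite -itvI.
pose F k := A `&` `]k.+1%:R^-1, +oo[%classic.
have FE : \bigcup_k F k = A.
  apply/seteqP; split => x; first by move=> [k _ []].
  move=> Ax; have := A0 _ Ax; rewrite /= in_itv/= andbT => x0.
  have [k _ /(_ k (leqnn k)) /= kx] := near_infty_natSinv_lt (PosNum x0).
  by exists k => //; split => //=; rewrite in_itv/= andbT.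
have mF k : measurable (F k) by exact: measurableI.
have ndF : nondecreasing_seq F.
  move=> a b ab; apply/subsetPset => x [Ax]; rewrite /= !in_itv/= !andbT => ax; split => //=.
  rewrite in_itv/= andbT; apply: le_lt_trans ax.
  by rewrite lef_pV2 ?posrE// ler_nat.
have c1 : m1 (F k) @[k --> \oo] --> m1 A.
  by rewrite -[in X in _ --> X]FE; apply: nondecreasing_cvg_mu => //; rewrite FE.
have c2 : m2 (F k) @[k --> \oo] --> m2 A.
  by rewrite -[in X in _ --> X]FE; apply: nondecreasing_cvg_mu => //; rewrite FE.
have E : (fun k => m1 (F k)) = (fun k => m2 (F k)).
  by apply/funext => k; apply: step; rewrite invr_gt0.
by rewrite -(cvg_lim _ c1)// E; exact: cvg_lim.
Qed.

End eq_measure_rays.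

(** * Layer cake for a product of two functions *)

Section layer_cake2.
Context d (T : measurableType d) (R : realType).
Variable m : {sigma_finite_measure set T -> \bar R}.
Notation mu := (@lebesgue_measure R).
Notation pos := (\1_(`]0%R, +oo[%classic : set R) : R -> R).
Variables f h : T -> R.
Hypotheses (mf : measurable_fun setT f) (mh : measurable_fun setT h).
Hypotheses (f0 : forall x, 0 <= f x) (h0 : forall x, 0 <= h x).

Lemma measurable_subgraph (k : T -> R) : measurable_fun setT k ->
  measurable [set z : T * R | z.2 < k z.1].
Proof.
move=> mk; rewrite -[X in measurable X]setTI.
apply: (@measurable_lte _ _ _ _ _ (fun z : T * R => z.2%:E) (fun z => (k z.1)%:E)) => //.
- by apply/measurable_EFinP; exact: measurable_snd.
- by apply/measurable_EFinP; exact: (measurableT_comp mk).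
Qed.

Lemma integral_under_graph (a : R) : 0 <= a ->
  (\int[mu]_t (pos t * \1_[set t | (t < a)%R] t)%:E = a%:E)%E.
Proof.
move=> a0; transitivity (\int[mu]_t (\1_(`]0%R, a[%classic : set R) t)%:E)%E.
  apply: eq_integral => t _; congr (_%:E); rewrite !indicE -natrM mulnb; congr (_%:R).
  apply: congr1; apply/andP/idP => [[/set_mem/= + /set_mem/= ta]|/set_mem/=].
    by rewrite in_itv/= andbT => t0; apply/mem_set; rewrite /= in_itv/= t0.
  by rewrite in_itv/= => /andP[t0 ta]; split; apply/mem_set => //=; rewrite in_itv/= t0.
rewrite integral_indic//= setIT lebesgue_measure_itv/= lte_fin.
case: ifPn => [_|]; first by rewrite ?sube0 -?EFinB ?subr0.
by rewrite -leNgt => a0'; congr (_%:E); apply/le_anti; rewrite a0 a0'.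
Qed.

Let inner (y : R) : (\int[mu]_t ((pos t)%:E * m [set x | (y < f x)%R /\ (t < h x)%R]) =
  \int[m]_x (\1_[set x | (y < f x)%R] x * h x)%:E)%E.
Proof.
pose E : set (T * R) := [set z | y < f z.1 /\ z.2 < h z.1].
have mE : measurable E.
  apply: (measurableI [set z : T * R | y < f z.1]); last exact: measurable_subgraph.
  rewrite -[X in measurable X]setTI.
  apply: (@measurable_lte _ _ _ _ _ (fun z : T * R => y%:E) (fun z => (f z.1)%:E)) => //.
  by apply/measurable_EFinP; exact: (measurableT_comp mf).
rewrite (tonelli_layer m mE)//.
apply: eq_integral => x _.
transitivity (\int[mu]_t ((\1_[set x | (y < f x)%R] x)%:E * (pos t * \1_[set t | (t < h x)%R] t)%:E))%E.
  apply: eq_integral => t _; rewrite -EFinM; congr (_%:E); rewrite mulrCA; congr (_ * _).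
  rewrite !indicE -natrM mulnb; congr (_%:R); apply: congr1.
  by apply/idP/andP => [/set_mem/= [? ?]|[/set_mem/= ? /set_mem/= ?]]; [split|]; apply/mem_set.
rewrite ge0_integralZl_EFin//; first by rewrite integral_under_graph// EFinM.
- apply/measurable_EFinP; apply: measurable_funM; first exact: measurable_indic.
  apply: measurable_indic; rewrite (_ : [set t | t < h x] = `]-oo, (h x)[%classic)//.
Qed.

(** Each factor is the integral of the indicators of its superlevel sets. Inequalities between
    integrals of products thereby reduce to inequalities between measures of intersections of two
    level sets. *)
Lemma layer_cake2 : (\int[m]_x (f x * h x)%:E = \int[mu]_y ((pos y)%:E *
  \int[mu]_t ((pos t)%:E * m [set x | (y < f x)%R /\ (t < h x)%R])))%E.
Proof.
under [RHS]eq_integral do rewrite inner.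
pose F (z : T * R) : \bar R := (pos z.2 * (\1_[set z : T * R | z.2 < f z.1] z * h z.1))%:E.
have mF : measurable_fun setT F.
  apply/measurable_EFinP; apply: measurable_funM.
    by apply: (@measurableT_comp _ _ _ _ _ _ pos); [exact: measurable_indic|exact: measurable_snd].
  apply: measurable_funM; last exact: (measurableT_comp mh).
  by apply: measurable_indic; exact: measurable_subgraph.
have F0 z : (0 <= F z)%E by rewrite lee_fin !mulr_ge0.
transitivity (\int[m]_x \int[mu]_y F (x, y))%E.
  apply: eq_integral => x _; rewrite /F /=.
  transitivity (\int[mu]_t ((h x)%:E * (pos t * \1_[set t | (t < f x)%R] t)%:E))%E.
    rewrite ge0_integralZl_EFin//; first by rewrite integral_under_graph// -EFinM mulrC.
    - apply/measurable_EFinP; apply: measurable_funM; first exact: measurable_indic.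
      apply: measurable_indic; rewrite (_ : [set t | t < f x] = `]-oo, (f x)[%classic)//.
  apply: eq_integral => t _; rewrite -EFinM; congr (_%:E); rewrite mulrC -mulrA; congr (_ * (_ * _)).
rewrite (@fubini_tonelli _ _ _ _ _ m mu F)//; apply: eq_integral => y _.
rewrite -ge0_integralZl_EFin//; last 2 first.
- by move=> x _; rewrite lee_fin mulr_ge0.
- apply/measurable_EFinP; apply: measurable_funM => //; apply: measurable_indic.
  rewrite (_ : [set x | y < f x] = f @^-1` `]y, +oo[%classic).
    by rewrite -[X in measurable X]setTI; exact: mf.
  by apply/seteqP; split => t /=; rewrite in_itv/= andbT.
Qed.

Lemma measurable_inner2 :
  measurable_fun setT (fun y : R => \int[mu]_t ((pos t)%:E * m [set x | (y < f x)%R /\ (t < h x)%R]))%E.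
Proof.
rewrite (_ : (fun _ => _) = fun y : R => (\int[m]_x (\1_[set x | (y < f x)%R] x * h x)%:E)%E); last first.
  by apply/funext => y; rewrite inner.
pose F (z : T * R) : \bar R := (\1_[set z : T * R | z.2 < f z.1] z * h z.1)%:E.
have mF : measurable_fun setT F.
  apply/measurable_EFinP; apply: measurable_funM; last exact: (measurableT_comp mh).
  by apply: measurable_indic; exact: measurable_subgraph.
have F0 z : (0 <= F z)%E by rewrite lee_fin mulr_ge0.
have := measurable_fun_fubini_tonelli_G (m1 := m) F mF F0.
apply: eq_measurable_fun => y _; apply: eq_integral => x _; congr (_%:E); congr (_ * _).
Qed.

Lemma measurable_level2 (y : R) :
  measurable_fun setT (fun t : R => m [set x | (y < f x)%R /\ (t < h x)%R]).
Proof.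
pose E : set (T * R) := [set z | y < f z.1 /\ z.2 < h z.1].
have mE : measurable E.
  apply: (measurableI [set z : T * R | y < f z.1]); last exact: measurable_subgraph.
  rewrite -[X in measurable X]setTI.
  apply: (@measurable_lte _ _ _ _ _ (fun z : T * R => y%:E) (fun z => (f z.1)%:E)) => //.
  by apply/measurable_EFinP; exact: (measurableT_comp mf).
exact: (measurable_layer m mE).
Qed.

End layer_cake2.

Lemma integral_mul_le_levels d1 d2 (T1 : measurableType d1) (T2 : measurableType d2) (R : realType)
  (m1 : {sigma_finite_measure set T1 -> \bar R}) (m2 : {sigma_finite_measure set T2 -> \bar R})
  (f1 h1 : T1 -> R) (f2 h2 : T2 -> R) :
  measurable_fun setT f1 -> measurable_fun setT h1 ->
  measurable_fun setT f2 -> measurable_fun setT h2 ->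
  (forall x, 0 <= f1 x) -> (forall x, 0 <= h1 x) ->
  (forall x, 0 <= f2 x) -> (forall x, 0 <= h2 x) ->
  (forall y t : R, 0 < y -> 0 < t ->
    (m1 [set x | (y < f1 x)%R /\ (t < h1 x)%R] <= m2 [set x | (y < f2 x)%R /\ (t < h2 x)%R])%E) ->
  (\int[m1]_x (f1 x * h1 x)%:E <= \int[m2]_x (f2 x * h2 x)%:E)%E.
Proof.
move=> mf1 mh1 mf2 mh2 f10 h10 f20 h20 le12.
rewrite !layer_cake2//.
have ge0 d (T : measurableType d) (m : {sigma_finite_measure set T -> \bar R}) (f h : T -> R) (y t : R) :
  (0 <= (\1_(`]0%R, +oo[%classic : set R) t)%:E * m [set x | (y < f x)%R /\ (t < h x)%R])%E.
  by rewrite mule_ge0// lee_fin.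
apply: ge0_le_integral => //.
- by move=> y _; rewrite mule_ge0 ?lee_fin// integral_ge0.
- apply: emeasurable_funM; first by apply/measurable_EFinP; exact: measurable_indic.
  exact: measurable_inner2.
- apply: emeasurable_funM; first by apply/measurable_EFinP; exact: measurable_indic.
  exact: measurable_inner2.
move=> y _; rewrite indicE; have [/set_mem/=|_] := boolP (y \in _); last by rewrite !mul0e.
rewrite in_itv/= andbT => y0; rewrite !mul1e; apply: ge0_le_integral => //.
- apply: emeasurable_funM; first by apply/measurable_EFinP; exact: measurable_indic.
  exact: measurable_level2.
- apply: emeasurable_funM; first by apply/measurable_EFinP; exact: measurable_indic.
  exact: measurable_level2.
move=> t _; rewrite indicE; have [/set_mem/=|_] := boolP (t \in _); last by rewrite !mul0e.
by rewrite in_itv/= andbT => t0; rewrite !mul1e; exact: le12.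
Qed.

(** * Equimeasurability and the Hardy-Littlewood inequality *)

Section equimeasurable.
Context {R : realType} {n : nat}.
Notation mu := (@lebesgue_measure R).
Implicit Types (x y : 'rV[R]_n).
Variables (g : 'rV[R]_n -> R) (Cg : R).
Hypotheses (mg : measurable_fun setT g) (g0 : forall x, 0 <= g x).
Hypothesis gC : forall x, g x <= Cg * dweight x.
Hypothesis cg : continuous g.
Hypothesis n0 : (0 < n)%N.

(** The extension by 0 yields a function on the whole line, whose positive arguments are volumes. *)
Definition gstar : R -> R := rearr g \_ `]0, +oo[%classic.

Lemma gstarE v : 0 < v -> gstar v = rearr g v.
Proof. by move=> v0; rewrite /gstar patchE mem_set//= in_itv/= v0. Qed.

Lemma gstar_le0 v : v <= 0 -> gstar v = 0.
Proof. by move=> v0; rewrite /gstar patchE memNset//= in_itv/= andbT; apply/negP; rewrite -leNgt. Qed.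

Lemma gstar_ge0 v : 0 <= gstar v.
Proof.
have [v0|v0] := ltP 0 v; last by rewrite gstar_le0.
by rewrite gstarE//; apply: (rearr_ge0 g0 gC); exact: ltW.
Qed.

Lemma gstar_le v : gstar v <= Cg.
Proof.
have Cg0 := Cg_ge0 g0 gC; have [v0|v0] := ltP 0 v; last by rewrite gstar_le0.
by rewrite gstarE//; apply: (rearr_le g0 gC); exact: ltW.
Qed.

Lemma lt_gstar t v : 0 < t -> (t < gstar v) = (0 < v) && (v < dfun g t).
Proof.
move=> t0; have [v0|v0] := ltP 0 v; last by rewrite gstar_le0//= ltNge ltW.
by rewrite gstarE//= (lt_rearr mg g0 gC)// ltW.
Qed.

Lemma gstar_noninc v w : 0 < v -> v <= w -> gstar w <= gstar v.
Proof.
move=> v0 vw; rewrite !gstarE//; last exact: lt_le_trans vw.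
by apply: (rearr_noninc mg g0 gC) => //; exact: ltW.
Qed.

Lemma gstar_continuous v : 0 < v -> {for v, continuous gstar}.
Proof.
move=> v0; have := rearr_continuous mg g0 gC cg n0 v0.
move=> h; change (gstar @ v --> gstar v); rewrite (gstarE v0); apply: cvg_trans h.
apply: near_eq_cvg.
by have := near_gt_pt v0; apply: filterS => w w0; rewrite gstarE.
Qed.

Lemma measurable_gstar : measurable_fun setT gstar.
Proof.
apply/(measurable_restrictT _ _).1 => //.
apply: open_continuous_measurable_fun; first exact: interval_open.
by move=> v; rewrite inE/= in_itv/= andbT => v0; exact: (rearr_continuous mg g0 gC cg n0).
Qed.

(** The images of volume under [g] and of length under [gstar] agree on each ray []t, +oo[] with
    [0 < t], both being [dfun g t]. The sets where [g] and [gstar] vanish may differ in measure,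
    hence the condition that [F] is 0 at nonpositive levels. *)
Lemma equimeasurable (F : R -> \bar R) : measurable_fun setT F -> (forall t, 0 <= F t)%E ->
  (forall t, t <= 0 -> F t = 0%E) -> (\int[rvol]_x F (g x) = \int[mu]_v F (gstar v))%E.
Proof.
move=> mF F0 F00.
have mgs : measurable_fun [set: measurableTypeR R] (gstar : measurableTypeR R -> measurableTypeR R).
  exact: measurable_gstar.
have mg' : measurable_fun setT (g : 'rV[R]_n -> measurableTypeR R) by exact: mg.
have key d (T : measurableType d) (m : {measure set T -> \bar R}) (f : T -> measurableTypeR R)
    (mf : measurable_fun setT f) :
    (\int[m]_x F (f x) = \int[pushm m mf]_(y in `]0%R, +oo[) F y)%E.
  rewrite [RHS](@ge0_integral_pushforward _ _ _ _ _ f mf m); last 3 first.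
  - by [].
  - exact: measurable_funTS.
  - by move=> y _; exact: F0.
  rewrite [RHS]integral_mkcond; apply: eq_integral => x _ /=.
  rewrite patchE; case: ifPn => //; rewrite notin_setE/= in_itv/= andbT => /negP.
  by rewrite -leNgt; exact: F00.
rewrite (key _ _ _ _ mg') (key _ _ _ _ mgs).
apply: eq_measure_integral => A mA A0.
apply: eq_measure_rays => // t t0.
  change (rvol (g @^-1` `]t, +oo[%classic) = mu (gstar @^-1` `]t, +oo[%classic)).
  rewrite (_ : g @^-1` _ = superlevel g t); last first.
    by apply/seteqP; split => x /=; rewrite in_itv/= andbT.
  rewrite (_ : gstar @^-1` _ = `]0, (dfun g t)[%classic); last first.
    by apply/seteqP; split => v /=; rewrite !in_itv/= andbT lt_gstar.
  rewrite (rvol_dfun mg g0 gC)// lebesgue_measure_itv/= lte_fin.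
  case: ifPn => [_|]; first by rewrite ?sube0 -?EFinB ?subr0.
  by rewrite -leNgt => h; congr (_%:E); apply/le_anti; rewrite h dfun_ge0.
change (rvol (g @^-1` `]t, +oo[%classic) < +oo)%E.
rewrite (_ : g @^-1` _ = superlevel g t); last first.
  by apply/seteqP; split => x /=; rewrite in_itv/= andbT.
by rewrite (rvol_dfun mg g0 gC)// ltry.
Qed.

Lemma integral_gstar_fin : (\int[mu]_v (gstar v)%:E < +oo)%E.
Proof.
pose F (t : R) : \bar R := (Num.max t 0)%:E.
have mF : measurable_fun setT F by apply/measurable_EFinP; exact: measurable_maxr.
have F0 t : (0 <= F t)%E by rewrite lee_fin le_max lexx orbT.
have F00 t : t <= 0 -> F t = 0%E by move=> t0; rewrite /F max_r.
have := equimeasurable mF F0 F00.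
rewrite (_ : (fun v => F (gstar v)) = fun v => (gstar v)%:E); last first.
  by apply/funext => v; rewrite /F max_l// gstar_ge0.
move=> <-.
have [W W0 intW] := @integral_dweight R n.
rewrite integral_RnE in intW; last 2 first.
- by apply/measurable_EFinP; exact: measurable_dweight.
- by move=> x; rewrite lee_fin; exact/ltW/dweight_gt0.
apply: (@le_lt_trans _ _ (\int[rvol]_x (Cg%:E * (dweight x)%:E))%E).
  apply: ge0_le_integral => //.
  - exact: (measurableT_comp mF).
  - by apply: emeasurable_funM => //; apply/measurable_EFinP; exact: measurable_dweight.
  - by move=> x _; rewrite /F max_l// -EFinM lee_fin.
rewrite ge0_integralZl_EFin//.
- by rewrite intW -EFinM ltry.
- by move=> x _; rewrite lee_fin; exact/ltW/dweight_gt0.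
- by apply/measurable_EFinP; exact: measurable_dweight.
- exact: (Cg_ge0 g0 gC).
Qed.

Lemma rvol_ball_volume v : 0 < v -> rvol [set x : 'rV[R]_n | @omega R n * enorm x ^+ n < v] = v%:E.
Proof.
move=> v0; have o0 := @omega_gt0 R n; pose r := (v / @omega R n) `^ n%:R^-1.
have r0 : 0 < r by rewrite powR_gt0 ?divr_gt0.
have rn : r ^+ n = v / @omega R n.
  rewrite -powR_mulrn ?ltW// -powRrM mulVf ?pnatr_eq0 -?lt0n// powRr1//.
  by rewrite divr_ge0 ?ltW.
rewrite (_ : [set x | _] = eball r); last first.
  apply/seteqP; split => x /=; rewrite /eball/= mulrC -ltr_pdivlMr// -rn;
  by rewrite ltr_pXn2r// ?nnegrE ?enorm_ge0// ltW.
by rewrite rvol_eball// rn mulrC divfK ?gt_eqF.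
Qed.

(** Let [c] be the volume of the set where [f > y] and [g^p > t]. For [v < c] this set does not fit
    into the ball of volume [v], so it has a point outside, where [f <= kap v], and [y < kap v]
    follows. Moreover [v] is below the volume of the level set of [g]. Hence []0, c[] lies in the
    corresponding set on the line. *)
Lemma hardy_littlewood (f : 'rV[R]_n -> R) (kap : R -> R) (p : R) : 0 < p ->
  measurable_fun setT f -> (forall x, 0 <= f x) ->
  measurable_fun setT kap -> (forall v, 0 <= kap v) ->
  (forall x v, 0 < v -> v <= @omega R n * enorm x ^+ n -> f x <= kap v) ->
  (\int[rvol]_x (f x * g x `^ p)%:E <= \int[mu]_v (kap v * gstar v `^ p)%:E)%E.
Proof.
move=> p0 mf f0 mk k0 fk; have o0 := @omega_gt0 R n.
apply: integral_mul_le_levels => //.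
- exact: (measurableT_comp (measurable_powR p)).
- by apply: (measurableT_comp (measurable_powR p)); exact: measurable_gstar.
- by move=> x; exact: powR_ge0.
- by move=> x; exact: powR_ge0.
move=> y t y0 t0.
pose s := t `^ p^-1; have s0 : 0 < s by rewrite powR_gt0.
have tE a : 0 <= a -> (t < a `^ p) = (s < a).
  move=> a0; have -> : t = s `^ p by rewrite -powRrM mulVf ?gt_eqF// powRr1// ltW.
  apply/idP/idP => [|sa]; last by apply: gt0_ltr_powR; rewrite ?nnegrE ?(ltW s0).
  by rewrite !ltNge; apply: contra => sa; apply: ge0_ler_powR; rewrite ?nnegrE ?(ltW p0) ?(ltW s0).
pose X := [set x | y < f x /\ t < g x `^ p].
pose V := [set v | y < kap v /\ t < gstar v `^ p].
change (rvol X <= mu V)%E.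
have mX : measurable X.
  rewrite (_ : X = f @^-1` `]y, +oo[%classic `&` superlevel g s); last first.
    by apply/seteqP; split => x; rewrite /X /superlevel /= in_itv/= andbT tE.
  apply: measurableI; last exact: measurable_superlevel.
  by rewrite -[X in measurable X]setTI; exact: mf.
have Xb : (rvol X <= (dfun g s)%:E)%E.
  rewrite -(rvol_dfun mg g0 gC)//; apply: le_measureW => //; first exact: measurable_superlevel.
  by move=> x [_]; rewrite /= tE.
have Xfin : rvol X \is a fin_num by rewrite ge0_fin_numE// (le_lt_trans Xb)// ltry.
rewrite -(fineK Xfin); set c := fine _.
have c0 : 0 <= c by exact: fine_ge0.
have cE : rvol X = c%:E by rewrite fineK.
have -> : c%:E = mu `]0, c[%classic.
  rewrite lebesgue_measure_itv/= lte_fin; case: ifPn => [_|]; first by rewrite ?sube0 -?EFinB ?subr0.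
  by rewrite -leNgt => h; congr (_%:E); apply/le_anti; rewrite h c0.
have mV : measurable V.
  rewrite (_ : V = kap @^-1` `]y, +oo[%classic `&` gstar @^-1` `]s, +oo[%classic); last first.
    by apply/seteqP; split => v; rewrite /V /= !in_itv/= !andbT tE ?gstar_ge0.
  apply: measurableI; rewrite -[X in measurable X]setTI; first exact: mk.
  exact: measurable_gstar.
apply: le_measureW => // v /=; rewrite in_itv/= => /andP[v0 vc]; split.
  rewrite ltNge; apply/negP => kv.
  have : (rvol X <= v%:E)%E.
    rewrite -(rvol_ball_volume v0); apply: le_measureW => //.
      rewrite (_ : [set x | _] = (fun x : 'rV[R]_n => @omega R n * enorm x ^+ n) @^-1` `]-oo, v[%classic).
        rewrite -[X in measurable X]setTI; apply: measurable_funM => //.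
        by apply: measurable_funX; exact: measurable_enorm.
      by apply/seteqP; split => z /=; rewrite in_itv.
    move=> x [/= yf _]; rewrite ltNge; apply/negP => vx.
    by have := lt_le_trans yf (fk x v v0 vx); rewrite ltNge kv.
  by rewrite cE lee_fin leNgt vc.
rewrite tE ?gstar_ge0// lt_gstar// v0/=; apply: (lt_le_trans vc).
by rewrite -lee_fin -cE.
Qed.

End equimeasurable.

(** * Lower bound for the Dirichlet energy *)

Section infconv.
Context {R : realType}.
Variables (D : set R) (K G : R -> R).
Hypotheses (D0 : D !=set0) (K0 : forall v, D v -> 0 <= K v).

(* Lipschitz minorants of the possibly discontinuous profile [G v |-> K v]. *)
Definition infconv (k : nat) (t : R) : R :=
  Num.min k%:R (inf [set K v + k%:R * `|t - G v| | v in D]).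

Let S k t := [set K v + k%:R * `|t - G v| | v in D].

Let has_infS k t : has_inf (S k t).
Proof.
split; first by have [v Dv] := D0; exists (K v + k%:R * `|t - G v|), v.
by exists 0 => _ [v Dv <-]; rewrite addr_ge0 ?K0// mulr_ge0.
Qed.

Lemma le_infconv k t a : a <= k%:R ->
  (forall v, D v -> a <= K v + k%:R * `|t - G v|) -> a <= infconv k t.
Proof.
move=> ak aS; rewrite le_min ak/=; apply: lb_le_inf; first exact: (has_infS k t).1.
by move=> _ [v Dv <-]; exact: aS.
Qed.

Lemma infconv_le_at k t v : D v -> infconv k t <= K v + k%:R * `|t - G v|.
Proof.
move=> Dv; rewrite ge_min; apply/orP; right.
by apply: ge_inf; [exact: (has_infS k t).2|exists v].
Qed.

Lemma infconv_ge0 k t : 0 <= infconv k t.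
Proof. by apply: le_infconv => // v Dv; rewrite addr_ge0 ?K0// mulr_ge0. Qed.

Lemma infconv_le k t : infconv k t <= k%:R.
Proof. by rewrite ge_min lexx. Qed.

Lemma infconv_lip k s t : infconv k t <= infconv k s + k%:R * `|t - s|.
Proof.
rewrite -lerBlDr; apply: le_infconv => [|v Dv].
  by rewrite lerBlDr (le_trans (infconv_le _ _))// lerDl mulr_ge0.
rewrite lerBlDr; apply: (le_trans (infconv_le_at k t Dv)).
rewrite -addrA lerD2l -mulrDr ler_wpM2l//.
rewrite [leRHS]addrC (_ : t - G v = (t - s) + (s - G v)); last by ring.
exact: ler_normD.
Qed.

Lemma infconv_mono t j k : (j <= k)%N -> infconv j t <= infconv k t.
Proof.
move=> jk; apply: le_infconv => [|v Dv].
  by rewrite (le_trans (infconv_le _ _))// ler_nat.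
by rewrite (le_trans (infconv_le_at j t Dv))// lerD2l ler_wpM2r// ler_nat.
Qed.

Lemma measurable_infconv k : measurable_fun setT (infconv k).
Proof.
apply: continuous_measurable_fun => t; apply/(@cvgrPdist_le _ _ _ (nbhs t) (nbhs_filter t)) => e e0.
have k1 : 0 < k%:R + 1 :> R by rewrite ltr_wpDl.
apply/nbhs_ballP; exists (e / (k%:R + 1)); first by rewrite /= divr_gt0.
move=> s; rewrite /ball/= /ball_/= ltr_pdivlMr// => ts.
have kts : k%:R * `|t - s| <= e.
  by apply: le_trans (ltW ts); rewrite mulrC ler_wpM2l// lerDl.
rewrite ler_norml; apply/andP; split.
  by have := infconv_lip k t s; rewrite distrC; lra.
by have := infconv_lip k s t; lra.
Qed.

(** Near [v0], continuity of [K] keeps the competitors above [K v0 - e]; away from it the penalty is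
    at least [k * h], which exceeds [K v0] for large [k]. *)
Lemma infconv_limit t v0 e : 0 < e -> {for v0, continuous K} -> D v0 ->
  (forall d, 0 < d -> exists2 h, 0 < h & forall v, D v -> d <= `|v - v0| -> h <= `|t - G v|) ->
  exists N : nat, forall k, (N <= k)%N -> K v0 - e <= infconv k t.
Proof.
move=> e0 cK Dv0 sep.
have /(@cvgrPdist_lt _ _ _ (nbhs v0) (nbhs_filter v0)) /(_ e e0) /nbhs_ballP[d /= d0 dK] := cK.
have [h h0 hG] := sep d d0.
exists (Num.truncn (K v0 + K v0 / h)).+1 => k Nk.
have Kv0 := K0 Dv0.
have kk : K v0 + K v0 / h <= k%:R.
  by apply: (le_trans (ltW (Num.Theory.truncnS_gt _))); rewrite ler_nat.
have Kh : 0 <= K v0 / h by rewrite divr_ge0// ltW.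
apply: le_infconv; first by lra.
move=> v Dv; have [dv|vd] := leP d `|v - v0|.
  have := hG v Dv dv => ht; apply: (@le_trans _ _ (k%:R * h)).
    have : K v0 / h <= k%:R by lra.
    by rewrite ler_pdivrMr// => ?; lra.
  by rewrite (@le_trans _ _ (k%:R * `|t - G v|)) ?ler_wpM2l// lerDr K0.
have := dK v; rewrite /ball/= /ball_/= distrC => /(_ vd); rewrite ltr_distl => /andP[_ hh].
have : 0 <= k%:R * `|t - G v| by rewrite mulr_ge0.
by lra.
Qed.

End infconv.

Section power_weights.
Context {R : realType} {n : nat}.
Notation om := (@omega R n).

(* If [v] is the volume of a ball of radius [r], then [rpow c v] is [r `^ (n * c)]. *)
Definition rpow (c v : R) : R := (v / om) `^ c.

Lemma rpow_ge0 c v : 0 <= rpow c v. Proof. exact: powR_ge0. Qed.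

Lemma rpow_gt0 c v : 0 < v -> 0 < rpow c v.
Proof. by move=> v0; rewrite powR_gt0// divr_gt0// omega_gt0. Qed.

Lemma measurable_rpow c : measurable_fun setT (rpow c).
Proof.
apply: (measurableT_comp (measurable_powR c)).
by apply: measurable_funM.
Qed.

Lemma rpowD a b v : 0 < v -> rpow (a + b) v = rpow a v * rpow b v.
Proof.
move=> v0; rewrite /rpow powRD//; apply/implyP => _.
by rewrite gt_eqF// divr_gt0// omega_gt0.
Qed.

Lemma is_derive_rpow c (v : R) : 0 < v ->
  is_derive v (1 : R) (rpow c) (c / om * rpow (c - 1) v).
Proof.
move=> v0; have o0 := @omega_gt0 R n; have vo : 0 < v / om by rewrite divr_gt0.
have h1 : is_derive v (1 : R) (fun w : R => w / om) om^-1.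
  have -> : (fun w : R => w / om) = om^-1 \*: (id : R -> R).
    by apply/funext => w /=; rewrite mulrC.
  by have := is_deriveZ om^-1 (is_derive_id v (1 : R)); rewrite [_ *: 1]mulr1.
have := @is_derive1_comp R (@powR R ^~ c) (fun w : R => w / om) v _ _ (is_derive1_powR c vo) h1.
by rewrite mulrAC.
Qed.

Lemma rpow_continuous c v : 0 < v -> {for v, continuous (rpow c)}.
Proof.
move=> v0; apply: differentiable_continuous; apply/derivable1_diffP.
by have [] := is_derive_rpow c v0.
Qed.

End power_weights.

Section derive_le.
Context {R : realType}.
Notation mu := (@lebesgue_measure R).

(** Exhaustion of []0, m[] by the intervals [[m / (j+2), m]]. The value of [F] at the lower end is
    nonnegative and is dropped, which leaves an inequality. *)
Lemma ge0_integral_derive_le (f F : R -> R) (m : R) : 0 < m ->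
  (forall v, 0 < v <= m -> is_derive v (1 : R) F (f v)) ->
  (forall v, 0 < v <= m -> {for v, continuous f}) ->
  (forall v, 0 < v <= m -> 0 <= f v) -> (forall v, 0 < v <= m -> 0 <= F v) ->
  (\int[mu]_(v in `]0%R, m[) (f v)%:E <= (F m)%:E)%E.
Proof.
move=> m0 FP cf f0 F0; pose I (j : nat) := `[(m / j.+2%:R), m]%classic.
have Ipos j : 0 < m / j.+2%:R by rewrite divr_gt0.
have Ilt j : m / j.+2%:R < m by rewrite ltr_pdivrMr// ltr_pMr// ltr1n.
have ID j v : I j v -> 0 < v <= m.
  by rewrite /I /= in_itv/= => /andP[jv ->]; rewrite (lt_le_trans (Ipos j) jv).
have cF v : 0 < v <= m -> {for v, continuous F}.
  move=> vm; apply: differentiable_continuous; apply/derivable1_diffP.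
  by have [] := FP v vm.
have ndI : nondecreasing_seq I.
  move=> a b ab; apply/subsetPset => v; rewrite /I /= !in_itv/= => /andP[av ->]; rewrite andbT.
  by apply: le_trans av; rewrite ler_pM2l// lef_pV2 ?posrE// ler_nat !ltnS.
have mI j : measurable (I j) by exact: measurable_itv.
have UI : `]0, m[%classic `<=` \bigcup_j I j.
  move=> v /=; rewrite in_itv/= => /andP[v0 vm].
  have vm0 : 0 < v / m by rewrite divr_gt0.
  have [j _ /(_ j (leqnn j)) /= jv] := near_infty_natSinv_lt (PosNum vm0).
  exists j => //; rewrite /I /= in_itv/= (ltW vm) andbT.
  apply: (@le_trans _ _ (m * j.+1%:R^-1)); first by rewrite ler_pM2l// lef_pV2 ?posrE// ler_nat.
  by rewrite -ler_pdivlMl// mulrC ltW.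
have mf : measurable_fun (\bigcup_j I j) (fun v => (f v)%:E).
  apply: (@measurable_funS _ _ _ _ (`]0, m]%classic)) => //.
    by move=> v [j _ /ID]; rewrite /= in_itv.
  apply/measurable_EFinP; apply: subspace_continuous_measurable_fun => //.
  by apply: continuous_in_subspaceT => v /set_mem/=; rewrite in_itv/=; exact: cf.
apply: (@le_trans _ _ (\int[mu]_(v in \bigcup_j I j) (f v)%:E)%E).
  apply: ge0_subset_integral => //; first by apply: bigcup_measurable => j _; exact: mI.
  by move=> v [j _ /ID Dv]; rewrite lee_fin f0.
have cv : (\int[mu]_(v in I i) (f v)%:E @[i --> \oo] --> \int[mu]_(v in \bigcup_i I i) (f v)%:E)%E.
  apply: ge0_nondecreasing_set_cvg_integral => //.
  - move=> i; apply: measurable_funS mf; first by apply: bigcup_measurable => j _; exact: mI.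
    exact: bigcup_sup.
  - by move=> i v Iv; rewrite lee_fin; exact: (f0 _ (ID i v Iv)).
rewrite -(cvg_lim _ cv)//; apply: lime_le; first by apply/cvg_ex; eexists; exact: cv.
apply: nearW => j.
have ooD v : v \in `](m / j.+2%:R), m[%R -> 0 < v <= m.
  by move=> vj; apply: (ID j); rewrite /I /=; exact: subset_itv_oo_cc.
rewrite (@continuous_FTC2 R f F)//.
- by rewrite -EFinB lee_fin lerBlDr lerDl F0//; apply: (ID j); rewrite /I /= in_itv/= lexx ltW.
- by apply: continuous_in_subspaceT => v /set_mem/ID; exact: cf.
- split.
  + by move=> v vj; have [] := FP v (ooD v vj).
  + by apply: cvg_at_right_filter; apply: cF; apply: (ID j); rewrite /I /= in_itv/= lexx ltW.
  + by apply: cvg_at_left_filter; apply: cF; rewrite m0 lexx.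
- by move=> v vj; rewrite derive1E; have [_ ->] := FP v (ooD v vj).
Qed.

End derive_le.

(** * From the isoperimetric inequality to a bound in the volume variable *)

Section radial_lower_bound.
Context {R : realType} {n : nat}.
Notation mu := (@lebesgue_measure R).
Notation om := (@omega R n).
Notation rp := (@rpow R n).
Implicit Types (x y : 'rV[R]_n).
Variables (g : 'rV[R]_n -> R) (Cg : R).
Hypotheses (mg : measurable_fun setT g) (g0 : forall x, 0 <= g x).
Hypothesis gC : forall x, g x <= Cg * dweight x.
Hypothesis cg : continuous g.
Hypothesis n2 : (2 < n)%N.
Variables (rho : 'rV[R]_n -> R) (Cr Ct : R).
Hypotheses (mrho : measurable_fun setT rho) (rho0 : forall x, 0 <= rho x).
Hypothesis rhoC : forall x, rho x <= Cr * dweight x.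
Hypothesis Ct0 : 0 <= Ct.
Hypothesis gT : forall x y (e : R), 0 < e <= 1 -> enorm y < e ->
  g (x + y) <= g x + e * rho x + Ct * e ^+ 2 * dweight x.
Variable En : 'rV[R]_n -> R.
Hypotheses (mEn : measurable_fun setT En) (En0 : forall x, 0 <= En x).
Hypothesis rhoEn : forall x, rho x ^+ 2 <= 4 * g x * En x.

Let n0 : (0 < n)%N. Proof. exact: ltn_trans n2. Qed.
Let n1 : (1 < n)%N. Proof. exact: ltn_trans n2. Qed.
Let nR0 : 0 < n%:R :> R. Proof. by rewrite ltr0n. Qed.

Notation gs := (gstar g).

(** An open initial interval of the half-line, possibly empty. The regularity and sign assumptions
    on [psi] are confined to it. *)
Definition gdom : set R := [set v | 0 < v /\ 0 < gs v].

Lemma gdom_le v w : gdom v -> 0 < w -> w <= v -> gdom w.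
Proof.
by move=> [v0 gv] w0 wv; split => //; apply: (lt_le_trans gv); exact: (gstar_noninc mg g0 gC).
Qed.

Lemma gdom_dfun t : 0 < t -> 0 < dfun g t -> gdom (dfun g t) /\ gs (dfun g t) = t.
Proof.
move=> t0 d0; have E : gs (dfun g t) = t.
  by rewrite gstarE// (rearr_dfun mg g0 gC cg n0).
by split => //; split => //; rewrite E.
Qed.

Lemma gdom_near v : gdom v -> \forall w \near v, gdom w.
Proof.
move=> [v0 gv]; have c := gstar_continuous mg g0 gC cg n0 v0.
near=> w; split; near: w; first exact: near_gt_pt.
exact: (@cvgr_gt _ _ (nbhs v) _ _ _ c 0 gv).
Unshelve. all: by end_near. Qed.

Lemma open_gdom : open gdom.
Proof. by rewrite openE => v /gdom_near. Qed.

Lemma measurable_gdom : measurable gdom.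
Proof. by apply: open_measurable; exact: open_gdom. Qed.

Lemma measurable_on_gdom (f : R -> R) : (forall v, gdom v -> {for v, continuous f}) ->
  measurable_fun setT (f \_ gdom).
Proof.
move=> cf; apply/(measurable_restrictT _ _).1; first exact: measurable_gdom.
apply: open_continuous_measurable_fun; first exact: open_gdom.
by move=> v; rewrite inE; exact: cf.
Qed.

Lemma rvol_gdom_dfun t v : 0 < t -> (t < gs v) = (0 < v) && (v < dfun g t).
Proof. exact: (lt_gstar mg g0 gC). Qed.

Variables (psi dpsi : R -> R).
Hypothesis psiP : forall v, gdom v -> is_derive v (1 : R) psi (dpsi v).
Hypothesis cdpsi : forall v, gdom v -> {for v, continuous dpsi}.
Hypotheses (dpsi0 : forall v, gdom v -> 0 <= dpsi v) (psi0 : forall v, gdom v -> 0 <= psi v).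

Let cpsi v : gdom v -> {for v, continuous psi}.
Proof.
move=> Dv; apply: differentiable_continuous; apply/derivable1_diffP.
by have [] := psiP Dv.
Qed.

(** In terms of the radius, [rp c2 v] is [r^(n-2)]; thus [S] below is [psi r^(n-2)], and [dS] is its
    derivative with respect to volume. *)
Let c2 : R := (n%:R - 2) / n%:R.
Let c20 : 0 <= c2. Proof. by rewrite divr_ge0// subr_ge0 ler_nat ltnW. Qed.

Let S v := psi v * rp c2 v.
Let dS v := dpsi v * rp c2 v + psi v * (c2 / om * rp (c2 - 1) v).

Let dS0 v : gdom v -> 0 <= dS v.
Proof.
move=> Dv; have o0 := @omega_gt0 R n.
apply: addr_ge0; first by rewrite mulr_ge0 ?dpsi0 ?rpow_ge0.
by rewrite mulr_ge0 ?psi0// mulr_ge0 ?rpow_ge0// divr_ge0 ?c20 ?(ltW o0).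
Qed.

Let S0 v : gdom v -> 0 <= S v.
Proof. by move=> Dv; rewrite mulr_ge0 ?psi0 ?rpow_ge0. Qed.

Let SP v : gdom v -> is_derive v (1 : R) S (dS v).
Proof.
move=> Dv; apply: (is_derive_eq (is_deriveM (psiP Dv) (is_derive_rpow c2 Dv.1))).
by rewrite /dS addrC; congr (_ + _); exact: mulrC.
Qed.

Let cS v : gdom v -> {for v, continuous S}.
Proof.
move=> Dv; apply: differentiable_continuous; apply/derivable1_diffP.
by have [] := SP Dv.
Qed.

Let cdS v : gdom v -> {for v, continuous dS}.
Proof.
move=> Dv; have r c : {for v, continuous (rp c)} := @rpow_continuous R n c v Dv.1.
apply: (@cvgD _ _ _ (nbhs v)); first exact: (@cvgM _ _ (nbhs v) _ _ _ _ _ (cdpsi Dv) (r c2)).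
apply: (@cvgM _ _ (nbhs v) _ _ _ _ _ (cpsi Dv)).
by apply: (@cvgM _ _ (nbhs v) _ (fun=> c2 / om)); [exact: cvg_cst|exact: r].
Qed.

Lemma ftc_gdom m : gdom m -> (\int[mu]_(v in `]0%R, m[) (dS v)%:E <= (S m)%:E)%E.
Proof.
move=> Dm; have D v : 0 < v <= m -> gdom v by move=> /andP[v0 vm]; exact: gdom_le vm.
apply: ge0_integral_derive_le; first exact: Dm.1.
- by move=> v /D Dv; exact: SP.
- by move=> v /D Dv; exact: cdS.
- by move=> v /D Dv; exact: dS0.
- by move=> v /D Dv; exact: S0.
Qed.

Notation pos := (\1_(`]0%R, +oo[%classic : set R) : R -> R).

Let patch_ge0 (f : R -> R) v : (forall v, gdom v -> 0 <= f v) -> 0 <= (f \_ gdom) v.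
Proof. by move=> f0; rewrite patchE; case: ifPn => [/set_mem/f0|]. Qed.

Let gs0 v : 0 <= gs v. Proof. exact: (gstar_ge0 g0 gC). Qed.

Let mgs : measurable_fun setT gs. Proof. exact: (measurable_gstar mg g0 gC cg n0). Qed.

Let mdfun : measurable_fun setT (dfun g).
Proof.
apply: (measurableT_comp (fine_measurable measurableT)).
exact: (measurable_layer (@rvol R n) (measurable_subgraph mg)).
Qed.

Let integral_gdom (f : R -> R) :
  (\int[mu]_(v in gdom) (f v)%:E = \int[mu]_v ((f \_ gdom) v)%:E)%E.
Proof.
rewrite integral_mkcond; apply: eq_integral => v _; rewrite !patchE.
by case: ifP.
Qed.

(** For a level [t] the points [v] with [t < gs v] form []0, dfun g t[], on which [dS] integrates to
    at most [S (dfun g t)]. *)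
Lemma layer_gdom : (\int[mu]_(v in gdom) (dS v * gs v)%:E <=
  \int[mu]_t (pos t * (S \_ gdom) (dfun g t))%:E)%E.
Proof.
pose ds := dS \_ gdom.
have ds0 v : 0 <= ds v by exact: patch_ge0.
have mds : measurable_fun setT ds by apply: measurable_on_gdom; exact: cdS.
have mS : measurable_fun setT (S \_ gdom) by apply: measurable_on_gdom; exact: cS.
have mE := measurable_subgraph mgs.
pose F (z : R * R) : \bar R := (ds z.1 * (pos z.2 * \1_[set z : R * R | z.2 < gs z.1] z))%:E.
have F0 z : (0 <= F z)%E by rewrite lee_fin !mulr_ge0.
have mpos2 : measurable_fun setT (fun z : R * R => pos z.2).
  by apply: (@measurableT_comp _ _ _ _ _ _ pos); [exact: measurable_indic|exact: measurable_snd].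
have mF : measurable_fun setT F.
  apply/measurable_EFinP; apply: measurable_funM; first exact: (measurableT_comp mds).
  by apply: measurable_funM => //; exact: measurable_indic.
rewrite (_ : (\int[mu]_(v in gdom) _)%E = (\int[mu]_v \int[mu]_t F (v, t))%E); last first.
  rewrite integral_gdom; apply: eq_integral => v _.
  transitivity (\int[mu]_t ((ds v)%:E * (pos t * \1_[set t | (t < gs v)%R] t)%:E))%E.
    rewrite ge0_integralZl_EFin//.
    - rewrite integral_under_graph// -EFinM; congr (_%:E).
      by rewrite /ds !patchE; case: ifP; rewrite ?mul0r.
    - apply/measurable_EFinP; apply: measurable_funM; first exact: measurable_indic.
      by apply: measurable_indic; rewrite (_ : [set t | t < gs v] = `]-oo, (gs v)[%classic).
  by apply: eq_integral => t _.
rewrite (@fubini_tonelli _ _ _ _ _ mu mu F)//; apply: ge0_le_integral => //.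
- by move=> t _; apply: integral_ge0.
- exact: (measurable_fun_fubini_tonelli_G (m1 := mu) F mF F0).
- apply/measurable_EFinP; apply: measurable_funM; first exact: measurable_indic.
  exact: (measurableT_comp mS mdfun).
move=> t _; rewrite indicE; have [/set_mem/=|tn] := boolP (t \in _); last first.
  rewrite mul0r; apply: (@le_trans _ _ (\int[mu]_(x in setT) 0)%E); last by rewrite integral0.
  by rewrite le_eqVlt; apply/orP; left; apply/eqP; apply: eq_integral => v _;
    rewrite /F /= indicE (negPf tn) mul0r mulr0.
rewrite in_itv/= andbT => t0; rewrite mul1r.
rewrite (_ : (\int[mu]_v F (v, t))%E = (\int[mu]_(v in `]0%R, (dfun g t)[) (ds v)%:E)%E); last first.
  rewrite [RHS]integral_mkcond; apply: eq_integral => v _; rewrite /F /= patchE.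
  rewrite indicE mem_set/= ?in_itv/= ?t0// mul1r.
  have -> : \1_[set z : R * R | z.2 < gs z.1] (v, t) = (v \in (`]0%R, (dfun g t)[%classic : set R))%:R :> R.
    rewrite indicE; congr (_%:R); apply: congr1; apply/idP/idP.
      by move=> /set_mem/=; rewrite rvol_gdom_dfun// => h; apply/mem_set; rewrite /= in_itv.
    by move=> /set_mem/=; rewrite in_itv/= => h; apply/mem_set; rewrite /= rvol_gdom_dfun.
  by case: (v \in _); rewrite ?mulr1 ?mulr0.
have [d0|d0] := ltP 0 (dfun g t); last first.
  rewrite set_itv_ge ?bnd_simp -?leNgt// integral_set0 lee_fin; exact: patch_ge0.
have [Dd _] := gdom_dfun t0 d0.
rewrite [X in (_ <= X%:E)%E]patchE mem_set//; apply: le_trans (ftc_gdom Dd).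
rewrite le_eqVlt; apply/orP; left; apply/eqP; apply: eq_integral => v.
rewrite inE/= in_itv/= => /andP[v0 vd]; rewrite /ds patchE mem_set//.
by apply: (gdom_le Dd) => //; exact: ltW.
Qed.

(** This is [psi / r], the multiplier meant for the level whose superlevel set has volume [v]. *)
Let K v := psi v * rp (- n%:R^-1) v.

Let K0 v : gdom v -> 0 <= K v.
Proof. by move=> Dv; rewrite mulr_ge0 ?psi0 ?rpow_ge0. Qed.

Let cK v : gdom v -> {for v, continuous K}.
Proof.
move=> Dv; exact: (@cvgM _ _ (nbhs v) _ _ _ _ _ (cpsi Dv) (@rpow_continuous R n _ v Dv.1)).
Qed.

Let K2 v : gdom v -> K v ^+ 2 = psi v ^+ 2 * rp (- (2 / n%:R)) v.
Proof.
move=> Dv; rewrite exprMn; congr (_ * _); rewrite expr2 -rpowD//; last exact: Dv.1.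
by congr (rp _ v); rewrite mulrDl mul1r opprD.
Qed.

Let Krad t : 0 < t -> 0 < dfun g t ->
  K (dfun g t) * rad g t ^+ n.-1 = S (dfun g t).
Proof.
move=> t0 d0; rewrite /K /S -mulrA; congr (_ * _).
have -> : rad g t = rp n%:R^-1 (dfun g t) by [].
have -> : rp n%:R^-1 (dfun g t) ^+ n.-1 = rp ((n%:R - 1) / n%:R) (dfun g t).
  rewrite -powR_mulrn ?rpow_ge0// /rpow -powRrM; congr (_ `^ _).
  by rewrite -subn1 natrB// mulrC.
by rewrite -rpowD//; congr (rp _ _); rewrite /c2; field; rewrite gt_eqF.
Qed.

(** Every interval on which [gs] is constant contains a rational point, so this countable set lists
    all plateau values. *)
Let bad : set R := [set gs (ratr q) | q in [set: rat]].

(** Off [bad], the monotone [gs] falls strictly on both sides of [dfun g t]; at distance [d] or more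
    its value differs from [t] by at least the smaller of the two drops. This is the separation that
    [infconv_limit] asks for. *)
Let sep t : 0 < t -> 0 < dfun g t -> ~ bad t -> forall d, 0 < d ->
  exists2 h, 0 < h & forall v, gdom v -> d <= `|v - dfun g t| -> h <= `|t - gs v|.
Proof.
move=> t0 v0 nb d d0; set w := dfun g t in v0 *.
have [Dw gw] := gdom_dfun t0 v0.
have ni := gstar_noninc mg g0 gC.
pose e := Num.min d (w / 2).
have e0 : 0 < e by rewrite lt_min d0 divr_gt0.
have ed : e <= d by rewrite ge_min lexx.
have ew : e <= w / 2 by rewrite ge_min lexx orbT.
have w1 : 0 < w - e by lra.
have noflat a b : 0 < a -> a < b -> gs a = t -> gs b = t -> False.
  move=> a0 ab ga gb; have [q] := rat_in_itvoo ab.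
  rewrite in_itv/= => /andP[aq qb]; apply: nb; exists q => //; apply/eqP; rewrite eq_le.
  apply/andP; split; first by rewrite -[leRHS]ga; apply: ni => //; exact: ltW.
  by rewrite -[leLHS]gb; apply: ni; [exact: lt_trans aq|exact: ltW].
have up : gs (w + e) < t.
  rewrite lt_neqAle -{2}gw ni ?andbT//; last by rewrite lerDl ltW.
  by apply/eqP => E; apply: (noflat w (w + e)) => //; rewrite ltrDl.
have dn : t < gs (w - e).
  rewrite lt_neqAle -{2}gw ni ?andbT//; last by rewrite gerBl ltW.
  by apply/eqP => E; apply: (noflat (w - e) w) => //; rewrite gtrBl.
exists (Num.min (t - gs (w + e)) (gs (w - e) - t)); first by rewrite lt_min !subr_gt0 up dn.
move=> v [v00 gv] dv; rewrite ge_min.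
have [vw|wv] := leP v w.
  apply/orP; right; have vwe : v <= w - e by move: dv; rewrite ler0_norm ?subr_le0//; lra.
  have := ni _ _ v00 vwe => h; rewrite ler0_norm; first by lra.
  by rewrite subr_le0; apply: (le_trans (ltW dn)).
apply/orP; left; have vwe : w + e <= v by move: dv; rewrite gtr0_norm ?subr_gt0//; lra.
have we0 : 0 < w + e by lra.
have := ni _ _ we0 vwe => h; rewrite ger0_norm; first by lra.
by rewrite subr_ge0; apply: (le_trans h); exact: ltW.
Qed.

(** [functional_isoperimetric] is applied to Lipschitz minorants [lam k] of [psi / r] and combined
    with [lam rho <= En + lam^2 g]. Monotone convergence in [k] recovers [psi / r] at almost every
    level. *)
Theorem radial_lower_bound : ((n%:R * om)%:E * \int[mu]_(v in gdom) (dS v * gs v)%:E <=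
  \int[rvol]_x (En x)%:E + \int[mu]_(v in gdom) (psi v ^+ 2 * rp (- (2 / n%:R)) v * gs v)%:E)%E.
Proof.
have o0 := @omega_gt0 R n; have no0 : 0 <= n%:R * om by rewrite mulr_ge0// ltW.
have dg0 v : gdom v -> 0 <= dS v * gs v by move=> Dv; rewrite mulr_ge0 ?dS0.
have q0 v : gdom v -> 0 <= psi v ^+ 2 * rp (- (2 / n%:R)) v * gs v.
  by move=> Dv; apply: mulr_ge0 => //; apply: mulr_ge0; [exact: sqr_ge0|exact: rpow_ge0].
have rhs0 : (0 <= \int[rvol]_x (En x)%:E + \int[mu]_(v in gdom) (psi v ^+ 2 * rp (- (2 / n%:R)) v * gs v)%:E)%E.
  by rewrite adde_ge0// integral_ge0// => v Dv; rewrite lee_fin ?En0// q0.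
have [Dne|De] := pselect (gdom !=set0); last first.
  have -> : gdom = set0 by apply/seteqP; split => // v Dv; apply: De; exists v.
  rewrite integral_set0 mule0; have -> : set0 = gdom; last exact: rhs0.
  by apply/seteqP; split => // v Dv; apply: De; exists v.
pose lam := infconv gdom K gs.
pose f k t : R := pos t * (lam k t * (n%:R * om * rad g t ^+ n.-1)).
have lam0 k t : 0 <= lam k t by exact: infconv_ge0.
have mlam k : measurable_fun setT (lam k) by exact: measurable_infconv.
have mrad := measurable_rad mg.
have f0 k t : 0 <= f k t by rewrite !mulr_ge0 ?exprn_ge0 ?rad_ge0// ltW.
have mf k : measurable_fun setT (f k).
  apply: measurable_funM; first exact: measurable_indic.
  by apply: measurable_funM => //; apply: measurable_funM => //; exact: measurable_funX.
have ndf t : nondecreasing_seq (fun k => (f k t)%:E).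
  move=> a b ab; rewrite lee_fin; apply: ler_wpM2l => //; apply: ler_wpM2r.
    by rewrite mulr_ge0// exprn_ge0// rad_ge0.
  exact: infconv_mono.
have key k : (\int[mu]_t (f k t)%:E <=
    \int[rvol]_x (En x)%:E + \int[mu]_(v in gdom) (psi v ^+ 2 * rp (- (2 / n%:R)) v * gs v)%:E)%E.
  apply: (@le_trans _ _ (\int[rvol]_x (lam k (g x) * rho x)%:E)%E).
    apply: (@functional_isoperimetric R n g Cg mg g0 gC n0 rho Cr Ct mrho rho0 rhoC Ct0 gT n1 (lam k) k%:R k%:R) => //.
    - by move=> t; exact: infconv_le.
    - by move=> s t; exact: infconv_lip.
  apply: (@le_trans _ _ (\int[rvol]_x (En x)%:E + \int[rvol]_x (lam k (g x) ^+ 2 * g x)%:E)%E).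
    rewrite -ge0_integralD//; last 4 first.
    - by move=> x _; rewrite lee_fin.
    - exact/measurable_EFinP.
    - by move=> x _; rewrite lee_fin mulr_ge0 ?sqr_ge0.
    - apply/measurable_EFinP; apply: measurable_funM => //; apply: measurable_funX.
      exact: measurableT_comp.
    apply: ge0_le_integral => //.
    - by move=> x _; rewrite lee_fin mulr_ge0.
    - by apply/measurable_EFinP; apply: measurable_funM => //; exact: measurableT_comp.
    - apply: emeasurable_funD; first exact/measurable_EFinP.
      apply/measurable_EFinP; apply: measurable_funM => //; apply: measurable_funX.
      exact: measurableT_comp.
    move=> x _; rewrite -EFinD lee_fin.
    have A0 : 0 <= lam k (g x) ^+ 2 * g x by rewrite mulr_ge0 ?sqr_ge0.
    (* After squaring, [rho^2 <= 4 g En] and [4 x y <= (x + y)^2] suffice. *)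
    rewrite -(ler_pXn2r (_ : 0 < 2)%N) ?nnegrE ?mulr_ge0 ?addr_ge0//.
    apply: (@le_trans _ _ (lam k (g x) ^+ 2 * (4 * g x * En x))).
      by rewrite exprMn ler_wpM2l ?sqr_ge0.
    have := sqr_ge0 (lam k (g x) ^+ 2 * g x - En x); lra.
  rewrite leeD2l//.
  (* The cut-off [pos] makes [F] vanish at nonpositive levels, as [equimeasurable] demands; a point
     with [g x = 0] contributes 0 either way. *)
  pose F t : \bar R := (pos t * (lam k t ^+ 2 * t))%:E.
  have Fpos t : 0 < t -> F t = (lam k t ^+ 2 * t)%:E.
    by move=> t0; rewrite /F indicE mem_set/= ?mul1r// in_itv/= t0.
  have F00 t : t <= 0 -> F t = 0%E.
    move=> t0; rewrite /F indicE memNset/= ?mul0r// in_itv/= andbT.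
    by apply/negP; rewrite -leNgt.
  have F0 t : (0 <= F t)%E.
    have [t0|t0] := ltP 0 t; last by rewrite F00.
    by rewrite Fpos// lee_fin mulr_ge0 ?sqr_ge0// ltW.
  have mF : measurable_fun setT F.
    apply/measurable_EFinP; apply: measurable_funM; first exact: measurable_indic.
    by apply: measurable_funM => //; exact: measurable_funX.
  rewrite (_ : (\int[rvol]_x _)%E = (\int[rvol]_x F (g x))%E); last first.
    apply: eq_integral => x _; have := g0 x; rewrite le_eqVlt => /predU1P[<-|gx].
      by rewrite F00// mulr0.
    by rewrite Fpos.
  rewrite (equimeasurable mg g0 gC cg n0 mF F0 F00).
  rewrite integral_gdom; apply: ge0_le_integral => //.
  - exact: (measurableT_comp mF mgs).
  - apply/measurable_EFinP; apply: measurable_on_gdom => v Dv.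
    apply: (@cvgM _ _ (nbhs v)); last exact: (gstar_continuous mg g0 gC cg n0 Dv.1).
    apply: (@cvgM _ _ (nbhs v)); last exact: (@rpow_continuous R n _ v Dv.1).
    exact: (@cvgM _ _ (nbhs v) _ _ _ _ _ (cpsi Dv) (cpsi Dv)).
  move=> v _; rewrite patchE; case: ifPn => [/set_mem Dv|].
    rewrite Fpos ?lee_fin; last exact: Dv.2.
    rewrite -K2//; apply: ler_wpM2r => //.
    (* Taking [v] itself as competitor in the infimum gives [lam k (gs v) <= K v]. *)
    rewrite ler_pXn2r ?nnegrE ?K0//; have := @infconv_le_at R gdom K gs Dne K0 k (gs v) v Dv.
    by rewrite subrr normr0 mulr0 addr0.
  rewrite notin_setE => nD; rewrite F00 ?lexx//.
  have [v0|v0] := ltP 0 v; last by rewrite gstar_le0.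
  by rewrite leNgt; apply/negP => gv; apply: nD.
have lim_le : (\int[mu]_t limn (fun k => (f k t)%:E) <=
    \int[rvol]_x (En x)%:E + \int[mu]_(v in gdom) (psi v ^+ 2 * rp (- (2 / n%:R)) v * gs v)%:E)%E.
  rewrite monotone_convergence; last 4 first.
  - by [].
  - by move=> k; apply/measurable_EFinP; exact: mf.
  - by move=> k t _; rewrite lee_fin.
  - by move=> t _; exact: ndf.
  apply: lime_le; last by apply: nearW.
  apply: ereal_nondecreasing_is_cvgn => a b ab; apply: ge0_le_integral => //.
  - by move=> t _; rewrite lee_fin.
  - by apply/measurable_EFinP; exact: mf.
  - by apply/measurable_EFinP; exact: mf.
  - by move=> t _; exact: ndf.
apply: le_trans lim_le.
apply: (@le_trans _ _ ((n%:R * om)%:E * \int[mu]_t (pos t * (S \_ gdom) (dfun g t))%:E)%E).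
  by apply: lee_wpmul2l; [rewrite lee_fin|exact: layer_gdom].
have mSg : measurable_fun setT (fun t => pos t * (S \_ gdom) (dfun g t)).
  apply: measurable_funM; first exact: measurable_indic.
  by apply: (measurableT_comp _ mdfun); apply: measurable_on_gdom; exact: cS.
have Sg0 v : 0 <= (S \_ gdom) v by exact: patch_ge0.
rewrite -ge0_integralZl_EFin//; last 2 first.
- by move=> t _; rewrite lee_fin mulr_ge0.
- exact/measurable_EFinP.
have lim0 t : (0 <= limn (fun k => (f k t)%:E))%E.
  apply: lime_ge; first exact: ereal_nondecreasing_is_cvgn.
  by apply: nearW => k; rewrite lee_fin.
apply: ae_ge0_le_integral => //.
- by move=> t _; rewrite -EFinM lee_fin mulr_ge0// mulr_ge0.
- by apply: emeasurable_funM => //; exact/measurable_EFinP.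
- apply: (emeasurable_fun_cvg (fun k t => (f k t)%:E)).
    by move=> k; apply/measurable_EFinP; exact: mf.
  by move=> t _; exact: ereal_nondecreasing_is_cvgn.
have cbad : countable bad by apply: (card_le_trans (card_image_le _ _)); exact: countableP.
exists bad; split.
- by apply: countable_measurable; [exact: measurable_set1|exact: cbad].
- by exact: countable_lebesgue_measure0.
move=> t /= nle; apply: contrapT => nb; apply: nle => _.
rewrite indicE; have [/set_mem/=|_] := boolP (t \in _); last by rewrite mul0r mule0.
rewrite in_itv/= andbT => t0; rewrite mul1r.
have [d0|d0] := ltP 0 (dfun g t); last first.
  rewrite patchE memNset ?mule0//; move=> [h _].
  by move: (lt_le_trans h d0); rewrite ltxx.
have [Dd gd] := gdom_dfun t0 d0.
rewrite patchE mem_set// -Krad// -EFinM.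
apply/lee_addgt0Pr => e e0.
have W0 : 0 < n%:R * om * rad g t ^+ n.-1 + 1 by rewrite ltr_wpDl// mulr_ge0// exprn_ge0// rad_ge0.
pose e' := e / (n%:R * om * rad g t ^+ n.-1 + 1).
have e'0 : 0 < e' by rewrite divr_gt0.
have [N hN] := @infconv_limit R gdom K gs Dne K0 t _ e' e'0 (cK Dd) Dd (sep t0 d0 nb).
rewrite -leeBlDr//; apply: lime_ge; first exact: ereal_nondecreasing_is_cvgn.
near=> k; rewrite -EFinB lee_fin lerBlDr /f indicE mem_set/= ?in_itv/= ?t0// mul1r.
have kN : (N <= k)%N by near: k; exact: nbhs_infty_ge.
have h := hN k kN; set W := n%:R * om * rad g t ^+ n.-1.
have W0' : 0 <= W by rewrite mulr_ge0// exprn_ge0// rad_ge0.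
have eW : e' * W <= e.
  by rewrite /e' -/W mulrAC ler_pdivrMr// ler_pM2l// lerDl.
have := ler_wpM2r W0' h; rewrite -/(lam k t) mulrBl.
rewrite (_ : n%:R * om * (K (dfun g t) * rad g t ^+ n.-1) = K (dfun g t) * W); last by rewrite /W; ring.
lra.
Unshelve. all: by end_near. Qed.

End radial_lower_bound.

(** * Gamma and beta integrals, volume of the ball *)

Section gamma.
Context {R : realType}.
Notation mu := (@lebesgue_measure R).
Local Notation pos := (\1_(`]0%R, +oo[%classic : set R)).
Implicit Types (s t u : R).

Lemma integral_indicM (A : set R) (f : R -> R) :
  (\int[mu]_t (\1_A t * f t)%:E = \int[mu]_(t in A) (f t)%:E)%E.
Proof.
rewrite [RHS]integral_mkcond; apply: eq_integral => t _.
by rewrite patchE indicE; case: ifPn => _; rewrite ?mul1r ?mul0r.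
Qed.

(** Kept extended-valued: [Gamma] applies [fine] to this integral, so its finiteness has to be
    established before the value can be used. *)
Definition gamma_int s : \bar R := (\int[mu]_t (pos t * (t `^ (s - 1) * expR (- t)))%:E)%E.

Lemma Gamma_fine s : Gamma s = fine (gamma_int s).
Proof.
rewrite /Gamma /gamma_int integral_indicM; congr (fine (integral _ _ _)).
by apply/seteqP; split => x /=; rewrite in_itv/= andbT.
Qed.

Lemma integral_exp_tail u :
  (\int[mu]_t (\1_(`]u, +oo[%classic : set R) t * expR (- t))%:E = (expR (- u))%:E)%E.
Proof.
have dF t : is_derive (t : R) (1 : R) (fun t => - expR (- t) : R) (expR (- t)).
  by apply: is_derive_eq; rewrite mulrN1 opprK.
have cF : continuous (fun t => expR (- t) : R).
  by move=> t; apply: (@continuous_comp _ _ _ (fun t : R => - t) expR); [exact: opp_continuous|exact: continuous_expR].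
rewrite integral_indicM integral_itv_obnd_cbnd; last first.
  by apply/measurable_EFinP/measurable_funTS; exact: continuous_measurable_fun.
rewrite (@ge0_continuous_FTC2y _ _ (fun t => - expR (- t)) _ 0)//.
- by rewrite EFinN oppeK add0e.
- exact: continuous_subspaceT.
- by rewrite -oppr0; apply: cvgN; exact: cvgr_expR.
- by apply: cvg_at_right_filter; apply: cvgN; exact: cF.
- by move=> x ux; rewrite derive1E; have [_ ->] := dF x.
Qed.

Lemma integral_powR s t : 1 < s -> 0 <= t ->
  (\int[mu]_u (\1_(`]0%R, t[%classic : set R) u * (s * u `^ (s - 1)))%:E = (t `^ s)%:E)%E.
Proof.
move=> s1; rewrite le_eqVlt => /predU1P[<-|t0].
  rewrite powR0 ?gt_eqF//; last by lra.
  by apply: integral0_eq => u _; rewrite indicE mem_setE in_itv/= lt_asym mul0r.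
have s10 : 0 < s - 1 by lra.
have mf : measurable_fun setT (fun u : R => s * u `^ (s - 1)).
  by apply: measurable_funM => //; exact: measurable_powR.
rewrite integral_indicM integral_itv_bndo_bndc; last by apply/measurable_EFinP/measurable_funTS.
rewrite integral_itv_obnd_cbnd; last by apply/measurable_EFinP/measurable_funTS.
have cp (b x : R) : 0 < x -> {for x, continuous (fun y : R => y `^ b)}.
  move=> x0; apply: differentiable_continuous; apply/derivable1_diffP.
  by have [] := @is_derive1_powR R b x x0.
rewrite (@continuous_FTC2 _ _ (fun u => u `^ s) 0 t t0).
- by rewrite powR0 ?sube0//; apply/eqP; lra.
- apply/continuous_within_itvP => //; split.
  + move=> x; rewrite in_itv/= => /andP[x0 _].
    by apply: (@cvgM _ _ (nbhs x)); [exact: cvg_cst|exact: cp].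
  + rewrite powR0 ?gt_eqF//.
    by apply: (@cvgM _ _ 0^'+); [exact: cvg_cst|exact: powR_cvg0].
  + apply: cvg_at_left_filter.
    by apply: (@cvgM _ _ (nbhs t)); [exact: cvg_cst|exact: cp].
- split.
  + move=> x; rewrite in_itv/= => /andP[x0 _].
    by have [] := @is_derive1_powR R s x x0.
  + rewrite powR0; last by apply/eqP; lra.
    by apply: powR_cvg0; lra.
  + by apply: cvg_at_left_filter; exact: cp.
- move=> x; rewrite in_itv/= => /andP[x0 _].
  by rewrite derive1E; have [_ ->] := @is_derive1_powR R s x x0.
Qed.

Let mexpN : measurable_fun setT (fun t : R => expR (- t)).
Proof.
by apply: (measurableT_comp (@measurable_expR R)); exact: oppr_measurable.
Qed.

Let mgamma s : measurable_fun setT (fun t : R => pos t * (t `^ (s - 1) * expR (- t))).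
Proof.
apply: measurable_funM; first exact: measurable_indic.
by apply: measurable_funM => //; exact: measurable_powR.
Qed.

Let gamma_ge0 s t : 0 <= pos t * (t `^ (s - 1) * expR (- t)).
Proof. by rewrite !mulr_ge0 ?powR_ge0 ?expR_ge0. Qed.

Lemma gamma_int_ge0 s : (0 <= gamma_int s)%E.
Proof. by apply: integral_ge0 => t _; rewrite lee_fin. Qed.

(** [t^s] is the integral of [s u^(s-1)] over []0, t[]; after exchanging the integrals, the one in
    [t] is the exponential tail [exp(-u)]. *)
Lemma gamma_intS s : 1 < s -> gamma_int (s + 1) = (s%:E * gamma_int s)%E.
Proof.
move=> s1; have s0 : 0 <= s by lra.
pose F (z : R * R) : \bar R :=
  (pos z.2 * (s * z.2 `^ (s - 1)) * (pos (z.1 - z.2) * expR (- z.1)))%:E.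
have mF : measurable_fun setT F.
  apply/measurable_EFinP; apply: measurable_funM; apply: measurable_funM.
  - apply: (measurableT_comp _ measurable_snd); exact: measurable_indic.
  - apply: measurable_funM => //.
    by apply: (measurableT_comp (measurable_powR _)); exact: measurable_snd.
  - apply: (measurableT_comp (measurable_indic _)) => //.
    by apply: measurable_funB; [exact: measurable_fst|exact: measurable_snd].
  - by apply: (measurableT_comp mexpN); exact: measurable_fst.
have F0 z : (0 <= F z)%E.
  by rewrite /F lee_fin !mulr_ge0 ?powR_ge0 ?expR_ge0.
transitivity (\int[mu]_t \int[mu]_u F (t, u))%E.
  apply: eq_integral => t _; rewrite /F/=.
  rewrite (_ : s + 1 - 1 = s); last by ring.
  transitivity (\int[mu]_u ((expR (- t))%:E * (\1_(`]0%R, t[%classic : set R) u * (s * u `^ (s - 1)))%:E))%E; last first.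
    apply: eq_integral => u _; rewrite -EFinM; congr (_%:E).
    rewrite !indicE !mem_setE !in_itv/= !andbT subr_gt0 -mulnb natrM; ring.
  rewrite ge0_integralZl_EFin; last 4 first.
- by [].
  - by move=> u _; rewrite lee_fin !mulr_ge0 ?powR_ge0.
  - apply/measurable_EFinP; apply: measurable_funM; first exact: measurable_indic.
    by apply: measurable_funM => //; exact: measurable_powR.
  - exact: expR_ge0.
  rewrite indicE mem_setE in_itv/= andbT; have [t0|t0] := ltP 0 t.
    by rewrite integral_powR ?(ltW t0)// -EFinM mul1r mulrC.
  rewrite mul0r integral0_eq ?mule0// => u _; rewrite indicE mem_setE in_itv/=.
  by have [u0|_] := ltP 0 u; rewrite /= ?mul0r// ltNge (le_trans t0 (ltW u0)) mul0r.
rewrite (@fubini_tonelli _ _ _ _ _ mu mu F)// /gamma_int -ge0_integralZl_EFin//; last 2 first.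
- by move=> t _; rewrite lee_fin.
- by apply/measurable_EFinP; exact: mgamma.
apply: eq_integral => u _; rewrite /F/=.
transitivity (\int[mu]_t ((pos u * (s * u `^ (s - 1)))%:E * (\1_(`]u, +oo[%classic : set R) t * expR (- t))%:E))%E.
  apply: eq_integral => t _; rewrite -EFinM; congr (_%:E); congr (_ * (_ * _)).
  by rewrite !indicE !mem_setE !in_itv/= !andbT subr_gt0.
rewrite ge0_integralZl_EFin; last 4 first.
- by [].
- by move=> t _; rewrite lee_fin mulr_ge0 ?expR_ge0.
- by apply/measurable_EFinP; apply: measurable_funM => //; exact: measurable_indic.
- by rewrite !mulr_ge0 ?powR_ge0.
by rewrite integral_exp_tail -!EFinM; congr (_%:E); ring.
Qed.

(** With [k = s - 1], the bound [x <= exp x] at [x = t / (2 k)] gives [t^k <= (2 k)^k exp(t/2)], so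
    the integrand is at most [(2 k)^k exp(-t/2)]. *)
Lemma gamma_int_fin s : 1 < s -> gamma_int s \is a fin_num.
Proof.
move=> s1; rewrite ge0_fin_numE ?gamma_int_ge0//.
pose k := s - 1; have k0 : 0 < k by rewrite subr_gt0.
have k20 : 0 < 2 * k by rewrite mulr_gt0.
pose h t : \bar R := (\1_(`]0%R, +oo[%classic : set R) t * expR (- t))%:E.
have mh : measurable_fun setT h.
  by apply/measurable_EFinP; apply: measurable_funM => //; exact: measurable_indic.
have h0 t : (0 <= h t)%E by rewrite lee_fin mulr_ge0 ?expR_ge0.
apply: (@le_lt_trans _ _ (((2 * k) `^ k)%:E * \int[mu]_t h (2^-1 * t + 0)%R))%E; last first.
  rewrite ge0_integral_affine//.
  by rewrite /h integral_exp_tail -!EFinM ltry.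
rewrite -ge0_integralZl_EFin//; last 2 first.
- by apply: measurableT_comp => //; exact: measurable_affine.
- exact: powR_ge0.
apply: ge0_le_integral => //.
- by move=> t _; rewrite lee_fin.
- by apply/measurable_EFinP; exact: mgamma.
- apply: measurable_funeM; apply: measurableT_comp => //; exact: measurable_affine.
move=> t _; rewrite /h -EFinM lee_fin addr0 !indicE !mem_setE !in_itv/= !andbT.
rewrite pmulr_rgt0 ?invr_gt0//; have [t0|_] := ltP 0 t; last by rewrite !mul0r mulr0.
rewrite !mul1r.
have le1 : t <= 2 * k * expR (t / (2 * k)).
  rewrite mulrC -ler_pdivrMr//; apply: le_trans (expR_ge1Dx _); lra.
have : t `^ k <= (2 * k * expR (t / (2 * k))) `^ k.
  by apply: ge0_ler_powR; rewrite ?nnegrE ?mulr_ge0 ?expR_ge0// ltW.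
rewrite powRM ?expR_ge0 ?(ltW k20)// -expRM -/k => le2.
rewrite (_ : t / (2 * k) * k = 2^-1 * t) in le2; last by field; rewrite gt_eqF.
have := ler_wpM2r (expR_ge0 (- t)) le2; rewrite -mulrA -expRD.
by rewrite (_ : 2^-1 * t + - t = - (2^-1 * t)); last lra.
Qed.

(** On []1, +oo[] the integrand dominates [exp(-t)]. *)
Lemma gamma_int_gt0 s : 1 < s -> (0 < gamma_int s)%E.
Proof.
move=> s1; apply: (@lt_le_trans _ _ (expR (- 1))%:E); first by rewrite lte_fin expR_gt0.
rewrite -integral_exp_tail; apply: ge0_le_integral => //.
- by apply/measurable_EFinP; apply: measurable_funM => //; exact: measurable_indic.
- by apply/measurable_EFinP; exact: mgamma.
move=> t _; rewrite lee_fin !indicE !mem_setE !in_itv/= !andbT.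
have [t1|_] := ltP 1 t; last by rewrite mul0r mulr_ge0 ?mulr_ge0 ?powR_ge0 ?expR_ge0.
rewrite (lt_trans ltr01 t1) !mul1r.
rewrite ler_peMl ?expR_ge0//; apply: (@le_trans _ _ (1 `^ (s - 1))); first by rewrite powR1.
by apply: ge0_ler_powR; rewrite ?nnegrE//; lra.
Qed.

Lemma gammaE s : 1 < s -> gamma_int s = (Gamma s)%:E.
Proof. by move=> s1; rewrite Gamma_fine fineK// gamma_int_fin. Qed.

Lemma Gamma_gt0 s : 1 < s -> 0 < Gamma s.
Proof. by move=> s1; rewrite -lte_fin -gammaE// gamma_int_gt0. Qed.

Lemma GammaS s : 1 < s -> Gamma (s + 1) = s * Gamma s.
Proof.
move=> s1; apply: EFin_inj; rewrite EFinM -!gammaE ?gamma_intS//; lra.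
Qed.

Definition beta_weight (k y : R) : R := \1_(`]-1, 1[%classic : set R) y * (1 - y ^+ 2) `^ k.

Lemma measurable_beta_weight k : measurable_fun setT (beta_weight k).
Proof.
apply: measurable_funM; first exact: measurable_indic.
apply: (measurableT_comp (measurable_powR _)).
by apply: measurable_funB => //; exact: measurable_funX.
Qed.

Lemma beta_weight_ge0 k y : 0 <= beta_weight k y.
Proof. by rewrite mulr_ge0 ?powR_ge0. Qed.

Definition beta_int k : \bar R := (\int[mu]_y (beta_weight k y)%:E)%E.

(** The square is a double integral in [x] and [w - x]. For fixed [w], the substitution
    [x = (w/2) (1 + y)] turns [x (w - x)] into [(w^2/4) (1 - y^2)] and separates the variables; the
    power of 2 collects [4^(1-s)] and the Jacobian [1/2]. *)
Lemma gamma_int_sqr s : 1 < s ->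
  (gamma_int s * gamma_int s = (2 `^ (1 - 2 * s))%:E * beta_int (s - 1) * gamma_int (2 * s))%E.
Proof.
move=> s1; pose G t : R := pos t * (t `^ (s - 1) * expR (- t)).
have mG : measurable_fun setT G by exact: mgamma.
have mposB : measurable_fun setT (fun z : R * R => z.2 - z.1).
  by apply: measurable_funB; [exact: measurable_snd|exact: measurable_fst].
pose F (z : R * R) : \bar R := (G z.1 * G (z.2 - z.1))%:E.
have mF : measurable_fun setT F.
  apply/measurable_EFinP; apply: measurable_funM; first by apply: (measurableT_comp mG); exact: measurable_fst.
  exact: (measurableT_comp mG).
have F0 z : (0 <= F z)%E by rewrite lee_fin mulr_ge0 ?gamma_ge0.
have G0 t : (0 <= (G t)%:E)%E by rewrite lee_fin gamma_ge0.
have mGE : measurable_fun setT (EFin \o G) by exact/measurable_EFinP.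
transitivity (\int[mu]_x \int[mu]_w F (x, w))%E.
  rewrite -{1}(fineK (gamma_int_fin s1)) {2}/gamma_int -ge0_integralZl_EFin; last 4 first.
  - by [].
  - by move=> t _; exact: G0.
  - exact: mGE.
  - by rewrite fine_ge0 ?gamma_int_ge0.
  apply: eq_integral => x _; rewrite fineK ?gamma_int_fin// muleC.
  have := @ge0_integral_affine R 1 (- x) (EFin \o G) ltr01 mGE G0.
  rewrite invr1 mul1e -[RHS]/(gamma_int s) => <-.
  rewrite -ge0_integralZl_EFin; last 4 first.
  - by [].
  - by move=> t _; exact: G0.
  - by apply: (measurableT_comp mGE); exact: measurable_affine.
  - exact: gamma_ge0.
  by apply: eq_integral => w _; rewrite /F/= mul1r.
rewrite (@fubini_tonelli _ _ _ _ _ mu mu F)//.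
have b0 : (0 <= beta_int (s - 1))%E by apply: integral_ge0 => y _; rewrite lee_fin beta_weight_ge0.
transitivity (\int[mu]_w ((2 `^ (1 - 2 * s))%:E * beta_int (s - 1) * (pos w * (w `^ (2 * s - 1) * expR (- w)))%:E))%E; last first.
  rewrite ge0_integralZl//; last 3 first.
  - by apply/measurable_EFinP; exact: mgamma.
  - by move=> t _; rewrite lee_fin.
  - by rewrite mule_ge0// lee_fin powR_ge0.
apply: eq_integral => w _.
rewrite [X in (_ * (X * _)%:E)%E]indicE mem_setE in_itv/= andbT; have [w0|w0] := ltP 0 w; last first.
  rewrite mul0r mule0 integral0_eq// => x _; rewrite /F /G/= !indicE !mem_setE !in_itv/= !andbT subr_gt0.
  by have [x0|_] := ltP 0 x; rewrite ?mul0r// ltNge (le_trans w0 (ltW x0)) mul0r mulr0.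
rewrite mul1r.
have w20 : 0 < w / 2 by rewrite divr_gt0.
have mFw : measurable_fun setT (fun x => F (x, w)).
  by apply: measurableT_comp => //.
have := @ge0_integral_affine R (w / 2) (w / 2) (fun x => F (x, w)) w20 mFw (fun x => F0 _).
move=> /(congr1 (fun z => (w / 2)%:E * z)%E).
rewrite muleA -EFinM mulfV ?gt_eqF// mul1e => <-.
transitivity ((w / 2)%:E * \int[mu]_y (((w ^+ 2 / 4) `^ (s - 1) * expR (- w))%:E * (beta_weight (s - 1) y)%:E))%E.
  congr (_ * _)%E; apply: eq_integral => y _; rewrite -EFinM /F /G/=; congr (_%:E).
  rewrite /beta_weight !indicE !mem_setE !in_itv/= !andbT.
  rewrite (_ : w / 2 * y + w / 2 = w / 2 * (y - - 1)); last by ring.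
  rewrite (_ : w - _ = w / 2 * (1 - y)); last by field.
  rewrite !pmulr_rgt0// !subr_gt0; have [y1|_] := ltP (- 1) y; last by rewrite !mul0r mulr0.
  have [y2|_] := ltP y 1; last by rewrite !mul0r !mulr0.
  rewrite /= !mul1r mulrACA -expRD -powRM; last 2 first.
  - by rewrite mulr_ge0// ?ltW//; lra.
  - by rewrite mulr_ge0// ?ltW//; lra.
  rewrite [RHS]mulrAC -powRM; last 2 first.
  - by rewrite divr_ge0// sqr_ge0.
  - by nra.
  by congr (_ `^ _ * expR _); field.
rewrite ge0_integralZl_EFin; last 4 first.
- by [].
- by move=> y _; rewrite lee_fin beta_weight_ge0.
- by apply/measurable_EFinP; exact: measurable_beta_weight.
- by rewrite mulr_ge0 ?powR_ge0 ?expR_ge0.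
rewrite muleA -EFinM [RHS]muleAC -EFinM; congr (_%:E * _)%E.
rewrite mulrA [RHS]mulrA; congr (_ * _).
rewrite (_ : w ^+ 2 / 4 = (w / 2) `^ 2); last by rewrite powR_mulrn ?(ltW w20)//; field.
rewrite -powRrM -[X in X * _]powRr1 ?(ltW w20)// -powRD; last by rewrite (gt_eqF w20) implybT.
rewrite powRM ?(ltW w0)// -powR_inv1// -powRrM mulrC.
by congr (_ `^ _ * _ `^ _); ring.
Qed.

Lemma beta_intE s : 1 < s ->
  beta_int (s - 1) = (2 `^ (2 * s - 1) * (Gamma s ^+ 2 / Gamma (2 * s)))%:E.
Proof.
move=> s1; have s2 : 1 < 2 * s by lra.
have := gamma_int_sqr s1; rewrite !gammaE// => h.
have G0 := Gamma_gt0 s2; have p0 : 0 < 2 `^ (1 - 2 * s) :> R by rewrite powR_gt0.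
have b0 : (0 <= beta_int (s - 1))%E by apply: integral_ge0 => y _; rewrite lee_fin beta_weight_ge0.
case: (beta_int (s - 1)) b0 h => [r| |]//; last by rewrite gt0_muley ?lte_fin// gt0_mulye ?lte_fin.
move=> _; rewrite -!EFinM => -[h]; congr (_%:E).
rewrite expr2 h mulfK ?gt_eqF// mulrA -powRD; last by rewrite pnatr_eq0 implybT.
rewrite (_ : 2 * s - 1 + _ = 0); last by ring.
by rewrite powRr0 mul1r.
Qed.

Lemma beta_const_gt0 s : 1 < s -> 0 < 2 `^ (2 * s - 1) * (Gamma s ^+ 2 / Gamma (2 * s)).
Proof.
move=> s1; rewrite mulr_gt0 ?powR_gt0// divr_gt0// ?exprn_gt0 ?Gamma_gt0//; lra.
Qed.

End gamma.

Section ball_volume.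
Context {R : realType} {n : nat}.
Notation mu := (@lebesgue_measure R).
Hypothesis n3 : (3 <= n)%N.

(** The Gaussian integral computed twice: as a product over coordinates it is [pi^(n/2)]; as the
    integral of [exp(-s)] times the volume [omega s^(n/2)] of the ball [|x|^2 < s] it is
    [omega Gamma(n/2 + 1)]. *)
Lemma omega_Gamma : n%:R * @omega R n = 2 * pi `^ (n%:R / 2) / Gamma (n%:R / 2).
Proof.
have n3R : 3 <= n%:R :> R by rewrite (ler_nat R 3 n).
have n21 : 1 < n%:R / 2 :> R by lra.
have G0 := Gamma_gt0 n21.
suff h : ((@omega R n)%:E * gamma_int (n%:R / 2 + 1) = (pi `^ (n%:R / 2))%:E)%E.
  move: h; rewrite gammaE; last by lra.
  rewrite -EFinM => -[]; rewrite GammaS// => h.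
  by rewrite -h; field; rewrite gt_eqF.
pose E : set ('rV[R]_n * R) := [set z | enorm z.1 ^+ 2 < z.2].
have mE : measurable E.
  rewrite -[X in measurable X]setTI; apply: measurable_fun_ltr => //.
  apply: measurable_funX; apply: (measurableT_comp (@measurable_enorm R n)).
  exact: measurable_fst.
have mexpN : measurable_fun setT (fun t : R => expR (- t)).
  by apply: (measurableT_comp (@measurable_expR R)); exact: oppr_measurable.
have gaussE (x : 'rV[R]_n) : expR (- enorm x ^+ 2) = \prod_i gauss_fun (x ord0 i).
  by rewrite sqr_enorm -sumrN expR_sum.
have rhsE : (\int[@rvol R n]_x \int[mu]_s (expR (- s) * \1_E (x, s))%:E =
    (pi `^ (n%:R / 2))%:E)%E.
  transitivity (\int[@rvol R n]_x (\prod_i gauss_fun (x ord0 i))%:E)%E.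
    apply: eq_integral => x _; rewrite -gaussE -integral_exp_tail.
    apply: eq_integral => s _; rewrite mulrC; congr ((_ * _)%:E).
    rewrite !indicE; congr (nat_of_bool _)%:R.
    by apply/idP/idP => /set_mem/=; rewrite ?in_itv/= ?andbT => h; apply/mem_set => //=; rewrite in_itv/= h.
  rewrite -integral_RnE; last 2 first.
  - apply/measurable_EFinP; under eq_fun do rewrite -gaussE.
    apply: (measurableT_comp mexpN); apply: measurable_funX; exact: measurable_enorm.
  - by move=> x; rewrite lee_fin -gaussE expR_ge0.
  rewrite (@integral_Rn_prod R n (fun=> gauss_fun) (fun=> Num.sqrt pi)); last 3 first.
  - by move=> _; exact: measurable_gauss_fun.
  - by move=> _ t; exact: gauss_fun_ge0.
  - by move=> _; exact: integralT_gauss.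
  rewrite prodr_const card_ord; congr (_%:E).
  rewrite -powR_mulrn ?sqrtr_ge0// -powR12_sqrt ?pi_ge0// -powRrM.
  by congr (_ `^ _); field.
rewrite -rhsE -(tonelli_layer (@rvol R n) mE mexpN (fun s => expR_ge0 _)).
rewrite /gamma_int -ge0_integralZl_EFin; last 4 first.
- by [].
- by move=> t _; rewrite lee_fin !mulr_ge0 ?powR_ge0 ?expR_ge0.
- apply/measurable_EFinP; apply: measurable_funM; first exact: measurable_indic.
  by apply: measurable_funM => //; exact: measurable_powR.
- by rewrite ltW// omega_gt0.
apply: eq_integral => s _; rewrite indicE mem_setE in_itv/= andbT; have [s0|s0] := ltP 0 s; last first.
  rewrite mul0r mule0 (_ : [set x | E (x, s)] = set0) ?measure0 ?mule0//.
  by rewrite -subset0 => x; rewrite /E/= ltNge (le_trans s0 (sqr_ge0 _)).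
rewrite mul1r.
rewrite (_ : [set x | E (x, s)] = eball (Num.sqrt s)); last first.
  have h (x : 'rV[R]_n) : (enorm x ^+ 2 < s) = (enorm x < Num.sqrt s).
    by rewrite -{1}(sqr_sqrtr (ltW s0)) ltr_pXn2r// ?nnegrE ?enorm_ge0 ?sqrtr_ge0.
  by apply/seteqP; split => x /=; rewrite /E /eball/= h.
rewrite rvol_eball ?sqrtr_gt0// -!EFinM; congr (_%:E).
rewrite -powR_mulrn ?sqrtr_ge0// -powR12_sqrt ?(ltW s0)// -powRrM.
rewrite (_ : n%:R / 2 + 1 - 1 = 2^-1 * n%:R); last by field.
by ring.
Qed.

End ball_volume.

(** * Transport to the beta weight *)

Section primitive.
Context {R : realType}.
Notation mu := (@lebesgue_measure R).
Variables (a : R) (w : R -> R).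
Hypotheses (mw : measurable_fun setT w) (w0 : forall x, 0 <= w x).
Hypothesis wfin : (\int[mu]_x (w x)%:E < +oo)%E.

Definition primitive (y : R) : R := (\int[mu]_(t in `[a, y]) w t)%R.

Let integrable_w (A : set R) : measurable A -> mu.-integrable A (EFin \o w).
Proof.
move=> mA; apply: (@integrableS _ _ _ mu setT) => //.
apply/integrableP; split; first exact/measurable_EFinP.
rewrite (_ : (\int[mu]_x `|(EFin \o w) x| = \int[mu]_x (w x)%:E)%E)//.
by apply: eq_integral => x _ /=; rewrite ger0_norm.
Qed.

Lemma primitiveE y : (\int[mu]_(t in `[a, y]) (w t)%:E = (primitive y)%:E)%E.
Proof.
rewrite /primitive /Rintegral fineK//; apply: integrable_fin_num => //.
exact: integrable_w.
Qed.

Lemma primitive_le_total y : ((primitive y)%:E <= \int[mu]_x (w x)%:E)%E.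
Proof.
rewrite -primitiveE; apply: ge0_subset_integral => //; first exact/measurable_EFinP.
by move=> t _; rewrite lee_fin.
Qed.

Lemma primitive_start : primitive a = 0.
Proof.
by apply: EFin_inj; rewrite -primitiveE set_itv1 integral_set1.
Qed.

Lemma is_derive_primitive y : a < y -> {for y, continuous w} ->
  is_derive y (1 : R) primitive (w y).
Proof.
move=> ay cw; have yy1 : y < y + 1 by rewrite ltrDl.
have [d e] := continuous_FTC1_closed yy1 (integrable_w (measurable_itv _)) ay cw.
by apply: DeriveDef => //; rewrite -derive1E.
Qed.

Lemma primitive_continuous x y : a <= x -> {within `[x, y], continuous primitive}.
Proof.
move=> ax; have [xy|yx] := leP x y; last first.
  by rewrite set_itv_ge ?bnd_simp -?ltNge//; exact: continuous_subspace0.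
apply: (@continuous_subspaceW R R _ `[a, y]%classic).
  by apply: subset_itvr; rewrite bnd_simp.
apply: parameterized_integral_continuous; first exact: le_trans xy.
exact: integrable_w.
Qed.

Lemma primitive_lt x y : a <= x -> x < y ->
  (forall t, x < t < y -> {for t, continuous w}) ->
  (forall t, x < t < y -> 0 < w t) -> primitive x < primitive y.
Proof.
move=> ax xy cw wp; have [|t] := @MVT R primitive w x y xy _ (@primitive_continuous x y ax).
  move=> t; rewrite in_itv/= => txy; apply: is_derive_primitive; last exact: cw.
  by case/andP: txy => /(le_lt_trans ax).
rewrite in_itv/= => txy e.
by rewrite -subr_gt0 e mulr_gt0 ?subr_gt0 ?wp.
Qed.

End primitive.

Section transport.
Context {R : realType}.
Notation mu := (@lebesgue_measure R).
Variables (k B : R).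
Hypothesis B0 : 0 < B.
Hypothesis BE : beta_int k = B%:E.

Notation w := (beta_weight k).
Notation J := (primitive (- 1) w).

Let mw : measurable_fun setT w := measurable_beta_weight k.
Let w0 x : 0 <= w x. Proof. exact: beta_weight_ge0. Qed.
Let wfin : (\int[mu]_x (w x)%:E < +oo)%E. Proof. by rewrite -/(beta_int k) BE ltry. Qed.

Let wE y : - 1 < y < 1 -> w y = (1 - y ^+ 2) `^ k.
Proof. by move=> y1; rewrite /beta_weight indicE mem_set/= ?in_itv//= mul1r. Qed.

Let onemsq_gt0 (y : R) : - 1 < y < 1 -> 0 < 1 - y ^+ 2.
Proof. by move=> /andP[y1 y2]; nra. Qed.

Let w_gt0 y : - 1 < y < 1 -> 0 < w y.
Proof. by move=> y1; rewrite wE// powR_gt0// onemsq_gt0. Qed.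

Lemma powR_comp_continuous (f : R -> R) (c v : R) : {for v, continuous f} -> 0 < f v ->
  {for v, continuous (fun x => f x `^ c)}.
Proof.
move=> cf fv; apply: (@continuous_comp R R R f (fun y => y `^ c)) => //.
apply: differentiable_continuous; apply/derivable1_diffP.
by have [] := @is_derive1_powR R c (f v) fv.
Qed.

Let cw y : - 1 < y < 1 -> {for y, continuous w}.
Proof.
move=> y1; have yI : (y : R) \in `]-1, 1[%classic by apply/mem_set; rewrite /= in_itv.
have : {for y, continuous (fun x : R => (1 - x ^+ 2) `^ k)}.
  apply: powR_comp_continuous; last exact: onemsq_gt0.
  apply: (@cvgB _ _ _ (nbhs y)); first exact: cvg_cst.
  exact: exprn_continuous.
move=> h; rewrite /prop_for /continuous_at wE//; apply: cvg_trans h; apply: near_eq_cvg.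
near=> x; rewrite wE//; apply/andP; split; near: x.
- by case/andP: y1 => + _; exact: near_gt_pt.
- by case/andP: y1 => _; exact: near_lt_pt.
Unshelve. all: by end_near. Qed.

Let J1 : J 1 = B.
Proof.
apply: EFin_inj; rewrite -(primitiveE _ mw w0 wfin) -BE /beta_int integral_mkcond.
apply: eq_integral => y _; rewrite patchE; case: ifPn => // /negP yI.
rewrite /beta_weight indicE memNset ?mul0r//= => y1; apply: yI; apply/mem_set => /=.
exact: subset_itv_oo_cc.
Qed.

Let J_lt x y : - 1 <= x -> x < y -> y <= 1 -> J x < J y.
Proof.
move=> x1 xy y1; have I t : x < t < y -> - 1 < t < 1.
  by move=> /andP[xt ty]; rewrite (le_lt_trans x1 xt) (lt_le_trans ty y1).
apply: (primitive_lt mw w0 wfin) => //.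
- by move=> t /I; exact: cw.
- by move=> t /I; exact: w_gt0.
Qed.

Let J_inj x y : - 1 < x < 1 -> - 1 < y < 1 -> J x = J y -> x = y.
Proof.
move=> /andP[x1 x2] /andP[y1 y2] e; have [xy|yx|//] := ltgtP x y.
- by have := J_lt (ltW x1) xy (ltW y2); rewrite e ltxx.
- by have := J_lt (ltW y1) yx (ltW x2); rewrite e ltxx.
Qed.

(* Inverse of the normalised distribution function of [beta_weight k]. *)
Definition theta (r : R) : R := xget 0 [set y | - 1 < y < 1 /\ J y = B * r].

(** [J] runs continuously from 0 to [B] on [[-1, 1]], and [0 < r < 1] keeps the solution away from
    both ends. *)
Lemma thetaP (r : R) : 0 < r < 1 -> - 1 < theta r < 1 /\ J (theta r) = B * r.
Proof.
move=> /andP[r0 r1]; rewrite /theta.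
case: xgetP => [y _ //|nex].
have Br0 : 0 < B * r by rewrite mulr_gt0.
have BrB : B * r < B by rewrite gtr_pMr.
have J0 : J (- 1) = 0 by exact: (primitive_start (-1) mw w0 wfin).
have [||y] := @IVT R J (- 1) 1 (B * r) _ (primitive_continuous mw w0 wfin (lexx _)).
- lra.
- by rewrite J0 J1 minEle maxEle (ltW B0) !ltW.
rewrite in_itv/= => /andP[y1 y2] Jy; exfalso; apply: (nex y) => /=; split => //.
apply/andP; split; rewrite lt_neqAle ?y1 ?y2 andbT; apply/eqP => e.
- by move: Br0; rewrite -Jy -e J0 ltxx.
- by move: BrB; rewrite -Jy e J1 ltxx.
Qed.

(** The rule for the derivative of an inverse, applied to [J / B], whose derivative [w / B] is
    positive inside the interval. *)
Lemma is_derive_theta (r : R) : 0 < r < 1 ->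
  is_derive r (1 : R) theta (B / (1 - theta r ^+ 2) `^ k).
Proof.
move=> r01; have [t1 Jt] := thetaP r01.
pose f (y : R) := B^-1 * J y.
have fD (y : R) : - 1 < y < 1 -> is_derive y (1 : R) f (B^-1 * w y).
  move=> y1; have y1' := y1; case/andP: y1' => ym _.
  exact: (is_deriveZ _ (is_derive_primitive mw w0 wfin ym (cw y1))).
have ft : f (theta r) = r by rewrite /f Jt mulKf ?gt_eqF.
have nt : \forall y \near theta r, - 1 < y < 1.
  case/andP: t1 => t1 t2; near=> y; apply/andP; split; near: y; [exact: near_gt_pt|exact: near_lt_pt].
have fpos (y : R) : - 1 < y < 1 -> 0 < f y < 1.
  move=> /andP[y1 y2]; have := J_lt (lexx _) y1 (ltW y2).
  rewrite (primitive_start (-1) mw w0 wfin) => Jy; rewrite mulr_gt0 ?invr_gt0//=.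
  by rewrite /f mulrC ltr_pdivrMr// mul1r -[ltRHS]J1 J_lt// ltW.
rewrite -[X in is_derive X]ft.
apply: (is_derive_eq (@is_derive_inverse R f theta (B^-1 * w (theta r)) (theta r) _ _ (fD _ t1) _)).
- near=> y; have y1 : - 1 < y < 1 by near: y.
  have [ty Jty] := thetaP (fpos y y1).
  by apply: J_inj => //; rewrite Jty /f mulVKf ?gt_eqF.
- near=> y; apply: differentiable_continuous; apply/derivable1_diffP.
  have y1 : - 1 < y < 1 by near: y.
  by have [] := fD y y1.
- by rewrite mulf_neq0 ?invr_eq0 ?gt_eqF// w_gt0.
- by rewrite wE// invfM invrK.
Unshelve. all: by end_near. Qed.

End transport.

(** * The pointwise weighted AM-GM inequality *)

Section transport_inequality.
Context {R : realType}.

(** Monomials are written as exponentials, so that matching their exponents becomes a linear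
    identity in [e1], [e2], [e3]. *)
Lemma weighted_amgm_exp (c1 c2 e1 e2 e3 t : R) : 0 <= c1 -> 0 <= c2 -> 0 < t < 1 ->
  e3 = (1 - t) * e1 + t * e2 ->
  c1 `^ (1 - t) * c2 `^ t * expR e3 <= (1 - t) * c1 * expR e1 + t * c2 * expR e2.
Proof.
move=> c10 c20 t01 ->.
have := @weighted_amgm R (c1 * expR e1) (c2 * expR e2) t.
rewrite !mulr_ge0 ?expR_ge0// => /(_ isT isT t01).
rewrite !powRM ?expR_ge0// -!expRM mulrACA -expRD.
by rewrite (mulrC e1) (mulrC e2) !mulrA.
Qed.

(** The first term gets weight [2 / q] and the second [1 / al]; dividing by these weights produces
    the factors [q / 2] and [al] in the constant. The powers of [w] cancel because
    [2 / q = (al - 1) / al], and the exponent of [r] in [p] is the one for which the remaining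
    powers of [r] and [G] recombine into [p]. *)
Lemma transport_amgm (N q m sg B Z r G w al p : R) : 3 <= N -> 2 < q -> 0 < m -> 0 < sg ->
  0 < B -> 0 < Z -> 0 < r -> 0 < G -> 0 < w ->
  al = q / (q - 2) -> p = r `^ (- (1 - q * (N - 2) / (2 * N))) * G `^ (q / 2) ->
  (m ^+ 2 * (q / 2)) `^ (2 / q) * (m * B * al * sg / Z) `^ (al^-1) * p <=
  m ^+ 2 * w * (r `^ (- (2 / N)) * G)
    + sg * (m * (B / w `^ (al - 1)) * (p / Z)) * r `^ ((N - 2) / N) * G.
Proof.
move=> N3 q2 m0 sg0 B0 Z0 r0 G0 w0 alE; have N0 : 0 < N by lra.
have q20 : 0 < q - 2 by lra.
have q0 : 0 < q by lra.
have al0 : 0 < al by rewrite alE divr_gt0.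
have alV : al^-1 = 1 - 2 / q by rewrite alE; field; rewrite !gt_eqF.
have tq : 1 - al^-1 = 2 / q by rewrite alV; ring.
have t01 : 0 < al^-1 < 1.
  rewrite invr_gt0 al0 alV /=; have : 0 < 2 / q by rewrite divr_gt0.
  lra.
have : expR (ln r) = r by rewrite lnK ?posrE.
have : expR (ln G) = G by rewrite lnK ?posrE.
have : expR (ln w) = w by rewrite lnK ?posrE.
move: (ln r) (ln G) (ln w) => lr lG lw <- <- <- pE'.
pose e1 := lw - lr * (2 / N) + lG.
pose e3 := lr * - (1 - q * (N - 2) / (2 * N)) + lG * (q / 2).
pose e2 := - (lw * (al - 1)) + e3 + lr * ((N - 2) / N) + lG.
have pE : p = expR e3 by rewrite pE' -!expRM -expRD.
have := @weighted_amgm_exp (m ^+ 2 * (q / 2)) (m * B * al * sg / Z) e1 e2 e3 al^-1.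
rewrite tq pE.
have c1 : 0 <= m ^+ 2 * (q / 2) by rewrite mulr_ge0 ?sqr_ge0// divr_ge0// ltW.
have c2 : 0 <= m * B * al * sg / Z by rewrite divr_ge0 ?(ltW Z0)// !mulr_ge0// ltW.
move=> /(_ c1 c2 t01) h; apply: le_trans (h _) _.
  rewrite alV /e1 /e2 /e3 alE; field.
  by rewrite !gt_eqF//; lra.
rewrite -!expRM -expRN le_eqVlt; apply/orP; left; apply/eqP; congr (_ + _).
  rewrite /e1 !expRD mulrN; field; lra.
rewrite /e2 !expRD; field; rewrite !gt_eqF//; lra.
Qed.
End transport_inequality.

(** * Integrability of the rearrangement against power weights *)

Section weighted_integrability.
Context {R : realType} {n : nat}.
Notation mu := (@lebesgue_measure R).
Notation om := (@omega R n).
Notation rp := (@rpow R n).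
Variables (g : 'rV[R]_n -> R) (Cg : R).
Hypotheses (mg : measurable_fun setT g) (g0 : forall x, 0 <= g x).
Hypothesis gC : forall x, g x <= Cg * dweight x.
Hypothesis cg : continuous g.
Hypothesis n0 : (0 < n)%N.
Notation gs := (gstar g).

Lemma rpow_integral_fin (b : R) : b < 1 ->
  (\int[mu]_v (\1_(`]0%R, om[%classic : set R) v * rp (- b) v)%:E < +oo)%E.
Proof.
move=> b1; have o0 := @omega_gt0 R n; have b0 : 0 < 1 - b by lra.
rewrite integral_indicM; apply: le_lt_trans (ltry (om / (1 - b) * rp (1 - b) om)).
apply: (@ge0_integral_derive_le R (rp (- b)) (fun v => om / (1 - b) * rp (1 - b) v)) => //.
- move=> v /andP[v0 _]; apply: (is_derive_eq (is_deriveZ _ (is_derive_rpow (1 - b) v0))).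
  rewrite (_ : 1 - b - 1 = - b); last by ring.
  by rewrite /GRing.scale/= mulrA; field; rewrite ?gt_eqF.
- by move=> v /andP[v0 _]; exact: rpow_continuous.
- by move=> v _; exact: rpow_ge0.
- by move=> v _; rewrite mulr_ge0 ?rpow_ge0// divr_ge0// ltW.
Qed.

Lemma powR_le_lin (x C r : R) : 0 <= x <= C -> 1 <= r -> x `^ r <= C `^ (r - 1) * x.
Proof.
move=> /andP[]; rewrite le_eqVlt => /predU1P[<- _ r1|x0 xC r1].
  by rewrite mulr0 powR0// gt_eqF//; lra.
have -> : x `^ r = x `^ (r - 1) * x.
  rewrite -{3}(powRr1 (ltW x0)) -powRD ?subrK//.
  by apply/implyP => _; rewrite gt_eqF.
rewrite ler_wpM2r ?(ltW x0)//.
by apply: ge0_ler_powR; rewrite ?nnegrE ?subr_ge0 ?(ltW x0)// (le_trans (ltW x0)).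
Qed.

(** Split at [v = om], that is, at radius 1. Below, [gs] is bounded and [rp (- b)] is integrable as
    [b < 1]; above, the weight is at most 1 as [b >= 0], and [gs^r <= Cg^(r-1) gs] is integrable. *)
Lemma integral_rpow_gstar_fin (b r : R) : 0 <= b < 1 -> 1 <= r ->
  (\int[mu]_v (rp (- b) v * gs v `^ r)%:E < +oo)%E.
Proof.
move=> /andP[b0 b1] r1; have o0 := @omega_gt0 R n.
have gs0 v : 0 <= gs v by exact: (gstar_ge0 g0 gC).
have gsC v : gs v <= Cg by exact: (gstar_le g0 gC).
have C0 : 0 <= Cg := le_trans (gs0 0) (gsC 0).
have mgs : measurable_fun setT gs := measurable_gstar mg g0 gC cg n0.
have r0 : 0 < r by lra.
have m1 : measurable_fun setT (fun v => \1_(`]0%R, om[%classic : set R) v * rp (- b) v).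
  by apply: measurable_funM; [exact: measurable_indic|exact: measurable_rpow].
apply: (@le_lt_trans _ _ ((Cg `^ r)%:E * \int[mu]_v (\1_(`]0%R, om[%classic : set R) v * rp (- b) v)%:E
  + (Cg `^ (r - 1))%:E * \int[mu]_v (gs v)%:E)%E); last first.
  rewrite lte_add_pinfty// lte_mul_pinfty ?lee_fin ?powR_ge0//.
  - exact: rpow_integral_fin.
  - exact: (integral_gstar_fin mg g0 gC cg n0).
rewrite -!ge0_integralZl_EFin; do ?[by []|exact/measurable_EFinP|exact: powR_ge0
  |by move=> v _; rewrite lee_fin ?mulr_ge0 ?rpow_ge0].
rewrite -ge0_integralD; do ?[by []|by apply: measurable_funeM; exact/measurable_EFinP
  |by move=> v _; rewrite -EFinM lee_fin ?mulr_ge0 ?rpow_ge0 ?powR_ge0].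
apply: ge0_le_integral => //.
- by move=> v _; rewrite lee_fin mulr_ge0 ?rpow_ge0 ?powR_ge0.
- apply/measurable_EFinP; apply: measurable_funM; first exact: measurable_rpow.
  exact: (measurableT_comp (measurable_powR r)).
- by apply: emeasurable_funD; apply: measurable_funeM; exact/measurable_EFinP.
move=> v _; rewrite -!EFinM -EFinD lee_fin.
have [v0|v0] := leP v 0.
  rewrite (gstar_le0 _ v0) powR0 ?gt_eqF// mulr0 addr_ge0// mulr_ge0 ?powR_ge0//.
  by rewrite mulr_ge0 ?rpow_ge0.
have [vo|ov] := ltP v om.
  rewrite indicE mem_set/= ?in_itv/= ?v0// mul1r mulrC -[leLHS]addr0 lerD//; last first.
    by rewrite mulr_ge0 ?powR_ge0.
  rewrite ler_wpM2r ?rpow_ge0//; apply: ge0_ler_powR; rewrite ?nnegrE//; lra.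
rewrite -[leLHS]add0r lerD//; first by rewrite !mulr_ge0 ?powR_ge0 ?rpow_ge0.
apply: (@le_trans _ _ (gs v `^ r)); last by apply: powR_le_lin; rewrite ?gs0 ?gsC.
rewrite ler_piMl ?powR_ge0// /rpow powRN invf_le1.
  apply: (@le_trans _ _ (1 `^ b)); first by rewrite powR1.
  by apply: ge0_ler_powR; rewrite ?nnegrE ?divr_ge0 ?(ltW v0) ?(ltW o0)// ler_pdivlMr// mul1r.
by rewrite powR_gt0// divr_gt0.
Qed.

End weighted_integrability.

(** * The choice of [psi] and the radial inequality *)

Section radial_hardy_sobolev.
Context {R : realType} {n : nat}.
Notation mu := (@lebesgue_measure R).
Notation om := (@omega R n).
Notation rp := (@rpow R n).
Notation N := (n%:R : R).
Variables (g : 'rV[R]_n -> R) (Cg : R).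
Hypotheses (mg : measurable_fun setT g) (g0 : forall x, 0 <= g x).
Hypothesis gC : forall x, g x <= Cg * dweight x.
Hypothesis cg : continuous g.
Hypothesis n2 : (2 < n)%N.
Variables (rho : 'rV[R]_n -> R) (Cr Ct : R).
Hypotheses (mrho : measurable_fun setT rho) (rho0 : forall x, 0 <= rho x).
Hypothesis rhoC : forall x, rho x <= Cr * dweight x.
Hypothesis Ct0 : 0 <= Ct.
Hypothesis gT : forall x y (e : R), 0 < e <= 1 -> enorm y < e ->
  g (x + y) <= g x + e * rho x + Ct * e ^+ 2 * dweight x.
Variable En : 'rV[R]_n -> R.
Hypotheses (mEn : measurable_fun setT En) (En0 : forall x, 0 <= En x).
Hypothesis rhoEn : forall x, rho x ^+ 2 <= 4 * g x * En x.
Variables (q a B : R).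
Hypotheses (q2 : 2 < q) (qle : q * (N - 2) <= 2 * N) (a0 : 0 < a) (aN : a < (N - 2) / 2).

Notation gs := (gstar g).
Notation D := (gdom g).
Let al : R := q / (q - 2).
Let m : R := (N - 2 - 2 * a) / 2.
Let b : R := 1 - q * (N - 2) / (2 * N).
Let sg : R := N * om.
Hypothesis B0 : 0 < B.
Hypothesis BE : beta_int (al - 1) = B%:E.

(* Written in the volume variable, this is [r `^ (- s) * gs `^ (q / 2)] with
   [s = n (qs - q) / qs = n b] the exponent of the weight in the theorem. *)
Definition trial_density (v : R) : R := rp (- b) v * gs v `^ (q / 2).
Notation p := trial_density.

Let n0 : (0 < n)%N. Proof. exact: ltn_trans n2. Qed.
Let N3 : 3 <= N. Proof. by rewrite (ler_nat R 3 n). Qed.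
Let o0 : 0 < om. Proof. exact: omega_gt0. Qed.
Let sg0 : 0 < sg. Proof. by rewrite mulr_gt0// ltr0n. Qed.
Let m0 : 0 < m. Proof. by move: aN; rewrite /m; lra. Qed.
Let q0 : 0 < q. Proof. by move: q2; lra. Qed.

Let b01 : 0 <= b < 1.
Proof.
have h : 0 < q * (N - 2) / (2 * N) by rewrite divr_gt0 ?mulr_gt0//; move: aN a0 q2 N3; lra.
rewrite /b; apply/andP; split; last by move: aN a0 q2 N3; lra.
by rewrite subr_ge0 ler_pdivrMr ?mul1r//; move: aN a0 q2 N3; lra.
Qed.

Let gs0 v : 0 <= gs v. Proof. exact: (gstar_ge0 g0 gC). Qed.
Let mgs : measurable_fun setT gs. Proof. exact: (measurable_gstar mg g0 gC cg n0). Qed.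

Let p0 v : 0 <= p v. Proof. by rewrite mulr_ge0 ?rpow_ge0 ?powR_ge0. Qed.

Let mp : measurable_fun setT p.
Proof.
apply: measurable_funM; first exact: measurable_rpow.
exact: (measurableT_comp (measurable_powR _)).
Qed.

Let pfin : (\int[mu]_v (p v)%:E < +oo)%E.
Proof. by apply: (integral_rpow_gstar_fin mg g0 gC cg n0 b01); move: aN a0 q2 N3; lra. Qed.

Let p_gt0 v : D v -> 0 < p v.
Proof. by move=> [v0 gv]; rewrite mulr_gt0 ?rpow_gt0 ?powR_gt0. Qed.

Let cgs v : D v -> {for v, continuous gs}.
Proof. by move=> [v0 _]; exact: (gstar_continuous mg g0 gC cg n0 v0). Qed.

Let crp c v : D v -> {for v, continuous (rp c)}.
Proof. by move=> [v0 _]; exact: rpow_continuous. Qed.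

Let cp v : D v -> {for v, continuous p}.
Proof.
move=> Dv; apply: (@cvgM _ _ (nbhs v)); first exact: crp.
by apply: powR_comp_continuous; [exact: cgs|exact: Dv.2].
Qed.

Let Z : R := fine (\int[mu]_v (p v)%:E)%E.

Let ZE : (\int[mu]_v (p v)%:E = Z%:E)%E.
Proof.
by rewrite fineK// ge0_fin_numE//; apply: integral_ge0 => v _; rewrite lee_fin.
Qed.

Notation P := (primitive 0 p).

(** Strictness at the upper end comes from [gdom] being open: an interval to the right of [v] still
    carries mass. *)
Let P_bounds v : D v -> 0 < P v < Z.
Proof.
move=> Dv; have [v0 gv] := Dv; apply/andP; split.
  rewrite -[ltLHS](primitive_start 0 mp p0 pfin); apply: (primitive_lt mp p0 pfin) => // t /andP[t0 tv].
  - by apply: cp; exact: (gdom_le mg g0 gC Dv t0 (ltW tv)).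
  - by apply: p_gt0; exact: (gdom_le mg g0 gC Dv t0 (ltW tv)).
have /nbhs_ballP[e /= e0 eD] := gdom_near mg g0 gC cg n2 Dv.
have vD t : v < t < v + e -> D t.
  move=> /andP[vt te]; apply: eD; rewrite /ball/= ltr_distlC; apply/andP; split; move: aN a0 q2 N3; lra.
have ve : v < v + e by rewrite ltrDl.
apply: (@lt_le_trans _ _ (P (v + e))); last first.
  by rewrite -lee_fin -ZE; exact: (primitive_le_total 0 mp p0 pfin).
apply: (primitive_lt mp p0 pfin) => //; first exact: ltW.
- by move=> t /vD; exact: cp.
- by move=> t /vD; exact: p_gt0.
Qed.

Let r v : R := P v / Z.
Notation th := (theta (al - 1) B).

Let Z_gt0 v : D v -> 0 < Z.
Proof. by move=> /P_bounds/andP[]; exact: lt_trans. Qed.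

Let r01 v : D v -> 0 < r v < 1.
Proof.
move=> Dv; have /andP[P0 PZ] := P_bounds Dv; have Z0 := Z_gt0 Dv.
by rewrite /r divr_gt0//= ltr_pdivrMr// mul1r.
Qed.

Let w v : R := 1 - th (r v) ^+ 2.
Let psi v : R := (N - 2) / 2 + m * th (r v).
Let dpsi v : R := m * (B / w v `^ (al - 1)) * (p v / Z).

Let th1 v : D v -> - 1 < th (r v) < 1.
Proof. by move=> Dv; have [] := thetaP B0 BE (r01 Dv). Qed.

Let w_gt0 v : D v -> 0 < w v.
Proof. by move=> /th1/andP[t1 t2]; rewrite /w; nra. Qed.

Let thP v : D v -> is_derive v (1 : R) (fun v => th (r v)) (B / w v `^ (al - 1) * (p v / Z)).
Proof.
move=> Dv; have rP : is_derive v (1 : R) r (p v / Z).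
  have -> : r = Z^-1 \*: (P : R -> R) by apply/funext => x /=; rewrite /r mulrC.
  by have := is_deriveZ Z^-1 (is_derive_primitive mp p0 pfin Dv.1 (cp Dv)); rewrite [_ *: _]mulrC.
exact: (@is_derive1_comp R th r v _ _ (is_derive_theta B0 BE (r01 Dv)) rP).
Qed.

Let psiP v : D v -> is_derive v (1 : R) psi (dpsi v).
Proof.
move=> Dv; have h := is_deriveZ m (thP Dv).
have := is_deriveD (is_derive_cst ((N - 2) / 2) v (1 : R)) h.
by rewrite add0r [_ *: _]mulrA.
Qed.

Let cth v : D v -> {for v, continuous (fun v => th (r v))}.
Proof.
move=> Dv; apply: differentiable_continuous; apply/derivable1_diffP.
by have [] := thP Dv.
Qed.

Let cw v : D v -> {for v, continuous w}.
Proof.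
move=> Dv; apply: (@cvgB _ _ _ (nbhs v)); first exact: cvg_cst.
apply: (@continuous_comp R R R (fun v => th (r v)) (fun x => x ^+ 2)); first exact: cth.
exact: exprn_continuous.
Qed.

Let cdpsi v : D v -> {for v, continuous dpsi}.
Proof.
move=> Dv; apply: (@cvgM _ _ (nbhs v)); last first.
  by apply: (@cvgM _ _ (nbhs v)); [exact: cp|exact: cvg_cst].
apply: (@cvgM _ _ (nbhs v)); first exact: cvg_cst.
apply: (@cvgM _ _ (nbhs v)); first exact: cvg_cst.
apply: (@cvgV _ _ (nbhs v)); first by rewrite gt_eqF// powR_gt0// w_gt0.
by apply: powR_comp_continuous; [exact: cw|exact: w_gt0].
Qed.

Let dpsi0 v : D v -> 0 <= dpsi v.
Proof.
move=> Dv; have Z0 := Z_gt0 Dv; have wk := powR_gt0 (al - 1) (w_gt0 Dv).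
by rewrite /dpsi; apply: mulr_ge0; [apply: mulr_ge0; [exact: ltW|apply: divr_ge0; exact: ltW]|apply: divr_ge0; [exact: p0|exact: ltW]].
Qed.

Let psi_bounds v : D v -> 0 <= psi v <= N - 2.
Proof. by move=> /th1/andP[t1 t2]; rewrite /psi; move: a0 aN N3; rewrite /m; nra. Qed.

Let cpsi v : D v -> {for v, continuous psi}.
Proof.
move=> Dv; apply: differentiable_continuous; apply/derivable1_diffP.
by have [] := psiP Dv.
Qed.

Let K : R := (m ^+ 2 * (q / 2)) `^ (2 / q) * (m * B * al * sg / Z) `^ (al^-1).

Let X v : R := rp (- (2 / N)) v * gs v.

(** The right-hand side splits into [sg dpsi r^(n-2) gs] and [(N - 2) psi X]. The quadratic identity
    for [psi] rewrites the second as [psi^2 X + a (N - 2 - a) X + m^2 w X], and [transport_amgm]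
    bounds the last of these together with the first from below by [K p]. *)
Let pointwise v : D v ->
  psi v ^+ 2 * X v + (a * (N - 2 - a) * X v + K * p v) <=
  sg * ((dpsi v * rp ((N - 2) / N) v + psi v * ((N - 2) / N / om * rp ((N - 2) / N - 1) v)) * gs v).
Proof.
move=> Dv; have [v0 gv] := Dv.
have h := @transport_amgm R N q m sg B Z (v / om) (gs v) (w v) al (p v) N3 q2 m0 sg0 B0 (Z_gt0 Dv)
  (divr_gt0 v0 o0) gv (w_gt0 Dv) erefl erefl.
rewrite -/(rp (- (2 / N)) v) -/(rp ((N - 2) / N) v) -/(X v) -/(dpsi v) -/K in h.
have N0 : N != 0 by rewrite gt_eqF//; move: aN a0 q2 N3; lra.
rewrite (_ : (N - 2) / N - 1 = - (2 / N)); last by field.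
rewrite (_ : sg * _ = sg * dpsi v * rp ((N - 2) / N) v * gs v + (N - 2) * psi v * X v); last first.
  by rewrite /sg /X; field; rewrite N0 gt_eqF.
suff e : psi v ^+ 2 * X v + a * (N - 2 - a) * X v + m ^+ 2 * w v * X v = (N - 2) * psi v * X v.
  by rewrite -e; move: aN a0 q2 N3; lra.
by rewrite /psi /w /m; field.
Qed.

Let integral_D (f : R -> R) : (forall v, ~ D v -> f v = 0) ->
  (\int[mu]_(v in D) (f v)%:E = \int[mu]_v (f v)%:E)%E.
Proof.
move=> f0; rewrite integral_mkcond; apply: eq_integral => v _.
by rewrite patchE; case: ifPn => // /negP vD; rewrite f0// => /mem_set.
Qed.

Let gsD v : ~ D v -> gs v = 0.
Proof.
move=> nD; have [v0|v0] := leP v 0; first exact: gstar_le0.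
by apply/eqP; rewrite eq_le gs0 andbT leNgt; apply/negP => gv; exact: nD.
Qed.

Let mD (f : R -> R) : (forall v, D v -> {for v, continuous f}) ->
  measurable_fun D (fun v => (f v)%:E).
Proof.
move=> cf; apply/measurable_EFinP; apply: open_continuous_measurable_fun; first exact: (open_gdom mg g0 gC cg n2).
by move=> v /set_mem; exact: cf.
Qed.

Lemma radial_hardy_sobolev :
  ((a * (N - 2 - a))%:E * \int[mu]_v (X v)%:E
    + ((m ^+ 2 * (q / 2)) `^ (2 / q) * (m * B * al * sg) `^ (al^-1))%:E
      * (\int[mu]_v (p v)%:E) `^ (2 / q)
   <= \int[rvol]_x (En x)%:E)%E.
Proof.
have q20 : 0 < 2 / q by rewrite divr_gt0.
have X0 v : 0 <= X v by rewrite mulr_ge0 ?rpow_ge0.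
(* When [gs] vanishes there is no mass to transport and [Z = 0]; both terms on the left are then
   0. *)
have [D0|/set0P[v1 Dv1]] := eqVneq D set0.
  have z v : gs v = 0 by apply: gsD; rewrite D0.
  rewrite integral0_eq; last by move=> v _; rewrite /X z mulr0.
  rewrite [X in (_ + _ * X `^ _)%E]integral0_eq; last first.
    by move=> v _; rewrite /p z powR0 ?mulr0// gt_eqF// divr_gt0.
  rewrite poweR0r ?gt_eqF// !mule0 adde0; apply: integral_ge0 => x _; by rewrite lee_fin.
have Z0 := Z_gt0 Dv1.
have mdom := measurable_gdom mg g0 gC cg n2.
have cX v : D v -> {for v, continuous X}.
  by move=> Dv; apply: (@cvgM _ _ (nbhs v)); [exact: crp|exact: cgs].
have cpX v : D v -> {for v, continuous (fun v => psi v ^+ 2 * X v)}.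
  move=> Dv; apply: (@cvgM _ _ (nbhs v)); last exact: cX.
  apply: (@continuous_comp R R R psi (fun x => x ^+ 2)); first exact: cpsi.
  exact: exprn_continuous.
have A0 : 0 <= a * (N - 2 - a) by rewrite mulr_ge0//; move: aN a0 q2 N3; lra.
have K0 : 0 <= K by rewrite mulr_ge0 ?powR_ge0.
have Xfin : (\int[mu]_v (X v)%:E < +oo)%E.
  have N20 : 0 <= 2 / N < 1.
    by rewrite divr_ge0 ?ler0n//= ltr_pdivrMr ?mul1r; move: aN a0 q2 N3; lra.
  have := integral_rpow_gstar_fin mg g0 gC cg n0 N20 (lexx 1).
  by under eq_integral do rewrite powRr1//.
(* Finiteness allows this integral to be cancelled from both sides of [radial_lower_bound]. *)
have psifin : (\int[mu]_(v in D) (psi v ^+ 2 * X v)%:E)%E \is a fin_num.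
  rewrite ge0_fin_numE; last by apply: integral_ge0 => v _; rewrite lee_fin mulr_ge0 ?sqr_ge0.
  apply: (@le_lt_trans _ _ (((N - 2) ^+ 2)%:E * \int[mu]_v (X v)%:E)%E); last first.
    by rewrite lte_mul_pinfty// lee_fin sqr_ge0.
  rewrite -integral_D; last by move=> v nD; rewrite /X gsD// mulr0.
  rewrite -ge0_integralZl_EFin; last 4 first.
  - exact: mdom.
  - by move=> v _; rewrite lee_fin.
  - exact: mD.
  - exact: sqr_ge0.
  apply: ge0_le_integral => //.
  - by move=> v _; rewrite lee_fin mulr_ge0 ?sqr_ge0.
  - exact: mD.
  - by apply: measurable_funeM; exact: mD.
  move=> v Dv; rewrite -EFinM lee_fin ler_wpM2r//.
  by have /andP[h1 h2] := psi_bounds Dv; rewrite ler_pXn2r// ?nnegrE//; move: aN a0 q2 N3; lra.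
have al0 : 0 <= al by rewrite divr_ge0//; move: q2; lra.
(* Integrating [K p] gives [K * Z]. As [K] contains [Z^(-1/al)] and [1 - 1/al = 2/q], the mass
   acquires the power of the Sobolev term. *)
have KZ : (K * Z = (m ^+ 2 * (q / 2)) `^ (2 / q) * (m * B * al * sg) `^ (al^-1) * Z `^ (2 / q))%R.
  rewrite /K [(m * B * al * sg / Z) `^ _]powRM; last 2 first.
  - exact: (mulr_ge0 (mulr_ge0 (mulr_ge0 (ltW m0) (ltW B0)) al0) (ltW sg0)).
  - by rewrite invr_ge0 ltW.
  rewrite -!mulrA; congr (_ * (_ * _)).
  rewrite -powR_inv1 ?(ltW Z0)// -powRrM -{2}(powRr1 (ltW Z0)) -powRD; last by rewrite (gt_eqF Z0) implybT.
  by congr (_ `^ _); rewrite /al; field; rewrite !gt_eqF//; move: aN a0 q2 N3; lra.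
rewrite ZE poweR_EFin -EFinM -KZ.
have main := radial_lower_bound mg g0 gC cg n2 mrho rho0 rhoC Ct0 gT mEn En0 rhoEn psiP cdpsi dpsi0
  (fun v Dv => (andP (psi_bounds Dv)).1).
have pD : (\int[mu]_(v in D) (p v)%:E = Z%:E)%E.
  by rewrite integral_D ?ZE// => v nD; rewrite /trial_density gsD// powR0 ?mulr0// gt_eqF// divr_gt0.
have XD : (\int[mu]_(v in D) (X v)%:E = \int[mu]_v (X v)%:E)%E.
  by rewrite integral_D// => v nD; rewrite /X gsD// mulr0.
have AX0 v : 0 <= a * (N - 2 - a) * X v by exact: mulr_ge0.
have Kp0 v : 0 <= K * p v by exact: mulr_ge0.
have pX0 v : 0 <= psi v ^+ 2 * X v by rewrite mulr_ge0 ?sqr_ge0.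
have cAX v : D v -> {for v, continuous (fun v => a * (N - 2 - a) * X v)}.
  by move=> Dv; apply: (@cvgM _ _ (nbhs v)); [exact: cvg_cst|exact: cX].
have cKp v : D v -> {for v, continuous (fun v => K * p v)}.
  by move=> Dv; apply: (@cvgM _ _ (nbhs v)); [exact: cvg_cst|exact: cp].
have cS v : D v -> {for v, continuous (fun v => a * (N - 2 - a) * X v + K * p v)}.
  by move=> Dv; apply: (@cvgD _ _ _ (nbhs v)); [exact: cAX|exact: cKp].
rewrite -(leeD2lE _ _ psifin).
apply: (@le_trans _ _ (\int[mu]_(v in D) (psi v ^+ 2 * X v + (a * (N - 2 - a) * X v + K * p v))%:E)%E).
  rewrite le_eqVlt; apply/orP; left; apply/eqP.
  under [RHS]eq_integral do rewrite EFinD.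
  rewrite ge0_integralD; last 5 first.
  - exact: mdom.
  - by move=> v _; rewrite lee_fin.
  - exact: mD.
  - by move=> v _; rewrite lee_fin addr_ge0.
  - exact: mD.
  congr (_ + _)%E; under [RHS]eq_integral do rewrite EFinD.
  rewrite ge0_integralD; last 5 first.
  - exact: mdom.
  - by move=> v _; rewrite lee_fin.
  - exact: mD.
  - by move=> v _; rewrite lee_fin.
  - exact: mD.
  have scaleD c (f : R -> R) : 0 <= c -> (forall v, 0 <= f v) ->
      (forall v, D v -> {for v, continuous f}) ->
      (\int[mu]_(v in D) (c * f v)%:E = c%:E * \int[mu]_(v in D) (f v)%:E)%E.
    move=> c0 f0 cf; under eq_integral do rewrite EFinM.
    by rewrite ge0_integralZl_EFin//; [move=> v _; rewrite lee_fin|exact: mD].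
  by rewrite !scaleD// XD pD EFinM.
rewrite [leRHS]addeC; apply: (le_trans _ (le_trans main _)); last first.
  rewrite leeD2l// le_eqVlt; apply/orP; left; apply/eqP; apply: eq_integral => v _.
  by rewrite -mulrA.
have cdS v : D v -> {for v, continuous (fun v => (dpsi v * rp ((N - 2) / N) v +
    psi v * ((N - 2) / N / om * rp ((N - 2) / N - 1) v)) * gs v)}.
  move=> Dv; apply: (@cvgM _ _ (nbhs v)); last exact: cgs.
  apply: (@cvgD _ _ _ (nbhs v)); apply: (@cvgM _ _ (nbhs v)).
  - exact: cdpsi.
  - exact: crp.
  - exact: cpsi.
  - by apply: (@cvgM _ _ (nbhs v)); [exact: cvg_cst|exact: crp].
have dS0 v : D v -> 0 <= (dpsi v * rp ((N - 2) / N) v +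
    psi v * ((N - 2) / N / om * rp ((N - 2) / N - 1) v)) * gs v.
  move=> Dv; have h := pointwise Dv; rewrite -(pmulr_rge0 _ sg0).
  by apply: le_trans h; rewrite !addr_ge0.
rewrite -ge0_integralZl_EFin; last 4 first.
- exact: mdom.
- by move=> v Dv; rewrite lee_fin; exact: dS0.
- exact: mD.
- exact: ltW.
apply: ge0_le_integral => //.
- by move=> v _; rewrite lee_fin !addr_ge0.
- by apply: mD => v Dv; apply: (@cvgD _ _ _ (nbhs v)); [exact: cpX|exact: cS].
- by apply: measurable_funeM; exact: mD.
Qed.

End radial_hardy_sobolev.

(** Supplies the comparison hypothesis of [hardy_littlewood] for power weights, which decrease with
    the radius. As [v] is positive, such an [x] is nonzero. *)
Lemma enorm_powR_le_rpow (R : realType) (n : nat) (c : R) (x : 'rV[R]_n) (v : R) :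
  (0 < n)%N -> 0 <= c -> 0 < v -> v <= @omega R n * enorm x ^+ n ->
  enorm x `^ (- c) <= @rpow R n (- (c / n%:R)) v.
Proof.
move=> n0 c0 v0 vx; have o0 := @omega_gt0 R n.
have nR0 : 0 < n%:R :> R by rewrite ltr0n.
have x0 : 0 < enorm x.
  rewrite lt_neqAle enorm_ge0 andbT; apply/eqP => x0.
  by move: (lt_le_trans v0 vx); rewrite -x0 expr0n eqn0Ngt n0 mulr0 ltxx.
have vo : 0 < v / @omega R n by exact: divr_gt0.
rewrite /rpow !powRN lef_pV2 ?posrE ?powR_gt0//.
have -> : enorm x `^ c = (enorm x ^+ n) `^ (c / n%:R).
  by rewrite -powR_mulrn ?(ltW x0)// -powRrM; congr (_ `^ _); field; rewrite gt_eqF.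
apply: ge0_ler_powR; rewrite ?nnegrE ?divr_ge0 ?exprn_ge0 ?(ltW nR0) ?(ltW x0) ?(ltW v0) ?(ltW o0)//.
by rewrite ler_pdivrMr// mulrC.
Qed.

(** Since [(2 al - 1) / al = 2/q + 1], the power of 2 in the beta integral becomes [2^(2/q+1)];
    likewise [m^(4/q) m^(1/al) = m^(2/q+1)], and the two merge into a power of [2 m]. The factor
    [al] turns one [Gamma al] into [Gamma (al + 1)]. *)
Lemma hardy_sobolev_constant (R : realType) (q m s al : R) : 2 < q -> 0 < m -> 0 < s ->
  al = q / (q - 2) ->
  (m ^+ 2 * (q / 2)) `^ (2 / q)
    * (m * (2 `^ (2 * al - 1) * (Gamma al ^+ 2 / Gamma (2 * al))) * al * s) `^ (al^-1) =
  (2 * m) `^ (2 / q + 1) * (s `^ (al^-1) * (q / 2) `^ (2 / q)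
    * (Gamma al * Gamma (al + 1) / Gamma (2 * al)) `^ (al^-1)).
Proof.
move=> q2 m0 s0 alE; have q0 : 0 < q by lra.
have q20 : 0 < q - 2 by lra.
have al1 : 1 < al by rewrite alE ltr_pdivlMr//; lra.
have al0 : 0 < al by lra.
have [G1 G2] : 0 < Gamma al /\ 0 < Gamma (2 * al) by split; apply: Gamma_gt0; lra.
have [qn qn2] : q != 0 /\ q - 2 != 0 by rewrite !gt_eqF.
rewrite GammaS//.
set Q := Gamma al * (al * Gamma al) / Gamma (2 * al).
have Q0 : 0 < Q by rewrite /Q divr_gt0// !mulr_gt0.
have -> : m * (2 `^ (2 * al - 1) * (Gamma al ^+ 2 / Gamma (2 * al))) * al * s =
    m * 2 `^ (2 * al - 1) * s * Q by rewrite /Q; field; rewrite gt_eqF.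
have p0 : 0 <= 2 `^ (2 * al - 1) :> R by exact: powR_ge0.
have [m0' s0' Q0' q0'] := And4 (ltW m0) (ltW s0) (ltW Q0) (ltW q0).
have mp0 := mulr_ge0 m0' p0.
rewrite (powRM _ (sqr_ge0 m) (divr_ge0 q0' (ler0n R 2))) (powRM _ (mulr_ge0 mp0 s0') Q0').
rewrite (powRM _ mp0 s0') (powRM _ m0' p0) (powRM _ (ler0n R 2) m0').
have -> : (m ^+ 2) `^ (2 / q) = m `^ (4 / q).
  by rewrite -powR_mulrn ?(ltW m0)// -powRrM; congr (_ `^ _); field.
have -> : (2 `^ (2 * al - 1)) `^ al^-1 = 2 `^ (2 / q + 1) :> R.
  by rewrite -powRrM; congr (_ `^ _); rewrite alE; field; rewrite ?qn ?qn2.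
have -> : m `^ (2 / q + 1) = m `^ (4 / q) * m `^ al^-1.
  rewrite -powRD; last by rewrite (gt_eqF m0) implybT.
  by congr (_ `^ _); rewrite alE; field; rewrite ?qn ?qn2.
by ring.
Qed.

(* f = u + i v, a complex-valued Schwartz function given by its real and
   imaginary parts u, v; |grad f|^2 = |grad u|^2 + |grad v|^2, |f|^2 = u^2 + v^2 *)
Theorem theorem2 (R : realType) (n : nat) (q a : R)
  (hn : (3 <= n)%N)
  (hq1 : 2 < q) (hq2 : q <= 2 * n%:R / (n%:R - 2))
  (ha1 : 0 < a) (ha2 : a < (n%:R - 2) / 2)
  (u v : 'rV[R]_n -> R) (hu : schwartz u) (hv : schwartz v) :
  let qs := 2 * n%:R / (n%:R - 2) in
  let alpha := q / (q - 2) in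
  let Cq := (2 * pi `^ (n%:R / 2) / Gamma (n%:R / 2)) `^ (alpha^-1)
            * (q / 2) `^ (2 / q)
            * (Gamma alpha * Gamma (alpha + 1) / Gamma (2 * alpha)) `^ (alpha^-1) in
  let D := (n%:R - 2 - 2 * a) `^ (2 / q + 1) * Cq in
  (integral_Rn (fun x => (grad_sq u x + grad_sq v x)%:E)
   >= (a * (n%:R - 2 - a))%:E
        * integral_Rn (fun x => ((enorm x) ^- 2 * (u x ^+ 2 + v x ^+ 2))%:E)
      + D%:E
        * (integral_Rn (fun x => ((enorm x) `^ (- (n%:R * (qs - q) / qs))
                                   * (Num.sqrt (u x ^+ 2 + v x ^+ 2)) `^ q)%:E))
          `^ (2 / q))%E.
Proof.
have n0 : (0 < n)%N by exact: leq_trans hn.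
have N3 : 3 <= n%:R :> R by rewrite (ler_nat R 3 n).
have qs0 : 0 < 2 * n%:R / (n%:R - 2) :> R by rewrite divr_gt0//; lra.
have qle : q * (n%:R - 2) <= 2 * n%:R by rewrite -ler_pdivlMr//; lra.
cbv zeta; set qs := 2 * n%:R / (n%:R - 2); set alpha := q / (q - 2).
have al1 : 1 < alpha by rewrite /alpha ltr_pdivlMr ?mul1r; lra.
pose g := sqmod u v.
have mg : measurable_fun setT g by exact: measurable_sqmod.
have g0 x : 0 <= g x by exact: sqmod_ge0.
have cg : continuous g by exact: sqmod_continuous.
have [Cg _ gC] := sqmod_bound hu hv.
have [Cr _ rhoC] := gradnorm_bound hu hv.
have [Ct Ct0 gT] := sqmod_taylor hu hv.
pose En x := grad_sq u x + grad_sq v x.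
have mEn : measurable_fun setT En by apply: measurable_funD; exact: measurable_grad_sq.
have En0 x : 0 <= En x by rewrite addr_ge0 ?grad_sq_ge0.
have menorm c : measurable_fun setT (fun x : 'rV[R]_n => enorm x `^ c).
  exact: (measurableT_comp (measurable_powR c) measurable_enorm).
have hm : 0 < (n%:R - 2 - 2 * a) / 2 by lra.
have main := radial_hardy_sobolev mg g0 gC cg hn (measurable_gradnorm hu hv)
  (gradnorm_ge0 u v) rhoC Ct0 gT mEn En0 (gradnorm_le u v) hq1 qle ha1 ha2
  (beta_const_gt0 al1) (beta_intE al1).
rewrite hardy_sobolev_constant// in main; last by rewrite mulr_gt0 ?omega_gt0// ltr0n.
rewrite omega_Gamma// (_ : 2 * ((n%:R - 2 - 2 * a) / 2) = n%:R - 2 - 2 * a) in main; last by field.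
(* As a real power, the Hardy weight falls under the same rearrangement lemma as the Sobolev weight;
   at the origin both forms are 0. *)
have nx (x : 'rV[R]_n) : enorm x ^- 2 = enorm x `^ (- 2) by rewrite powRN powR_mulrn// enorm_ge0.
have hardy : (integral_Rn (fun x => (enorm x ^- 2 * g x)%:E) <=
    \int[@lebesgue_measure R]_v (rpow (n := n) (- (2 / n%:R)) v * gstar g v)%:E)%E.
  rewrite integral_RnE; last 2 first.
  - apply/measurable_EFinP; apply: measurable_funM => //.
    by rewrite (_ : (fun x => _) = fun x => enorm x `^ (- 2))//; apply/funext => x; exact: nx.
  - by move=> x; rewrite lee_fin mulr_ge0// invr_ge0 sqr_ge0.
  rewrite (eq_integral (fun x => (enorm x `^ (- 2) * g x `^ 1)%:E)); last first.
    by move=> x _; rewrite nx powRr1.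
  have <- : (\int[@lebesgue_measure R]_v (rpow (n := n) (- (2 / n%:R)) v * gstar g v `^ 1)%:E =
      \int[@lebesgue_measure R]_v (rpow (n := n) (- (2 / n%:R)) v * gstar g v)%:E)%E.
    by apply: eq_integral => w _; rewrite powRr1// (gstar_ge0 g0 gC).
  apply: (hardy_littlewood mg g0 gC cg n0) => //.
  - by move=> x; exact: powR_ge0.
  - exact: measurable_rpow.
  - by move=> w; exact: rpow_ge0.
  - by move=> x w w0 wx; exact: enorm_powR_le_rpow.
have N0 : n%:R != 0 :> R by rewrite gt_eqF//; lra.
have qsn : qs != 0 by rewrite gt_eqF.
pose s := n%:R * (qs - q) / qs.
have s0 : 0 <= s by rewrite divr_ge0 ?(ltW qs0)// mulr_ge0 ?ler0n// subr_ge0.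
have sobolev : (integral_Rn (fun x => (enorm x `^ (- s) * Num.sqrt (g x) `^ q)%:E) <=
    \int[@lebesgue_measure R]_v (trial_density g q v)%:E)%E.
  have gq x : Num.sqrt (g x) `^ q = g x `^ (q / 2).
    by rewrite -powR12_sqrt// -powRrM mulrC.
  rewrite integral_RnE; last 2 first.
  - apply/measurable_EFinP; apply: measurable_funM => //.
    rewrite (_ : (fun x => _) = fun x => g x `^ (q / 2)); last exact/funext.
    exact: (measurableT_comp (measurable_powR _)).
  - by move=> x; rewrite lee_fin mulr_ge0 ?powR_ge0.
  rewrite (eq_integral (fun x => (enorm x `^ (- s) * g x `^ (q / 2))%:E)); last first.
    by move=> x _; rewrite gq.
  rewrite /trial_density (_ : 1 - _ = s / n%:R); last first.
    by rewrite /s /qs; field; rewrite N0 /=; apply/eqP; lra.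
  apply: (hardy_littlewood mg g0 gC cg n0) => //.
  - by lra.
  - by move=> x; exact: powR_ge0.
  - exact: measurable_rpow.
  - by move=> w; exact: rpow_ge0.
  - by move=> x w w0 wx; exact: enorm_powR_le_rpow.
rewrite [leRHS]integral_RnE; last 2 first.
- exact/measurable_EFinP.
- by move=> x; rewrite lee_fin; exact: En0.
(* Both coefficients are nonnegative and [2 / q] is a nonnegative power, so the two integrals may be
   replaced by their rearranged bounds. *)
apply: le_trans main; apply: leeD.
- by apply: lee_wpmul2l => //; rewrite lee_fin mulr_ge0//; lra.
- apply: lee_wpmul2l; first by rewrite lee_fin !mulr_ge0 ?powR_ge0.
  apply: gt0_ler_poweR; rewrite ?in_itv/= ?leey ?andbT//.
  + by rewrite divr_ge0//; lra.
  + by apply: iint_ge0 => x; rewrite lee_fin mulr_ge0 ?powR_ge0.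
  + by apply: integral_ge0 => w _; rewrite lee_fin mulr_ge0 ?rpow_ge0 ?powR_ge0.
Qed.
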